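(* Suppose there exists $p\in\Gamma$ at which the weak bracket condition holds. Then the chain $\tilde Z$ admits a unique invariant probability $\tilde\pi$, and $\tilde\pi$ is absolutely continuous with respect to the Lebesgue measure $\lambda_{M\times E}$ on $M\times E$. Moreover, there exist two constants $c>1$ and $\rho\in(0,1)$ such that, whatever the law of $\tilde Z_0$, for any $n\in\mathbb N$, $$\big\|\mathbb P[\tilde Z_n\in\cdot\,]-\tilde\pi\big\|_{TV}\le c\,\rho^n,$$ where $\|\cdot\|_{TV}$ is the total variation norm.
   Context: Setting. Let $d\ge 1$ and let $E$ be a finite set. For each $i\in E$, $F^i:\mathbb R^d\to\mathbb R^d$ is a smooth bounded vector field with flow $\Phi^i=(\Phi^i_t)$, i.e. $t\mapsto \Phi^i_t(x)=\Phi^i(t,x)$ solves $\dot x=F^i(x)$ with value $x$ at time $0$. $M\subset\mathbb R^d$ is a compact set with $\Phi^i_t(M)\subset M$ for all $i\in E$, $t\ge 0$. Rates $\lambda(x,i,j)$ ($x\in M$, $i,j\in E$) are given such that $x\mapsto\lambda(x,i,j)$ is continuous, $\lambda(x,i,j)\ge 0$ for $i\ne j$, $\lambda(x,i,i)=0$, and for each $x\in M$ the matrix $(\lambda(x,i,j))_{i,j}$ is irreducible. Fix $\lambda>\max_{x\in M,i\in E}\sum_{j\ne i}\lambda(x,i,j)$ and put $Q(x,i,j)=\lambda(x,i,j)/\lambda$ for $i\neq j$, $Q(x,i,i)=1-\sum_{j\ne i}Q(x,i,j)>0$. Chain. Let $(U_n)_{n\ge1}$ be i.i.d. exponential of parameter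 $\lambda$, and $\tilde Z_0=(\tilde X_0,\tilde Y_0)\in M\times E$ independent of them. Define recursively $\tilde Z_n=(\tilde X_n,\tilde Y_n)$ on $M\times E$ by $\tilde X_{n+1}=\Phi^{\tilde Y_n}(U_{n+1},\tilde X_n)$ and $\mathbb P[\tilde Y_{n+1}=j\mid \tilde X_{n+1},\tilde Y_n=i]=Q(\tilde X_{n+1},i,j)$. Accessible set. For $n\ge 1$, $\mathbf i=(i_0,\dots,i_n)\in E^{n+1}$, $\mathbf u=(u_1,\dots,u_n)\in\mathbb R_+^n$, let $\mathbf\Phi^{\mathbf i}_{\mathbf u}=\Phi^{i_{n-1}}_{u_n}\circ\cdots\circ\Phi^{i_0}_{u_1}$. Let $\gamma^+(x)$ be the set of all points $\mathbf\Phi^{\mathbf i}_{\mathbf u}(x)$ (over all $n\ge 1$ and all such $\mathbf i,\mathbf u$), and $\Gamma=\bigcap_{x\in M}\overline{\gamma^+(x)}$. Weak bracket condition. Let $[F,G]$ be the Lie bracket, $\mathcal F_0=\{F^i:i\in E\}$, $\mathcal F_k=\mathcal F_{k-1}\cup\{[F^i,V]:i\in E,\ V\in\mathcal F_{k-1}\}$, and $\mathcal F_k(x)$ the linear span of $\{V(x):V\in\mathcal F_k\}$. The weak bracket condition holds at $x$ if there is $k$ with $\mathcal F_k(x)=\mathbb R^d$. $\lambda_{M\times E}$ is the product of Lebesgue measure on $M$ and counting measure on $E$. *)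

(* Defs.v *)
From HB Require Import structures.
From mathcomp Require Import all_boot all_order all_algebra.
From mathcomp Require Import all_classical all_reals all_analysis.

Set Implicit Arguments.
Unset Strict Implicit.
Unset Printing Implicit Defensive.

Import Order.TTheory GRing.Theory Num.Theory.
Import numFieldNormedType.Exports.

Local Open Scope classical_set_scope.
Local Open Scope ring_scope.

(* Measurable types are pointed in the library, so a finite set carrying the
   discrete sigma-algebra comes with a base point. The base point plays no role
   below beyond making the type nonempty. *)
#[short(type="pfinType")]
HB.structure Definition PointedFinite := {T of isPointed T & Finite T}.

HB.instance Definition _ (E : pfinType) :=
  @isMeasurable.Build default_measure_display E discrete_measurable
    discrete_measurable0 discrete_measurableC discrete_measurableU.

Definition borel_mx_display : measure_display.
Proof. exact: default_measure_display. Qed.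

Section borel_matrix.
Context (R : realType) (m n : nat).

HB.instance Definition _ :=
  @isMeasurable.Build borel_mx_display 'M[R]_(m, n)
    <<s @open 'M[R]_(m, n) >> (@sigma_algebra0 _ setT _)
    (@sigma_algebraC _ _) (@sigma_algebra_bigcup _ setT _).

End borel_matrix.

Section lebesgue.
Context (R : realType) (d : nat).

Definition box (a b : 'rV[R]_d) : set 'rV[R]_d :=
  [set x | forall k, a ord0 k <= x ord0 k <= b ord0 k].

Definition box_volume (a b : 'rV[R]_d) : R := \prod_k (b ord0 k - a ord0 k).

(* Lebesgue outer measure on R^d for d >= 1, by countable covers with boxes;
   on Borel sets it is Lebesgue measure. *)
Definition lebesgue_rV (A : set 'rV[R]_d) : \bar R :=
  ereal_inf [set v | exists a b : nat -> 'rV[R]_d,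
    [/\ forall n k, a n ord0 k <= b n ord0 k,
        A `<=` \bigcup_n box (a n) (b n) &
        v = (\sum_(0 <= n <oo) (box_volume (a n) (b n))%:E)%E]].

(* The product of Lebesgue measure on M and counting measure on E, as a measure
   on R^d * E that does not charge the complement of M * E. *)
Definition lebesgue_ME (M : set 'rV[R]_d) (E : pfinType)
    (A : set ('rV[R]_d * E)) : \bar R :=
  (\sum_(i : E) lebesgue_rV (M `&` [set x | A (x, i)]))%E.

End lebesgue.

Arguments lebesgue_ME {R d} M E A.

Section vector_fields.
Context (R : realType) (d : nat).
Notation V := 'rV[R]_d.

Fixpoint is_Ck (k : nat) (f : V -> V) : Prop :=
  match k with
  | 0%N => continuous f
  | k'.+1 => (forall x, differentiable f x) /\
             forall v, is_Ck k' (fun x => 'd f x v)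
  end.

Definition smooth (f : V -> V) := forall k, is_Ck k f.

Definition bounded_field (f : V -> V) := exists K : R, forall x, `|f x| <= K.

Definition is_flow (f : V -> V) (phi : R -> V -> V) :=
  forall x, phi 0 x = x /\
    forall t : R, is_derive t 1 (fun s => phi s x) (f (phi t x)).

Definition lie_bracket (f g : V -> V) : V -> V :=
  fun x => 'd g x (f x) - 'd f x (g x).

Context (E : finType) (F : E -> V -> V).

Fixpoint bracket_family (k : nat) : seq (V -> V) :=
  match k with
  | 0%N => [seq F i | i <- enum E]
  | k'.+1 => bracket_family k' ++
      [seq lie_bracket (F i) G | i <- enum E, G <- bracket_family k']
  end.

Definition weak_bracket_condition (x : V) :=
  exists k, <<[seq G x | G <- bracket_family k]>>%VS = fullv :> {vspace V}.

End vector_fields.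

Section accessible.
Context (R : realType) (d : nat) (E : finType).
Context (Phi : E -> R -> 'rV[R]_d -> 'rV[R]_d).

(* Only i_0, ..., i_(n-1) and u_1, ..., u_n are used. *)
Fixpoint composite_flow (i : nat -> E) (u : nat -> R) (n : nat)
    (x : 'rV[R]_d) : 'rV[R]_d :=
  match n with
  | 0%N => x
  | n'.+1 => Phi (i n') (u n'.+1) (composite_flow i u n' x)
  end.

Definition positive_orbit (x : 'rV[R]_d) : set 'rV[R]_d :=
  [set y | exists (n : nat) (i : nat -> E) (u : nat -> R),
    [/\ (1 <= n)%N, forall k, 0 <= u k & y = composite_flow i u n x]].

Definition accessible_set (M : set 'rV[R]_d) : set 'rV[R]_d :=
  \bigcap_(x in M) closure (positive_orbit x).

End accessible.

Section probability_notions.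
Local Open Scope ereal_scope.
Context (R : realType) (d : measure_display) (T : measurableType d).

Definition mutually_independent (P : probability T R)
    (G : nat -> set (set T)) :=
  forall (s : seq nat) (A : nat -> set T), uniq s ->
    (forall n, n \in s -> G n (A n)) ->
    P (\bigcap_(n in [set` s]) A n) = \prod_(n <- s) P (A n).

Definition independent (P : probability T R) (G H : set (set T)) :=
  forall A B, G A -> H B -> P (A `&` B) = P A * P B.

(* Total mass of the variation |nu| of the signed measure nu. *)
Definition tv_norm (nu : {charge set T -> \bar R}) : \bar R :=
  charge_variation (svalP (cid (svalP (cid (Hahn_decomposition nu))))) setT.

Definition prob_diff (mu nu : probability T R) : {charge set T -> \bar R} :=
  cadd (charge_of_finite_measure mu)
       (cscale (-1) (charge_of_finite_measure nu)).

End probability_notions.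

Section chain.
Context (R : realType) (d : nat) (E : pfinType).
Notation V := 'rV[R]_d.
Context (Phi : E -> R -> V -> V) (M : set V).
Context (lam : V -> E -> E -> R) (lambda : R).

Definition jump_matrix (x : V) (i j : E) : R :=
  if i == j then 1 - \sum_(k | k != i) lam x i k / lambda
  else lam x i j / lambda.

Definition state_space : set (V * E) := M `*` setT.

(* The one-step transition probability of the chain from z = (x, i) into A:
   flow along F^i for an exponential time t, then change i according to the
   matrix at the point reached. *)
Definition transition (z : V * E) (A : set (V * E)) : \bar R :=
  (\int[lebesgue_measure]_(t in `[0%R, +oo[)
     (exponential_pdf lambda t *
      \sum_(j : E) jump_matrix (Phi z.2 t z.1) z.2 j *
                   \1_A (Phi z.2 t z.1, j))%:E)%E.

Definition invariant_probability (pi : probability (V * E)%type R) :=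
  pi state_space = 1%E /\
  forall A, measurable A ->
    pi A = (\int[pi]_(z in state_space) transition z A)%E.

Context (dO : measure_display) (Omega : measurableType dO).
Context (P : probability Omega R).

Definition history (U : nat -> {RV P >-> R}) (Z : nat -> {RV P >-> (V * E)%type})
    (n : nat) : set (set Omega) :=
  <<s (\bigcup_(k in [set k | (k <= n)%N]) g_sigma_algebra_preimage (Z k)) `|`
      (\bigcup_k g_sigma_algebra_preimage (U k)) >>.

(* U n is the variable U_(n+1) of the recursion. In chain_Y, the conditional law
   of Y_(n+1) is given knowing Z_0, ..., Z_n and the whole sequence of times: it
   depends on X_(n+1) and Y_n only. This is the Markov reading of
   P[Y_(n+1) = j | X_(n+1), Y_n = i] = Q(X_(n+1), i, j). *)
Record sampled_chain (U : nat -> {RV P >-> R})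
    (Z : nat -> {RV P >-> (V * E)%type}) : Prop := {
  chain_U_ge0 : forall n w, 0 <= U n w;
  chain_U_law : forall n B, measurable B ->
    distribution P (U n) B = exponential_prob lambda B;
  chain_U_indep :
    mutually_independent P (fun n => g_sigma_algebra_preimage (U n));
  chain_Z0_indep :
    independent P (g_sigma_algebra_preimage (Z 0%N))
                  <<s \bigcup_n g_sigma_algebra_preimage (U n) >>;
  chain_Z0_in : forall w, state_space (Z 0%N w);
  chain_X : forall n w,
    (Z n.+1 w).1 = Phi (Z n w).2 (U n w) (Z n w).1;
  chain_Y : forall n (j : E) (G : set Omega), history U Z n G ->
    P (G `&` [set w | (Z n.+1 w).2 = j]) =
    (\int[P]_(w in G) (jump_matrix (Z n.+1 w).1 (Z n w).2 j)%:E)%E }.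

End chain.

(* Main.v *)
(* The kernel K of the chain satisfies a Doeblin condition: some power of K is
   bounded below by a positive multiple of a fixed probability.

   Call a word a finite list of states with durations, and look at the end point
   of the switched flow as a function of the durations.  Among the short words
   starting at p, one whose derivative in the durations has maximal rank must have
   full rank: otherwise a nonzero covector would annihilate the range of that
   derivative, hence, appending arbitrarily short pieces of flow, all the iterated
   brackets at the end point, which the weak bracket condition excludes near p.
   The law of the end point then dominates Lebesgue measure on a small ball,
   uniformly in the starting point near p.  As p is accessible from everywhere, M
   is compact and the jump rates are irreducible, the chain started anywhere
   reaches the first state of the word close to p with a probability bounded below.

   The Doeblin condition yields geometric contraction, hence the invariant
   probability as a uniform limit of the laws of the chain.  The minorizing measure
   is absolutely continuous and the flows, being locally Lipschitz and invertible,
   preserve null sets, so the limit is absolutely continuous as well. *)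

Require Import Defs.
From HB Require Import structures.
From mathcomp Require Import all_boot all_order all_algebra.
From mathcomp Require Import all_classical all_reals all_analysis.
From mathcomp Require Import measurable_realfun giry ring lra.

Import Order.TTheory GRing.Theory Num.Theory.
Import numFieldNormedType.Exports.
Local Open Scope classical_set_scope.
Local Open Scope ring_scope.
Set Implicit Arguments.
Unset Strict Implicit.
Unset Printing Implicit Defensive.

(** * Vector-valued calculus *)

(** Differentiability is always used in strict form: the increment between any two points close to a
    base point is compared with one fixed matrix. Such bounds follow from Gronwall estimates on
    differences of solutions, compose along a word, and are uniform in the starting point, as a
    minorization must be. Continuity of derivatives is never discussed.

    To bound the law of the end point from below, the durations are perturbed along a section of the
    derivative. Translation invariance, Fubini and the bounded distortion of volume by Lipschitz
    maps are then enough, since only positivity of the constants matters. Lebesgue measure is an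
    outer measure here; Fubini becomes available by comparing it with a uniform product law on a
    large cube.

    A step of the chain flows and then jumps, while a word switches and then flows, so the
    minorization starts in the first state of the word. The sampled chain is described by
    conditional probabilities on history events; it is identified with the iterates of the kernel by
    an induction that also carries the independence of the present from the future clock times. *)

Section row_vectors.
Context {R : realType} {n : nat}.
Implicit Types (x v : 'rV[R]_n).

Lemma coord_le_norm x k : `|x ord0 k| <= `|x|.
Proof.
rewrite [leRHS]/Num.Def.normr/= mx_normrE.
exact: (le_bigmax _ (fun ij => `|x ij.1 ij.2|) (ord0, k)).
Qed.

Lemma norm_le_coord x (c : R) :
  0 <= c -> (forall k, `|x ord0 k| <= c) -> `|x| <= c.
Proof.
move=> c0 xc; rewrite [leLHS]/Num.Def.normr/= mx_normrE.
by apply: bigmax_le => // -[i k] _ /=; rewrite ord1.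
Qed.

Lemma is_derive_coord (u : R -> 'rV[R]_n) t v k :
  is_derive t (1 : R) u v ->
  is_derive t (1 : R) (fun s => u s ord0 k) (v ord0 k).
Proof.
move=> [du dv]; have := du; rewrite derivable_mxP => /(_ ord0 k) duk.
by apply: DeriveDef => //; rewrite -dv derive_mx// mxE.
Qed.

Lemma is_derive_continuous (W : normedModType R) (u : R -> W) t (v : W) :
  is_derive t (1 : R) u v -> {for t, continuous u}.
Proof.
move=> [du _].
exact/differentiable_continuous/derivable1_diffP.
Qed.

(** The norm is the sup norm, so the scalar mean value theorem on each coordinate loses no
    constant. *)
Lemma vector_MVT (u du : R -> 'rV[R]_n) v (a b c : R) : a <= b -> 0 <= c ->
  (forall s, is_derive s (1 : R) u (du s)) ->
  (forall s, a <= s <= b -> `|du s - v| <= c) ->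
  `|u b - u a - (b - a) *: v| <= c * (b - a).
Proof.
move=> ab c0 ud duv; apply: norm_le_coord => [|k].
  by rewrite mulr_ge0// subr_ge0.
rewrite !mxE.
have [s|s|s] := @MVT_segment R (fun s => u s ord0 k) (fun s => du s ord0 k) a b ab.
- by move=> _; exact: is_derive_coord.
- apply: continuous_subspaceT => z; apply: is_derive_continuous.
  exact: is_derive_coord.
rewrite in_itv/= => /duv /(le_trans (coord_le_norm _ k)).
rewrite !mxE => h ->.
rewrite (mulrC (b - a)) -mulrBl normrM (ger0_norm (_ : 0 <= b - a)) ?subr_ge0//.
by rewrite ler_wpM2r ?subr_ge0.
Qed.

Lemma vector_MVT0 (u du : R -> 'rV[R]_n) (a b c : R) : a <= b -> 0 <= c ->
  (forall s, is_derive s (1 : R) u (du s)) ->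
  (forall s, a <= s <= b -> `|du s| <= c) ->
  `|u b - u a| <= c * (b - a).
Proof.
move=> ab c0 ud duv; have := @vector_MVT u du 0 a b c ab c0 ud.
by rewrite scaler0 subr0; apply => s /duv; rewrite subr0.
Qed.

(* The sum of squares of the coordinates is differentiable, unlike the norm. *)
Lemma gronwall (u du : R -> 'rV[R]_n) (T L c : R) : 0 <= L -> 0 <= c ->
  (forall s, is_derive s (1 : R) u (du s)) ->
  (forall s, 0 <= s <= T -> `|du s| <= L * `|u s| + c) ->
  forall t, 0 <= t <= T ->
  `|u t| ^+ 2 <= (n%:R * `|u 0| ^+ 2 + c ^+ 2) * expR ((2 * n%:R * L + n%:R) * T).
Proof.
move=> L0 c0 ud duL t /andP[t0 tT].
set C := 2 * n%:R * L + n%:R.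
have C0 : 0 <= C by rewrite addr_ge0// !mulr_ge0.
pose q s := \sum_(k < n) (u s ord0 k) ^+ 2.
have uq s : `|u s| ^+ 2 <= q s.
  have q0 : 0 <= q s by apply: sumr_ge0 => k _; exact: sqr_ge0.
  rewrite -(sqr_sqrtr q0) lerXn2r ?nnegrE ?sqrtr_ge0//.
  apply: norm_le_coord; first exact: sqrtr_ge0.
  move=> k; rewrite -(@ler_pXn2r _ 2) ?nnegrE ?sqrtr_ge0// sqr_sqrtr//.
  rewrite -normrX ger0_norm ?sqr_ge0// /q (bigD1 k)//= lerDl.
  by apply: sumr_ge0 => j _; exact: sqr_ge0.
have qu s : q s <= n%:R * `|u s| ^+ 2.
  rewrite (_ : n%:R * _ = \sum_(k < n) `|u s| ^+ 2); last by rewrite sumr_const card_ord mulr_natl.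
  apply: ler_sum => k _; rewrite -[leLHS]ger0_norm ?sqr_ge0// normrX lerXn2r ?nnegrE//.
  exact: coord_le_norm.
pose dq s := \sum_(k < n) (2 * (u s ord0 k * du s ord0 k)).
have qd s : is_derive s (1 : R) q (dq s).
  rewrite (_ : q = \sum_(k < n) (fun s => u s ord0 k ^+ 2)); last first.
    by apply/funext => z; rewrite /q fct_sumE.
  apply: is_derive_sum => k.
  have h := @is_derive_coord u s (du s) k (ud s).
  rewrite (_ : (fun s => u s ord0 k ^+ 2) = (fun s => u s ord0 k) ^+ 2); last first.
    by apply/funext => z; rewrite exprfctE.
  have h2 := is_deriveX 1 h; apply: is_derive_eq.
  by rewrite /GRing.scale/= expr1; ring.
have dqC s : 0 <= s <= T -> dq s <= C * (q s + c ^+ 2).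
  move=> sT; have h := duL s sT.
  have : dq s <= \sum_(k < n) (2 * (`|u s| * (L * `|u s| + c))).
    apply: ler_sum => k _; rewrite ler_pM2l//.
    apply: (le_trans (ler_norm _)); rewrite normrM ler_pM//.
      exact: coord_le_norm.
    exact: le_trans (coord_le_norm _ _) h.
  rewrite sumr_const card_ord -[X in _ <= X]mulr_natl => /le_trans; apply.
  have n0 : 0 <= (n%:R : R) by [].
  have h1 := uq s.
  have h2 : 2 * (`|u s| * c) <= q s + c ^+ 2.
    by have := sqr_ge0 (`|u s| - c); nra.
  have h3 : L * (2 * `|u s| ^+ 2) <= L * (2 * (q s + c ^+ 2)).
    by rewrite ler_wpM2l// ler_pM2l//; have := sqr_ge0 c; lra.
  rewrite (_ : C * _ = n%:R * (L * (2 * (q s + c ^+ 2)) + (q s + c ^+ 2))); last first.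
    by rewrite /C; ring.
  rewrite ler_wpM2l//; lra.
(* Integrating factor: by [dqC] this function is nonincreasing between 0 and [T]. *)
pose g s := (q s + c ^+ 2) * expR (- C * s).
have gd s : is_derive s (1 : R) g
    ((q s + c ^+ 2) * (expR (- C * s) * - C) + expR (- C * s) * dq s).
  have e : is_derive s (1:R) (fun s => expR (- C * s)) (expR (- C * s) * - C).
    have := @is_derive1_comp R expR (fun s => - C * s) s _ (- C) (is_derive_expR _).
    apply; apply: (is_derive_eq (@is_deriveZ _ _ _ id (- C) s 1 _ (is_derive_id _ _))).
    by rewrite /GRing.scale/= mulr1.
  have q' : is_derive s (1:R) (fun s => q s + c ^+ 2) (dq s).
    apply: (is_derive_eq (@is_deriveD _ _ _ q (cst (c ^+ 2)) s 1 _ _ (qd s) (is_derive_cst _ _ _))).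
    by rewrite addr0.
  exact: (is_derive_eq (is_deriveM q' e)).
have gle : g t <= g 0.
  have : {in `[0, T] &, {homo g : x y /~ x <= y}}.
    apply: ler0_derive1_le_cc.
    - by move=> x _; case: (gd x).
    - move=> x; rewrite in_itv/= => /andP[x0 xT]; rewrite derive1E; case: (gd x) => _ ->.
      rewrite mulrCA -mulrDr mulr_ge0_le0 ?expR_ge0//.
      by have := @dqC x; rewrite (ltW x0) (ltW xT) => /(_ isT); lra.
    - apply: continuous_subspaceT => z; exact: is_derive_continuous (gd z).
  apply => //; rewrite in_itv/= ?lexx ?t0 ?tT//.
  exact: le_trans tT.
have : g 0 <= n%:R * `|u 0| ^+ 2 + c ^+ 2.
  by rewrite /g mulr0 expR0 mulr1 lerD2r.
move=> /(le_trans gle); rewrite /g => h.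
apply: le_trans (uq t) _.
apply: (@le_trans _ _ (q t + c ^+ 2)); first by rewrite lerDl sqr_ge0.
rewrite -(ler_pM2r (expR_gt0 (- C * t))).
apply: (le_trans h).
rewrite -mulrA -expRD ler_peMr ?addr_ge0 ?mulr_ge0 ?sqr_ge0 ?exprn_ge0//.
rewrite -expR0 ler_expR; nra.
Qed.
End row_vectors.

Section matrix_norm.
Context {R : realType} {m n : nat}.

Lemma norm_mulmx_le p (B : 'M[R]_(p, m)) (A : 'M[R]_(m, n)) :
  `|B *m A| <= m%:R * `|A| * `|B|.
Proof.
have entry q r (C : 'M[R]_(q, r)) i j : `|C i j| <= `|C|.
  rewrite [leRHS]/Num.Def.normr/= mx_normrE.
  exact: (le_bigmax _ (fun ij => `|C ij.1 ij.2|) (i, j)).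
rewrite [leLHS]/Num.Def.normr/= mx_normrE; apply: bigmax_le => [|[i k] _ /=].
  by rewrite !mulr_ge0.
rewrite mxE; apply: le_trans (ler_norm_sum _ _ _) _.
rewrite (_ : _ * _ * _ = \sum_(i < m) (`|A| * `|B|)); last first.
  by rewrite sumr_const card_ord -mulrA mulr_natl.
by apply: ler_sum => j _; rewrite normrM mulrC ler_pM.
Qed.

End matrix_norm.

(** * Estimates, uniform on balls, for fields of class C^1 and C^2 *)

Section C1_fields.
Context {R : realType} {n : nat}.
Notation V := 'rV[R]_n.
Implicit Types (f g : V -> V) (x y z v : V).

Lemma diff_jacobian f x v : 'd f x v = v *m jacobian f x.
Proof. by rewrite /jacobian mul_rV_lin1. Qed.

Lemma is_CkW k f : is_Ck k.+1 f -> is_Ck k f.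
Proof.
elim: k f => [|k IH] f [df h].
  by move=> x; exact: differentiable_continuous.
by split=> // v; exact/IH/h.
Qed.

Lemma closed_ball0_compact (r : R) : compact [set x : V | `|x| <= r].
Proof.
apply: bounded_closed_compact.
  exists r; split; first exact: num_real.
  by move=> s rs x /= xr; exact: le_trans (ltW rs).
rewrite (_ : mkset _ = (fun x : V => `|x|) @^-1` [set t | t <= r]) //.
apply: (closed_comp (f := fun x : V => `|x|)); last exact: closed_le.
by move=> x _; exact: norm_continuous.
Qed.

Lemma continuous_bounded_ball (W : normedModType R) (g : V -> W) (r : R) :
  continuous g -> exists2 B, 0 <= B & forall x, `|x| <= r -> `|g x| <= B.
Proof.
move=> cg.
have cA : compact (g @` [set x : V | `|x| <= r]).
  apply: continuous_compact; last exact: closed_ball0_compact.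
  exact: continuous_subspaceT.
have [B [_ hB]] := compact_bounded cA.
exists (Num.max 0 (B + 1)); first by rewrite le_max lexx.
move=> x xr; rewrite le_max; apply/orP; right; apply: (hB (B + 1)).
  by rewrite ltrDl.
by exists x.
Qed.

(** [is_Ck] controls the differential in each fixed direction only; summing over the basis
    directions turns this into bounds on the whole differential. *)
Lemma linear_coord_bound (D : V -> V) (B : 'I_n -> R) v :
  (forall a u w, D (a *: u + w) = a *: D u + D w) ->
  (forall k, `|D (delta_mx ord0 k)| <= B k) ->
  `|D v| <= (\sum_k B k) * `|v|.
Proof.
move=> Dlin DB.
have D0 : D 0 = 0.
  have := Dlin 1 0 0; rewrite !scale1r addr0 => /eqP.
  by rewrite -subr_eq0 opprD addrA subrr sub0r oppr_eq0 => /eqP.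
have Dsum (s : seq 'I_n) : D (\sum_(k <- s) v ord0 k *: delta_mx ord0 k) =
    \sum_(k <- s) v ord0 k *: D (delta_mx ord0 k).
  by elim: s => [|k s IH]; rewrite ?big_nil ?D0// !big_cons Dlin IH.
rewrite [v in `|D v|]row_sum_delta Dsum.
apply: le_trans (ler_norm_sum _ _ _) _; rewrite mulr_suml.
by apply: ler_sum => k _; rewrite normrZ mulrC ler_pM// coord_le_norm.
Qed.

Lemma C1_diff_bound f (r : R) : is_Ck 1 f ->
  exists2 L, 0 <= L & forall x v, `|x| <= r -> `|v *m jacobian f x| <= L * `|v|.
Proof.
move=> [df cdf].
have /choice[B hB] : forall k : 'I_n, exists B, 0 <= B /\
    forall x, `|x| <= r -> `|'d f x (delta_mx ord0 k)| <= B.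
  move=> k; have [B B0 h] := continuous_bounded_ball r (cdf (delta_mx ord0 k)).
  by exists B.
exists (\sum_k B k); first by apply: sumr_ge0 => k _; case: (hB k).
move=> x v xr; apply: (@linear_coord_bound (fun v => v *m jacobian f x)).
  by move=> a u w; rewrite mulmxDl scalemxAl.
by move=> k; rewrite -diff_jacobian; apply: (hB k).2.
Qed.

Lemma is_derive_line f (y v : V) (s : R) : differentiable f (y + s *: v) ->
  is_derive s (1 : R) (fun s => f (y + s *: v)) (v *m jacobian f (y + s *: v)).
Proof.
move=> df.
have l : is_diff s (fun s : R => y + s *: v) (fun s => s *: v).
  apply: is_diff_eq.
  by apply/funext => t /=; rewrite fctE /cst/= add0r.
have h := is_diff_comp l (differentiableP df).
have hd : differentiable (f \o (fun s : R => y + s *: v)) s by exact: ex_diff.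
apply: DeriveDef; first exact: (@diff_derivable _ _ _ _ _ _ hd).
rewrite (@deriveE _ _ _ _ _ _ hd) (@diff_val _ _ _ _ _ _ _ h) /= scale1r.
exact: diff_jacobian.
Qed.

Lemma norm_convex_le (x y : V) (r s : R) : 0 <= s <= 1 ->
  `|x| <= r -> `|y| <= r -> `|y + s *: (x - y)| <= r.
Proof.
move=> /andP[s0 s1] xr yr.
have -> : y + s *: (x - y) = s *: x + (1 - s) *: y.
  by rewrite scalerBr scalerBl scale1r; apply/rowP => i; rewrite !mxE; ring.
apply: le_trans (ler_normD _ _) _; rewrite !normrZ (ger0_norm s0) ger0_norm ?subr_ge0//.
apply: le_trans (_ : s * r + (1 - s) * r <= _); last by rewrite -mulrDl addrC subrK mul1r.
by rewrite lerD// ler_wpM2l// subr_ge0.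
Qed.

Lemma diff_increment_bound f (x y : V) (A : 'M[R]_n) (c : R) :
  (forall x, differentiable f x) -> 0 <= c ->
  (forall s, 0 <= s <= 1 ->
     `|(x - y) *m (jacobian f (y + s *: (x - y)) - A)| <= c) ->
  `|f x - f y - (x - y) *m A| <= c.
Proof.
move=> df c0 h.
have := @vector_MVT R n (fun s => f (y + s *: (x - y))) _ ((x - y) *m A)
  0 1 c ler01 c0 (fun s => @is_derive_line f y (x - y) s (df _)).
rewrite scale0r addr0 scale1r subrKC subr0 scale1r mulr1; apply => s hs.
by rewrite -mulmxBr; exact: h.
Qed.

Lemma C1_lipschitz_ball f (r : R) : is_Ck 1 f -> exists2 L, 0 <= L &
  forall x y, `|x| <= r -> `|y| <= r -> `|f x - f y| <= L * `|x - y|.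
Proof.
move=> Cf; have [L L0 hL] := C1_diff_bound r Cf.
exists L => // x y xr yr.
have := @diff_increment_bound f x y 0 (L * `|x - y|) Cf.1.
rewrite mulmx0 subr0; apply; first exact: mulr_ge0.
move=> s hs; rewrite subr0; apply: hL.
exact: norm_convex_le.
Qed.

(** The Jacobian is taken at a third point [z], so that increments between different pairs of points
    can be compared with the same matrix. *)
Lemma C2_increment_ball f (r : R) : is_Ck 2 f -> exists2 C, 0 <= C &
  forall x y z, `|x| <= r -> `|y| <= r -> `|z| <= r ->
  `|f x - f y - (x - y) *m jacobian f z|
    <= C * (`|x - z| + `|y - z|) * `|x - y|.
Proof.
move=> [df d2f].
have /choice[B hB] : forall k : 'I_n, exists B, 0 <= B /\
    forall x y, `|x| <= r -> `|y| <= r ->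
    `|'d f x (delta_mx ord0 k) - 'd f y (delta_mx ord0 k)| <= B * `|x - y|.
  move=> k; have [B B0 h] := C1_lipschitz_ball r (d2f (delta_mx ord0 k)).
  by exists B.
have B0 k : 0 <= B k by case: (hB k).
exists (\sum_k B k); first exact: sumr_ge0.
move=> x y z xr yr zr; apply: diff_increment_bound => //.
  by rewrite !mulr_ge0 ?sumr_ge0 ?addr_ge0.
move=> s hs; set w := y + _.
have wz : `|w - z| <= `|x - z| + `|y - z|.
  have -> : w - z = s *: (x - z) + (1 - s) *: (y - z).
    by apply/rowP => i; rewrite !mxE; ring.
  move: hs => /andP[s0 s1].
  apply: le_trans (ler_normD _ _) _; rewrite !normrZ (ger0_norm s0) ger0_norm ?subr_ge0//.
  by rewrite lerD// ler_piMl// gerBl.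
have wr : `|w| <= r by exact: norm_convex_le.
clearbody w.
have := @linear_coord_bound (fun v => v *m (jacobian f w - jacobian f z))
  (fun k => B k * `|w - z|) (x - y).
move=> h; apply: le_trans (h _ _) _.
- by move=> a u v; rewrite mulmxDl scalemxAl.
- move=> k /=; rewrite mulmxBr -[X in X - _]diff_jacobian -[X in _ - X]diff_jacobian.
  by have [_ hBk] := hB k; exact: (hBk w z wr zr).
- by rewrite -mulr_suml !ler_wpM2r// ler_wpM2l// sumr_ge0.
Qed.

End C1_fields.

(** * Flows of vector fields *)

(** The quadratic bound of [gronwall] becomes linear in the initial norm and in [c], with a factor
    that depends only on [n], [L] and [T] and thus serves all differences of solutions in a ball. *)
Lemma gronwall_linear {R : realType} (n : nat) (L T : R) : 0 <= L ->
  exists2 G, 0 <= G & forall (u du : R -> 'rV[R]_n) (c : R), 0 <= c ->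
  (forall s, is_derive s (1 : R) u (du s)) ->
  (forall s, 0 <= s <= T -> `|du s| <= L * `|u s| + c) ->
  forall t, 0 <= t <= T -> `|u t| <= G * (`|u 0| + c).
Proof.
move=> L0; pose E := expR ((2 * n%:R * L + n%:R) * T).
have E0 : 0 < E by exact: expR_gt0.
exists (Num.sqrt ((n%:R + 1) * E)) => [|u du c c0 ud duL t tT]; first exact: sqrtr_ge0.
rewrite -(@ler_pXn2r _ 2) ?nnegrE ?mulr_ge0 ?sqrtr_ge0 ?addr_ge0//.
rewrite exprMn sqr_sqrtr ?mulr_ge0 ?addr_ge0 ?(ltW E0)//.
have := gronwall L0 c0 ud duL tT; rewrite -/E => /le_trans; apply.
rewrite mulrAC ler_wpM2r ?(ltW E0)//.
have n0 : 0 <= (n%:R : R) by [].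
have ac0 : 0 <= `|u 0| * c by rewrite mulr_ge0.
have := mulr_ge0 n0 ac0; have := mulr_ge0 n0 (sqr_ge0 c).
have := sqr_ge0 `|u 0|; lra.
Qed.

Section flow.
Context {R : realType} {n : nat}.
Notation V := 'rV[R]_n.

(** Slope [-1] gives the reversed flow, slope [1] the time shift behind [flow_group]. *)
Lemma is_derive_flow_affine (f : V -> V) phi x (a b q : R) : is_flow f phi ->
  is_derive q (1 : R) (fun s => phi (a * s + b) x) (a *: f (phi (a * q + b) x)).
Proof.
move=> fl; have [d e] := (fl x).2 (a * q + b).
have ha : is_diff q (fun s : R => a * s + b) (fun s : R => a * s + 0).
  have h1 : is_diff q (fun s : R => a * s) (fun s : R => a * s).
    exact: (@is_diffZ _ _ _ id id a q (is_diff_id q)).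
  exact: (is_diffD h1 (is_diff_cst b q)).
have d2 : differentiable (fun s : R => a * s + b) q by exact: ex_diff.
have d1 : differentiable (fun s => phi s x) (a * q + b) by exact/derivable1_diffP.
have d3 : differentiable ((fun s => phi s x) \o (fun s : R => a * s + b)) q.
  exact: differentiable_comp.
apply: DeriveDef; first exact: (@diff_derivable _ _ _ _ _ _ d3).
rewrite (@deriveE _ _ _ _ _ _ d3) diff_comp//=.
rewrite (@diff_val _ _ _ _ _ _ _ ha)/= mulr1 addr0 -[X in 'd _ _ X]mulr1.
by rewrite -/(a *: (1 : R^o)) linearZ/= -deriveE// e.
Qed.

Lemma is_flow_opp (f : V -> V) phi : is_flow f phi ->
  is_flow (fun x => - f x) (fun t => phi (- t)).
Proof.
move=> fl x; split; first by rewrite oppr0; case: (fl x).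
move=> t; have := is_derive_flow_affine x (-1) 0 t fl.
rewrite mulN1r addr0 scaleN1r.
by under [X in is_derive _ _ X]eq_fun do rewrite mulN1r addr0.
Qed.

Lemma is_Ck_opp k (f : V -> V) : is_Ck k f -> is_Ck k (fun x => - f x).
Proof.
elim: k f => [|k IH] f /=; first by move=> cf x; exact/continuousN/cf.
move=> [df cf]; split=> [x|v]; first exact: differentiableN.
have -> : (fun x => 'd (fun x => - f x) x v) = (fun x => - 'd f x v).
  apply/funext => x; exact: (congr1 (fun g : V -> V => g v) (diffN (df x))).
by apply: IH; exact: cf.
Qed.

Lemma flow_time_lipschitz (f : V -> V) phi (K : R) :
  is_flow f phi -> (forall x, `|f x| <= K) ->
  forall x s t, `|phi t x - phi s x| <= K * `|t - s|.
Proof.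
move=> fl fK x.
have K0 : 0 <= K by apply: le_trans (fK x).
have key a b : a <= b -> `|phi b x - phi a x| <= K * (b - a).
  move=> ab; apply: (@vector_MVT0 _ _ (fun s => phi s x) (fun s => f (phi s x))) => //.
  by move=> s; case: (fl x) => _.
move=> s t; have [st|/ltW ts] := leP s t.
  by rewrite (ger0_norm (_ : 0 <= t - s)) ?subr_ge0//; exact: key.
by rewrite distrC (distrC t) (ger0_norm (_ : 0 <= s - t)) ?subr_ge0//; exact: key.
Qed.

Lemma flow_norm_le (f : V -> V) phi (K : R) :
  is_flow f phi -> (forall x, `|f x| <= K) ->
  forall x t r T, `|x| <= r -> `|t| <= T -> `|phi t x| <= r + K * T.
Proof.
move=> fl fK x t r T xr tT.
have := flow_time_lipschitz fl fK x 0 t; rewrite subr0 (fl x).1 => h.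
rewrite -(subrK x (phi t x)) addrC; apply: le_trans (ler_normD _ _) _.
rewrite lerD// (le_trans h)// ler_wpM2l//.
by apply: le_trans (fK x).
Qed.

Section two_sided.
Variables (f : V -> V) (phi : R -> V -> V) (K : R).
Hypotheses (Cf : is_Ck 2 f) (fK : forall x, `|f x| <= K) (fl : is_flow f phi).

(** Time reversal preserves the hypotheses, so each estimate proved for nonnegative times extends to
    all times. *)
Lemma reverse_flow_hyps : [/\ is_Ck 2 (fun x => - f x),
  (forall x, `|- f x| <= K) & is_flow (fun x => - f x) (fun t => phi (- t))].
Proof.
by split; [exact: is_Ck_opp|move=> x; rewrite normrN|exact: is_flow_opp].
Qed.

Lemma flow_space_lipschitz_pos (T r : R) : exists2 C, 0 <= C &
  forall x y t, `|x| <= r -> `|y| <= r -> 0 <= t <= T ->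
  `|phi t x - phi t y| <= C * `|x - y|.
Proof.
have [L L0 hL] := C1_lipschitz_ball (r + K * T) (is_CkW Cf).
have [G G0 hG] := @gronwall_linear R n L T L0.
exists G => // x y t xr yr tT.
have /= := hG (fun s => phi s x - phi s y) (fun s => f (phi s x) - f (phi s y)) 0 (lexx _).
rewrite (fl x).1 (fl y).1 addr0; apply => //.
  by move=> s; apply: is_deriveB; [case: (fl x)|case: (fl y)].
move=> s /andP[s0 sT]; rewrite addr0; apply: hL.
  by apply: (flow_norm_le fl fK) => //; rewrite ger0_norm.
by apply: (flow_norm_le fl fK) => //; rewrite ger0_norm.
Qed.

(** Boundedness of the field keeps both curves in one ball, on which the field is Lipschitz;
    Gronwall then starts from a zero difference. *)
Lemma flow_unique_pos (a b : R -> V) :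
  (forall t, is_derive t (1 : R) a (f (a t))) ->
  (forall t, is_derive t (1 : R) b (f (b t))) ->
  a 0 = b 0 -> forall t, 0 <= t -> a t = b t.
Proof.
move=> da db ab t t0.
have bound (c : R -> V) : (forall t, is_derive t (1 : R) c (f (c t))) ->
    forall s, 0 <= s <= t -> `|c s| <= `|c 0| + K * t.
  move=> dc s /andP[s0 st].
  have K0 : 0 <= K by apply: le_trans (fK 0).
  have := @vector_MVT0 _ _ c _ 0 s K s0 K0 dc (fun z _ => fK (c z)).
  rewrite subr0 => h; rewrite -(subrK (c 0) (c s)) addrC.
  by apply: le_trans (ler_normD _ _) _; rewrite lerD// (le_trans h)// ler_wpM2l.
have [L L0 hL] := C1_lipschitz_ball (`|a 0| + K * t) (is_CkW Cf).
have [G G0 hG] := @gronwall_linear R n L t L0.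
have /= := hG (fun s => a s - b s) (fun s => f (a s) - f (b s)) 0 (lexx _).
rewrite ab subrr normr0 addr0 mulr0 => /(_ _ _ t) h.
apply/eqP; rewrite -subr_eq0 -normr_le0; apply: h; last by rewrite lexx t0.
move=> s st; rewrite addr0; apply: hL; first exact: bound.
by rewrite ab; exact: bound.
Qed.

(* Two difference quotients of the flow in the same direction, both taken near
   [z], differ by a second order term; no variational equation is needed. *)
Lemma flow_quotients_pos (T r : R) : exists2 C, 0 <= C &
  forall x y a b z k t, `|x| <= r -> `|y| <= r -> `|a| <= r -> `|b| <= r ->
  `|z| <= r -> 0 <= t <= T -> x - y = k *: (a - b) ->
  `|(phi t x - phi t y) - k *: (phi t a - phi t b)| <=
  C * (`|x - z| + `|y - z| + `|a - z| + `|b - z|) * `|x - y|.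
Proof.
have [M M0 hM] := flow_space_lipschitz_pos T r.
have [L L0 hL] := C1_diff_bound (r + K * T) (is_CkW Cf).
have [B B0 hB] := C2_increment_ball (r + K * T) Cf.
have [G G0 hG] := @gronwall_linear R n L T L0.
exists (G * (B * M * M)); first by rewrite !mulr_ge0.
move=> x y a b z k t xr yr ar br zr tT xyab.
set S := _ + _ + _ + _.
have S0 : 0 <= S by rewrite !addr_ge0.
have inball p s : `|p| <= r -> 0 <= s <= T -> `|phi s p| <= r + K * T.
  by move=> pr /andP[s0 sT]; apply: (flow_norm_le fl fK) => //; rewrite ger0_norm.
have c0 : 0 <= B * M * M * S * `|x - y| by rewrite !mulr_ge0.
have := hG (fun s => (phi s x - phi s y) - k *: (phi s a - phi s b))
  (fun s => (f (phi s x) - f (phi s y)) - k *: (f (phi s a) - f (phi s b))) _ c0.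
rewrite (fl x).1 (fl y).1 (fl a).1 (fl b).1 xyab subrr normr0 add0r.
rewrite -!mulrA; apply => //.
  move=> s; apply: is_deriveB; first by apply: is_deriveB; [case: (fl x)|case: (fl y)].
  by apply: is_deriveZ; apply: is_deriveB; [case: (fl a)|case: (fl b)].
move=> s sT; rewrite -xyab.
set J := jacobian f (phi s z).
set Dxy := phi s x - phi s y; set Dab := phi s a - phi s b.
have -> : f (phi s x) - f (phi s y) - k *: (f (phi s a) - f (phi s b)) =
    (Dxy - k *: Dab) *m J + ((f (phi s x) - f (phi s y) - Dxy *m J) -
    k *: (f (phi s a) - f (phi s b) - Dab *m J)).
  rewrite mulmxBl -scalemxAl; apply/rowP => i; rewrite !mxE; ring.
apply: le_trans (ler_normD _ _) _; rewrite lerD ?hL ?inball//.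
have step p q : `|p| <= r -> `|q| <= r ->
    `|f (phi s p) - f (phi s q) - (phi s p - phi s q) *m J| <=
    B * M * M * (`|p - z| + `|q - z|) * `|p - q|.
  move=> pr qr; apply: le_trans (hB _ _ _ (inball _ _ pr sT) (inball _ _ qr sT)
    (inball _ _ zr sT)) _.
  have h1 := hM p q s pr qr sT; have h2 := hM p z s pr zr sT.
  have h3 := hM q z s qr zr sT.
  rewrite (_ : B * M * M * _ * _ = B * (M * `|p - z| + M * `|q - z|) * (M * `|p - q|)); last by ring.
  by rewrite ler_pM ?mulr_ge0 ?addr_ge0// ler_wpM2l// lerD.
have kn : `|k| * `|a - b| = `|x - y| by rewrite xyab normrZ.
apply: le_trans (ler_normB _ _) _; rewrite normrZ.
apply: (@le_trans _ _ (B * M * M * (`|x - z| + `|y - z|) * `|x - y| +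
   `|k| * (B * M * M * (`|a - z| + `|b - z|) * `|a - b|))).
  by rewrite lerD ?step// ler_wpM2l// step.
rewrite (mulrCA `|k|) kn -mulrDl -mulrDr; rewrite /S; lra.
Qed.

End two_sided.

End flow.

Section flow_derivative.
Context {R : realType} {n : nat}.
Notation V := 'rV[R]_n.
Variables (f : V -> V) (phi : R -> V -> V) (K : R).
Hypotheses (Cf : is_Ck 2 f) (fK : forall x, `|f x| <= K) (fl : is_flow f phi).

Lemma flow_space_lipschitz (T r : R) : exists2 C, 0 <= C &
  forall x y t, `|x| <= r -> `|y| <= r -> `|t| <= T ->
  `|phi t x - phi t y| <= C * `|x - y|.
Proof.
have [Cg gK gfl] := reverse_flow_hyps Cf fK fl.
have [C C0 hC] := flow_space_lipschitz_pos Cf fK fl T r.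
have [D D0 hD] := flow_space_lipschitz_pos Cg gK gfl T r.
exists (C + D) => [|x y t xr yr tT]; first exact: addr_ge0.
rewrite mulrDl; have [t0|t0] := leP 0 t.
  by rewrite ler_wpDr ?mulr_ge0// hC// t0 -(ger0_norm t0).
rewrite ler_wpDl ?mulr_ge0//; have := hD x y (- t) xr yr; rewrite opprK; apply.
by rewrite oppr_ge0 ltW//= -(ltr0_norm t0).
Qed.

Lemma flow_group s t x : phi s (phi t x) = phi (s + t) x.
Proof.
have [s0|s0] := leP 0 s.
  apply: (@flow_unique_pos _ _ f K Cf fK (fun s => phi s (phi t x)) (fun s => phi (s + t) x)) => //.
  - by move=> q; case: (fl (phi t x)).
  - move=> q; have := is_derive_flow_affine x 1 t q fl; rewrite mul1r scale1r.
    by under [X in is_derive _ _ X]eq_fun do rewrite mul1r.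
  - by rewrite add0r (fl _).1.
have [Cg gK gfl] := reverse_flow_hyps Cf fK fl.
have := @flow_unique_pos _ _ _ K Cg gK (fun s => phi (- s) (phi t x)) (fun s => phi (- s + t) x).
move=> /(_ _ _ _ (- s)); rewrite opprK; apply.
- by move=> q; case: (gfl (phi t x)).
- move=> q; have := is_derive_flow_affine x (-1) t q fl; rewrite mulN1r scaleN1r.
  by under [X in is_derive _ _ X]eq_fun do rewrite mulN1r.
- by rewrite oppr0 add0r (fl _).1.
- by rewrite oppr_ge0 ltW.
Qed.

Lemma flow_quotients (T r : R) : exists2 C, 0 <= C &
  forall x y a b z k t, `|x| <= r -> `|y| <= r -> `|a| <= r -> `|b| <= r ->
  `|z| <= r -> `|t| <= T -> x - y = k *: (a - b) ->
  `|(phi t x - phi t y) - k *: (phi t a - phi t b)| <=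
  C * (`|x - z| + `|y - z| + `|a - z| + `|b - z|) * `|x - y|.
Proof.
have [Cg gK gfl] := reverse_flow_hyps Cf fK fl.
have [C C0 hC] := flow_quotients_pos Cf fK fl T r.
have [D D0 hD] := flow_quotients_pos Cg gK gfl T r.
exists (C + D) => [|x y a b z k t xr yr ar br zr tT e]; first exact: addr_ge0.
have S0 : 0 <= (`|x - z| + `|y - z| + `|a - z| + `|b - z|) * `|x - y|.
  by rewrite mulr_ge0 ?addr_ge0.
rewrite -mulrA mulrDl; have [t0|t0] := leP 0 t.
  apply: ler_wpDr; first exact: mulr_ge0.
  by rewrite mulrA hC// t0 -(ger0_norm t0).
apply: ler_wpDl; first exact: mulr_ge0.
have := hD x y a b z k (- t) xr yr ar br zr; rewrite opprK mulrA; apply => //.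
by rewrite oppr_ge0 ltW//= -(ltr0_norm t0).
Qed.

(** By [flow_quotients], the difference quotients at [z] in the direction [w] with steps [h j] form
    a Cauchy sequence. Their limit [l] is the directional derivative, and the estimate survives the
    passage to the limit. *)
Lemma flow_directional (T r : R) : 0 <= r -> exists2 C, 0 <= C & forall t z w,
  `|t| <= T -> `|z| <= r -> `|w| <= 1 -> exists l, forall x y k, `|x| <= r + 1 -> `|y| <= r + 1 ->
  x - y = k *: w ->
  `|phi t x - phi t y - k *: l| <= C * (`|x - z| + `|y - z|) * `|x - y|.
Proof.
move=> r0; have [C C0 hC] := flow_quotients T (r + 1).
exists C => // t z w tT zr w1.
pose h (k : nat) : R := k.+1%:R^-1.
have h0 k : 0 < h k by rewrite invr_gt0.
have h1 k : h k <= 1 by rewrite invf_le1// ler1n.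
pose q k := (h k)^-1 *: (phi t (z + h k *: w) - phi t z).
have zr1 : `|z| <= r + 1 by apply: le_trans zr _; rewrite lerDl.
have inb k : `|z + h k *: w| <= r + 1.
  apply: le_trans (ler_normD _ _) _; rewrite lerD// normrZ gtr0_norm//.
  by rewrite mulr_ile1// ltW.
have zK (u : V) : z + u - z = u by rewrite addrAC subrr add0r.
have key x y k j : `|x| <= r + 1 -> `|y| <= r + 1 -> x - y = k *: w ->
    `|phi t x - phi t y - k *: q j| <= C * (`|x - z| + `|y - z| + h j) * `|x - y|.
  move=> xr yr e.
  have := hC x y (z + h j *: w) z z (k * (h j)^-1) t xr yr (inb j) zr1 zr1 tT.
  rewrite zK !scalerA -mulrA mulVf ?gt_eqF// mulr1 => /(_ e).
  rewrite subrr normr0 addr0 => /le_trans; apply.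
  rewrite ler_wpM2r// ler_wpM2l// lerD2l normrZ gtr0_norm// ger_pMr//.
have hcvg : h k @[k --> \oo] --> (0 : R) by exact: cvg_harmonic.
have cq : cvgn q.
  apply: cauchy_cvg; apply: cauchy_exP => e e0.
  pose e' := e / (2 * C + 1).
  have e'0 : 0 < e' by rewrite divr_gt0// ltr_wpDl// mulr_ge0.
  have [N _ hN] : \forall k \near \oo, h k < e'.
    by have /cvgrPdist_lt/(_ _ e'0) := hcvg; apply: filterS => k; rewrite sub0r normrN gtr0_norm.
  have d : forall i j, (N <= i)%N -> (N <= j)%N -> ball (q i) e (q j).
    move=> i j Ni Nj; rewrite -ball_normE/=.
    have := key (z + h i *: w) z (h i) j (inb i) zr1.
    rewrite zK => /(_ erefl); rewrite subrr normr0 addr0.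
    have -> : phi t (z + h i *: w) - phi t z = h i *: q i.
      by rewrite /q scalerA mulfV ?gt_eqF// scale1r.
    rewrite -scalerBr !normrZ !(gtr0_norm (h0 i)) => H.
    have {}H : `|q i - q j| <= C * (h i * `|w| + h j) * `|w|.
      by rewrite -(ler_pM2l (h0 i)); apply: le_trans H _; rewrite [leRHS]mulrCA.
    apply: le_lt_trans H _.
    apply: (@le_lt_trans _ _ (C * (e' + e') * 1)).
      rewrite ler_pM ?mulr_ge0 ?addr_ge0 ?mulr_ge0 ?(ltW (h0 _))//.
      rewrite ler_wpM2l// lerD ?(ltW (hN _ _))//.
      by apply: le_trans (ltW (hN i Ni)); rewrite ger_pMr.
    rewrite mulr1 -mulr2n -mulr_natl mulrA (mulrC C) /e' mulrA.
    rewrite ltr_pdivrMr; last by rewrite ltr_wpDl ?mulr_ge0.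
    lra.
  by exists (q N); exists N => // j /= Nj; exact: d.
exists (limn q) => x y k xr yr e.
have l1 : (`|phi t x - phi t y - k *: q j| @[j --> \oo]) --> `|phi t x - phi t y - k *: limn q|.
  apply: cvg_norm; apply: cvgB; first exact: cvg_cst.
  exact: (cvgZl_tmp (k := k) cq).
have l2 : (C * (`|x - z| + `|y - z| + h j) * `|x - y| @[j --> \oo]) -->
    C * (`|x - z| + `|y - z| + 0) * `|x - y|.
  by apply: cvgMr_tmp; apply: cvgMl_tmp; apply: cvgD => //; exact: cvg_cst.
have := ler_cvg_to l1 l2; rewrite addr0; apply.
by near=> j; exact: key.
Unshelve. all: by end_near. Qed.

(** The path from [y] to [x] changes one coordinate at a time, so each of its steps is along a basis
    vector and the rows of [J] are the directional derivatives. Linearity of the directional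
    derivative in the direction is thus never proved. The sup norm keeps the intermediate points in
    the ball. *)
Lemma flow_strict_ball (T r : R) : 0 <= r -> exists2 C, 0 <= C & forall t z,
  `|t| <= T -> `|z| <= r -> exists J : 'M[R]_n, forall x y,
  `|x| <= r + 1 -> `|y| <= r + 1 ->
  `|phi t x - phi t y - (x - y) *m J| <= C * (`|x - z| + `|y - z|) * `|x - y|.
Proof.
move=> r0; have [C C0 hC] := flow_directional T r0.
exists (n%:R * (C * 2)) => [|t z tT zr]; first by rewrite !mulr_ge0.
have e1 (k : 'I_n) : `|delta_mx ord0 k : V| <= 1.
  by apply: norm_le_coord => // j; rewrite mxE eqxx/=; case: (j == k); rewrite ?normr1 ?normr0.
have /choice[l hl] := fun k => hC t z (delta_mx ord0 k) tT zr (e1 k).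
exists (\matrix_k l k) => x y xr yr.
pose p (i : nat) : V := \row_k (if (k < i)%N then x ord0 k else y ord0 k).
have p0 : p 0%N = y by apply/rowP => k; rewrite mxE.
have pn : p n = x by apply/rowP => k; rewrite mxE ltn_ord.
have pr i : `|p i| <= r + 1.
  apply: norm_le_coord => [|k]; first by rewrite addr_ge0.
  by rewrite mxE; case: ifP => _; apply: le_trans (coord_le_norm _ _) _.
have pz i : `|p i - z| <= `|x - z| + `|y - z|.
  apply: norm_le_coord => [|k]; first by rewrite addr_ge0.
  rewrite !mxE; case: ifP => _; [apply: ler_wpDr|apply: ler_wpDl] => //.
    by have := coord_le_norm (x - z) k; rewrite !mxE.
  by have := coord_le_norm (y - z) k; rewrite !mxE.
have pS (i : 'I_n) : p i.+1 - p i = (x - y) ord0 i *: delta_mx ord0 i.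
  apply/rowP => k; rewrite !mxE eqxx/= ltnS.
  have [ki|ki|/val_inj ->] := ltngtP k i.
  - by rewrite subrr; case: eqP ki => [->|_]; rewrite ?ltnn//= mulr0.
  - by rewrite subrr; case: eqP ki => [->|_]; rewrite ?ltnn//= mulr0.
  - by rewrite eqxx/= mulr1.
have -> : phi t x - phi t y = \sum_(i < n) (phi t (p i.+1) - phi t (p i)).
  rewrite -[in LHS]pn -[in LHS]p0 -(big_mkord xpredT (fun i => phi t (p i.+1) - phi t (p i))).
  by rewrite telescope_sumr.
have -> : (x - y) *m (\matrix_k l k) = \sum_(i < n) (x - y) ord0 i *: l i.
  rewrite mulmx_sum_row; apply: eq_bigr => i _; by rewrite rowK.
rewrite -sumrB; apply: le_trans (ler_norm_sum _ _ _) _.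
set B := `|x - z| + `|y - z|.
rewrite (_ : _ * _ * _ * _ = \sum_(i < n) C * (B + B) * `|x - y|); last first.
  rewrite sumr_const card_ord -[RHS]mulr_natl; ring.
apply: ler_sum => i _.
have H := hl i _ _ _ (pr i.+1) (pr i) (pS i).
apply: le_trans H _.
rewrite pS normrZ ler_pM ?mulr_ge0 ?addr_ge0//.
  by rewrite ler_wpM2l// lerD.
by apply: le_trans (coord_le_norm (x - y) i); rewrite ler_piMr.
Qed.

End flow_derivative.

Lemma vector_MVT_ball {R : realType} {n : nat} (u du : R -> 'rV[R]_n) v (s0 d a b c : R) :
  0 <= c -> (forall s, is_derive s (1 : R) u (du s)) ->
  (forall s, `|s - s0| <= d -> `|du s - v| <= c) ->
  `|a - s0| <= d -> `|b - s0| <= d ->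
  `|u b - u a - (b - a) *: v| <= c * `|b - a|.
Proof.
move=> c0 ud duv.
have key p q : p <= q -> `|p - s0| <= d -> `|q - s0| <= d ->
    `|u q - u p - (q - p) *: v| <= c * (q - p).
  move=> pq; rewrite !ler_norml => /andP[p1 p2] /andP[q1 q2].
  apply: vector_MVT => // s /andP[ps sq]; apply: duv; rewrite ler_norml.
  by apply/andP; split; lra.
move=> ad bd; have [ab|/ltW ba] := leP a b.
  by rewrite (ger0_norm (_ : 0 <= b - a)) ?subr_ge0//; exact: key.
rewrite -normrN opprB [in X in X <= _]opprB (distrC b) (ger0_norm (_ : 0 <= a - b)) ?subr_ge0//.
have -> : (b - a) *: v + (u a - u b) = u a - u b - (a - b) *: v.
  by rewrite addrC -(opprB a b) scaleNr.
exact: key.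
Qed.

Lemma le_of_small_increments {R : realType} (a b c h0 : R) : 0 < h0 -> 0 <= c ->
  (forall h, 0 < h -> h <= h0 -> a <= b + h * c) -> a <= b.
Proof.
move=> h00 c0 H; apply/ler_addgt0Pr => e e0.
pose h := Num.min h0 (e / (c + 1)).
have h_gt0 : 0 < h by rewrite lt_min h00 divr_gt0// ltr_wpDl.
apply: le_trans (H h h_gt0 _) _; first by rewrite ge_min lexx.
rewrite lerD2l; apply: (@le_trans _ _ (e / (c + 1) * c)).
  by rewrite ler_wpM2r// ge_min lexx orbT.
by rewrite -mulrA ler_piMr ?(ltW e0)// mulrC ler_pdivrMr ?ltr_wpDl// mul1r lerDl.
Qed.

Lemma small_multiple {R : realType} (c e : R) : 0 <= c -> 0 < e ->
  exists d, [/\ 0 < d, d <= 1 & d * c <= e].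
Proof.
move=> c0 e0; have c1 : 0 < c + 1 by rewrite ltr_wpDl.
exists (Num.min 1 (e / (c + 1))); split.
- by rewrite lt_min ltr01 divr_gt0.
- by rewrite ge_min lexx.
- apply: (@le_trans _ _ (e / (c + 1) * c)).
    by rewrite ler_wpM2r// ge_min lexx orbT.
  by rewrite -mulrA ler_piMr ?(ltW e0)// mulrC ler_pdivrMr// mul1r lerDl.
Qed.

(** * The spatial derivative of a flow, in strict form *)

Section flow_jacobian.
Context {R : realType} {n : nat}.
Notation V := 'rV[R]_n.

(* [J t z] is the Jacobian matrix of [phi t] at [z]. *)
Definition flow_jacobian (phi : R -> V -> V) (J : R -> V -> 'M[R]_n) :=
  forall t z, exists2 C, 0 <= C & forall x y,
  `|x| <= `|z| + 1 -> `|y| <= `|z| + 1 ->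
  `|phi t x - phi t y - (x - y) *m J t z| <= C * (`|x - z| + `|y - z|) * `|x - y|.

Variables (f : V -> V) (phi : R -> V -> V) (K : R).
Hypotheses (Cf : is_Ck 2 f) (fK : forall x, `|f x| <= K) (fl : is_flow f phi).

Lemma flow_jacobian_exists : exists J, flow_jacobian phi J.
Proof.
have /choice[J hJ] : forall p : R * V, exists J : 'M[R]_n, exists2 C, 0 <= C &
    forall x y, `|x| <= `|p.2| + 1 -> `|y| <= `|p.2| + 1 ->
    `|phi p.1 x - phi p.1 y - (x - y) *m J| <= C * (`|x - p.2| + `|y - p.2|) * `|x - y|.
  move=> [t z] /=.
  have [C C0 hC] := flow_strict_ball Cf fK fl `|t| (normr_ge0 z).
  by have [J hJ] := hC t z (lexx _) (lexx _); exists J, C.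
by exists (fun t z => J (t, z)) => t z; exact: hJ (t, z).
Qed.

Variable J : R -> V -> 'M[R]_n.
Hypothesis HJ : flow_jacobian phi J.

Let K0 : 0 <= K. Proof. by apply: le_trans (fK 0). Qed.

Let near_ball (x z : V) (d : R) : `|x - z| <= d -> `|x| <= `|z| + d.
Proof.
move=> xz; rewrite -(subrK z x) addrC; apply: le_trans (ler_normD _ _) _.
by rewrite lerD2l.
Qed.

(** The increment splits into a time increment at the fixed point [x], the change between times [t0]
    and [s] of the spatial increment, and the spatial increment at time [t0], which [J t0 z]
    describes. *)
Lemma flow_strict t0 z (e : R) : 0 < e -> exists2 d, 0 < d & forall t s x y,
  `|t - t0| <= d -> `|s - t0| <= d -> `|x - z| <= d -> `|y - z| <= d ->
  `|phi t x - phi s y - ((t - s) *: f (phi t0 z) + (x - y) *m J t0 z)| <=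
  e * (`|t - s| + `|x - y|).
Proof.
move=> e0.
have [C3 C30 h3] := HJ t0 z.
have [C1 C10 h1] := flow_space_lipschitz Cf fK fl (`|t0| + 1) (`|z| + 1).
have [L L0 hL] := C1_lipschitz_ball (`|z| + 1 + K * (`|t0| + 1)) (is_CkW Cf).
pose B := L * (K + C1) + L * C1 + C3 * 2.
have [d [d0 d1 dB]] := @small_multiple R B e (addr_ge0 (addr_ge0 (mulr_ge0 L0
  (addr_ge0 K0 C10)) (mulr_ge0 L0 C10)) (mulr_ge0 C30 (ler0n _ _))) e0.
exists d => // t s x y td sd xd yd.
have zz : `|z| <= `|z| + 1 by rewrite lerDl.
have xr : `|x| <= `|z| + 1 by apply: near_ball; exact: le_trans d1.
have yr : `|y| <= `|z| + 1 by apply: near_ball; exact: le_trans d1.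
have tT q : `|q - t0| <= d -> `|q| <= `|t0| + 1.
  move=> qd; rewrite -(subrK t0 q) addrC; apply: le_trans (ler_normD _ _) _.
  by rewrite lerD2l (le_trans qd).
have inb q w : `|q| <= `|t0| + 1 -> `|w| <= `|z| + 1 ->
    `|phi q w| <= `|z| + 1 + K * (`|t0| + 1).
  by move=> qd wr; apply: (flow_norm_le fl fK).
have t0T : `|t0| <= `|t0| + 1 by rewrite lerDl.
have e1 : `|phi t x - phi s x - (t - s) *: f (phi t0 z)| <= L * (K + C1) * d * `|t - s|.
  apply: (@vector_MVT_ball _ _ (fun q => phi q x) (fun q => f (phi q x)) _ t0 d) => //.
  - by rewrite !mulr_ge0 ?addr_ge0 ?(ltW d0).
  - by move=> q; case: (fl x).
  move=> q qd; apply: le_trans (hL _ _ (inb _ _ (tT _ qd) xr) (inb _ _ t0T zz)) _.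
  rewrite -mulrA ler_wpM2l//.
  rewrite -(subrK (phi t0 x) (phi q x)) -addrA mulrDl; apply: le_trans (ler_normD _ _) _.
  rewrite lerD//; first by apply: le_trans (flow_time_lipschitz fl fK _ _ _) _; rewrite ler_wpM2l.
  by apply: le_trans (h1 _ _ _ xr zz t0T) _; rewrite ler_wpM2l.
have e2 : `|phi s x - phi s y - (phi t0 x - phi t0 y)| <= L * C1 * `|x - y| * d.
  have := @vector_MVT_ball _ _ (fun q => phi q x - phi q y)
    (fun q => f (phi q x) - f (phi q y)) 0 t0 d t0 s (L * C1 * `|x - y|).
  rewrite scaler0 subr0 => h; apply: le_trans (h _ _ _ _ _) _ => //.
  - by rewrite !mulr_ge0.
  - by move=> q; apply: is_deriveB; [case: (fl x)|case: (fl y)].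
  - move=> q qd; rewrite subr0.
    apply: le_trans (hL _ _ (inb _ _ (tT _ qd) xr) (inb _ _ (tT _ qd) yr)) _.
    by rewrite -mulrA ler_wpM2l// h1// tT.
  - by rewrite subrr normr0 ltW.
  - by rewrite ler_wpM2l// !mulr_ge0.
have e3 : `|phi t0 x - phi t0 y - (x - y) *m J t0 z| <= C3 * (d + d) * `|x - y|.
  by apply: le_trans (h3 _ _ xr yr) _; rewrite ler_wpM2r// ler_wpM2l// lerD.
have -> : phi t x - phi s y - ((t - s) *: f (phi t0 z) + (x - y) *m J t0 z) =
  (phi t x - phi s x - (t - s) *: f (phi t0 z)) +
  ((phi s x - phi s y - (phi t0 x - phi t0 y)) +
   (phi t0 x - phi t0 y - (x - y) *m J t0 z)).
  by apply/rowP => i; rewrite !mxE; ring.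
apply: le_trans (ler_normD _ _) _.
apply: le_trans (lerD e1 (le_trans (ler_normD _ _) (lerD e2 e3))) _.
apply: (@le_trans _ _ (d * B * (`|t - s| + `|x - y|))); last first.
  by rewrite ler_wpM2r// addr_ge0.
have := mulr_ge0 (mulr_ge0 (ltW d0) (addr_ge0 (mulr_ge0 L0 C10) (mulr_ge0 C30 (ler0n R 2)))) (normr_ge0 (t - s)).
have := mulr_ge0 (mulr_ge0 (ltW d0) (mulr_ge0 L0 (addr_ge0 K0 C10))) (normr_ge0 (x - y)).
rewrite /B; lra.
Qed.

(** First order expansion of the Jacobian in time, uniform in [y] near [z]. As [J] is known through
    finite increments only, the expansion is shown for the increment from [y] to [y + h *: w],
    divided by [h], and [h] is sent to 0. *)
Lemma flow_jacobian_expansion z (e : R) : 0 < e -> exists2 d, 0 < d & forall s y (w : V),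
  `|s| <= d -> `|y - z| <= d ->
  `|w *m J s y - w - s *: (w *m jacobian f z)| <= e * `|s| * `|w|.
Proof.
move=> e0.
have [C1 C10 h1] := flow_space_lipschitz Cf fK fl 1 (`|z| + 2).
have [L L0 hL] := C1_lipschitz_ball (`|z| + 2 + K * 1) (is_CkW Cf).
have [L' L'0 hL'] := C1_diff_bound (`|z| + 2 + K * 1) (is_CkW Cf).
have [B B0 hB] := C2_increment_ball (`|z| + 2 + K * 1) Cf.
pose C := B * (2 * C1 + 2 * K) * C1 + L' * L * C1.
have CC0 : 0 <= C.
  by rewrite addr_ge0 // !mulr_ge0 // addr_ge0 // mulr_ge0.
have zz : `|z| <= `|z| + 2 by rewrite lerDl.
have inb q w : `|q| <= 1 -> `|w| <= `|z| + 2 -> `|phi q w| <= `|z| + 2 + K * 1.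
  by move=> qd wr; apply: (flow_norm_le fl fK).
have step x y s : `|x - z| <= 2 -> `|y - z| <= 2 -> `|s| <= 1 ->
    `|phi s x - phi s y - (x - y) - s *: ((x - y) *m jacobian f z)| <=
    C * (`|x - z| + `|y - z| + `|s|) * `|x - y| * `|s|.
  move=> /near_ball xr /near_ball yr s1.
  have := @vector_MVT_ball _ _ (fun q => phi q x - phi q y)
    (fun q => f (phi q x) - f (phi q y)) ((x - y) *m jacobian f z) 0 `|s| 0 s
    (C * (`|x - z| + `|y - z| + `|s|) * `|x - y|).
  rewrite (fl x).1 (fl y).1 !subr0 normr0; apply => //.
  - by rewrite mulr_ge0// mulr_ge0// !addr_ge0.
  - by move=> q; apply: is_deriveB; [case: (fl x)|case: (fl y)].
  move=> q; rewrite subr0 => qs.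
  have q1 : `|q| <= 1 by exact: le_trans s1.
  have z1 : `|z| <= `|z| + 2 + K * 1 by rewrite -addrA lerDl addr_ge0 ?mulr_ge0.
  have dist w : `|w| <= `|z| + 2 -> `|phi q w - z| <= C1 * `|w - z| + K * `|s|.
    move=> wr; rewrite -(subrK (phi q z) (phi q w)) -addrA.
    apply: le_trans (ler_normD _ _) _; rewrite lerD ?h1//.
    have := flow_time_lipschitz fl fK z 0 q; rewrite (fl z).1 subr0 => /le_trans; apply.
    by rewrite ler_wpM2l.
  have hxy : `|phi q x - phi q y| <= C1 * `|x - y| by exact: h1.
  have hdiff : `|(phi q x - phi q y) - (x - y)| <= L * C1 * `|x - y| * `|s|.
    have := @vector_MVT_ball _ _ (fun q => phi q x - phi q y)
      (fun q => f (phi q x) - f (phi q y)) 0 0 `|s| 0 q (L * C1 * `|x - y|).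
    rewrite (fl x).1 (fl y).1 scaler0 !subr0 => h; apply: le_trans (h _ _ _ _ _) _ => //.
    - by rewrite !mulr_ge0.
    - by move=> p; apply: is_deriveB; [case: (fl x)|case: (fl y)].
    - move=> p; rewrite !subr0 => ps; have p1 : `|p| <= 1 by exact: le_trans s1.
      apply: le_trans (hL _ _ (inb _ _ p1 xr) (inb _ _ p1 yr)) _.
      by rewrite -mulrA ler_wpM2l// h1.
    - by rewrite normr0.
    - by rewrite ler_wpM2l// !mulr_ge0.
  have -> : f (phi q x) - f (phi q y) - (x - y) *m jacobian f z =
    (f (phi q x) - f (phi q y) - (phi q x - phi q y) *m jacobian f z) +
    (phi q x - phi q y - (x - y)) *m jacobian f z.
    by rewrite [X in _ = _ + X]mulmxBl addrA subrK.
  apply: le_trans (ler_normD _ _) _.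
  apply: le_trans (lerD (hB _ _ _ (inb _ _ q1 xr) (inb _ _ q1 yr) z1) (hL' _ _ z1)) _.
  apply: (@le_trans _ _ (B * ((C1 * `|x - z| + K * `|s|) + (C1 * `|y - z| + K * `|s|)) * (C1 * `|x - y|)
     + L' * (L * C1 * `|x - y| * `|s|))).
    rewrite lerD ?ler_wpM2l// ler_pM ?mulr_ge0 ?addr_ge0// ler_wpM2l//.
    by rewrite lerD// dist.
  set a := `|x - z|; set b := `|y - z|; set c := `|x - y|; set u := `|s|.
  have [a0 b0 c0 u0] : [/\ 0 <= a, 0 <= b, 0 <= c & 0 <= u] by split; exact: normr_ge0.
  have p1 : 0 <= B * C1 * C1 * c * (a + b) by rewrite !mulr_ge0 ?addr_ge0.
  have p2 : 0 <= B * C1 * C1 * c * u by rewrite !mulr_ge0.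
  have p3 : 0 <= B * K * C1 * c * (a + b) by rewrite !mulr_ge0 ?addr_ge0.
  have p4 : 0 <= L' * L * C1 * c * (a + b) by rewrite !mulr_ge0 ?addr_ge0.
  rewrite /C; lra.
have [d [d0 d1 dB]] := @small_multiple R (C * 3) e (mulr_ge0 CC0 (ler0n _ _)) e0.
exists d => // s y w sd yd.
have [C' C'0 h'] := HJ s y.
apply: (@le_trans _ _ (C * 3 * d * `|s| * `|w|)); last first.
  by rewrite ler_wpM2r// ler_wpM2r// mulrC.
pose h0 : R := (`|w| + 1)^-1.
have w1 : 0 < `|w| + 1 by rewrite ltr_wpDl.
apply: (@le_of_small_increments _ _ _ (C * `|s| * `|w| ^+ 2 + C' * `|w| ^+ 2) h0).
- by rewrite invr_gt0.
- by rewrite addr_ge0// !mulr_ge0 ?sqr_ge0.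
move=> h h_gt0 hh0.
have hw : h * `|w| <= 1.
  apply: le_trans (ler_wpM2r (normr_ge0 w) hh0) _.
  by rewrite /h0 mulrC ler_pdivrMr// mul1r lerDl.
have zK (u v : V) : u + v - u = v by rewrite addrAC subrr add0r.
have yhw : `|y + h *: w - z| <= d + h * `|w|.
  rewrite addrAC; apply: le_trans (ler_normD _ _) _; rewrite lerD//.
  by rewrite normrZ gtr0_norm.
have A1 := step (y + h *: w) y s _ _ (le_trans sd d1).
have {}A1 := A1 (le_trans yhw (lerD d1 hw)) (le_trans yd (le_trans d1 (ler1n _ 2))).
have B1 : `|y + h *: w| <= `|y| + 1.
  by apply: near_ball; rewrite zK normrZ gtr0_norm.
have B2 : `|y| <= `|y| + 1 by rewrite lerDl.
have A2 := h' _ _ B1 B2.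
move: A1 A2; rewrite zK subrr normr0 addr0 -!scalemxAl.
set P := phi s (y + h *: w) - phi s y => A1 A2.
rewrite -(ler_pM2l h_gt0) -[X in X * `|_|](gtr0_norm h_gt0) -normrZ.
have -> : h *: (w *m J s y - w - s *: (w *m jacobian f z)) =
    (P - h *: w - s *: (h *: (w *m jacobian f z))) - (P - h *: (w *m J s y)).
  by apply/rowP => i; rewrite !mxE; ring.
apply: le_trans (ler_normB _ _) _; apply: le_trans (lerD A1 A2) _.
rewrite !normrZ !(gtr0_norm h_gt0).
apply: (@le_trans _ _ (C * ((d + h * `|w|) + d + d) * (h * `|w|) * `|s| +
   C' * (h * `|w|) * (h * `|w|))).
  rewrite lerD2r ler_wpM2r// ler_wpM2r ?mulr_ge0 ?(ltW h_gt0)// ler_wpM2l//.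
  by rewrite lerD// lerD.
lra.
Qed.

Lemma flow_jacobian0 z : J 0 z = 1%:M.
Proof.
have [d d0 hd] := flow_jacobian_expansion z ltr01.
apply/row_matrixP => i; have := hd 0 z (delta_mx ord0 i).
rewrite subrr !normr0 (ltW d0) mulr0 mul0r scale0r subr0 => /(_ isT isT).
rewrite normr_le0 subr_eq0 => /eqP h.
by rewrite !rowE h mulmx1.
Qed.

(** The chain rule for [phi (- t)] after [phi t], carried out on increments [h *: w] with an error
    of order [h ^+ 2]. Its use is the invertibility of the Jacobians. *)
Lemma flow_jacobianK t z : J t z *m J (- t) (phi t z) = 1%:M.
Proof.
have [C C0 hC] := HJ t z; have [D D0 hD] := HJ (- t) (phi t z).
have [M M0 hM] := flow_space_lipschitz Cf fK fl `|t| (`|z| + 1).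
apply/row_matrixP => i; rewrite !rowE mulmx1; set w := delta_mx _ _.
have w1 : `|w| <= 1.
  by apply: norm_le_coord => // j; rewrite mxE eqxx/=; case: (j == i); rewrite ?normr1 ?normr0.
apply/eqP; rewrite -subr_eq0 -normr_le0.
set J' := J (- t) _.
pose h0 : R := (M + 1)^-1.
have M1 : 0 < M + 1 by rewrite ltr_wpDl.
apply: (@le_of_small_increments _ _ _ (n%:R * `|J'| * C + D * M * M) h0).
- by rewrite invr_gt0.
- by rewrite addr_ge0// !mulr_ge0.
move=> h h_gt0 hh0; rewrite add0r.
have h1 : h <= 1.
  by apply: le_trans hh0 _; rewrite invf_le1// lerDr.
have hM1 : M * h <= 1.
  apply: le_trans (ler_wpM2l M0 hh0) _.
  by rewrite ler_pdivrMr// mul1r lerDl.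
have hw : `|h *: w| <= h by rewrite normrZ gtr0_norm// ler_piMr// ltW.
have zK (u v : V) : u + v - u = v by rewrite addrAC subrr add0r.
have B1 : `|z + h *: w| <= `|z| + 1.
  by apply: near_ball; rewrite zK (le_trans hw).
have B2 : `|z| <= `|z| + 1 by rewrite lerDl.
have A1 := hC _ _ B1 B2.
have Mz := hM _ _ t B1 B2 (lexx _).
move: A1 Mz; rewrite zK subrr normr0 addr0 => A1 Mz.
have {}Mz : `|phi t (z + h *: w) - phi t z| <= M * h.
  by apply: le_trans Mz _; rewrite ler_wpM2l.
have A2 := hD (phi t (z + h *: w)) (phi t z) _ _.
have {}A2 := A2 (near_ball (le_trans Mz hM1)).
have {}A2 := A2 (le_trans (lexx _) _); move: A2; rewrite lerDl => /(_ ler01).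
rewrite !(flow_group Cf fK fl) addNr (fl _).1 (fl _).1 zK subrr normr0 addr0 => A2.
set P := phi t (z + h *: w) - phi t z in A1 A2 Mz.
rewrite -(ler_pM2l h_gt0) -[X in X * `|_ - w|](gtr0_norm h_gt0) -normrZ.
have -> : h *: (w *m (J t z *m J') - w) =
    - (P - (h *: w) *m J t z) *m J' - (h *: w - P *m J').
  rewrite mulNmx mulmxBl scalerBr opprB opprB -!scalemxAl mulmxA.
  by apply/rowP => k; rewrite !mxE; ring.
apply: le_trans (ler_normB _ _) _.
apply: le_trans (lerD (norm_mulmx_le _ _) A2) _; rewrite normrN.
apply: (@le_trans _ _ (n%:R * `|J'| * (C * h * h) + D * (M * h) * (M * h))).
  rewrite lerD//.
    rewrite ler_wpM2l ?mulr_ge0//; apply: le_trans A1 _.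
    by rewrite ler_pM ?mulr_ge0// ler_wpM2l.
  by rewrite ler_pM ?mulr_ge0// ler_wpM2l.
lra.
Qed.

End flow_jacobian.

(** * Lie brackets *)

Section smooth_fields.
Context {R : realType} {n : nat}.
Notation V := 'rV[R]_n.
Implicit Types (f g : V -> V).

(** A coordinate times a vector, written as a bilinear map so that the differential of a continuous
    bilinear map gives the product rule. *)
Definition coord_scale (j : 'I_n) (u v : V) : V := u ord0 j *: v.

Lemma coord_scale_is_bilinear j :
  bilinear_for
    (GRing.Scale.Law.clone _ _ *:%R _) (GRing.Scale.Law.clone _ _ *:%R _)
    (coord_scale j).
Proof.
split=> [u'|u] a x y /=; rewrite /coord_scale.
- by rewrite !mxE scalerDl scalerA.
- by rewrite scalerDr !scalerA (mulrC a).
Qed.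

HB.instance Definition _ j := bilinear_isBilinear.Build R V V V _ _ (coord_scale j)
  (coord_scale_is_bilinear j).

Lemma coord_scale_continuous j : continuous (fun p => coord_scale j p.1 p.2).
Proof.
move=> p; apply: cvgZ; last exact: cvg_snd.
apply: (@continuous_comp _ _ _ (fun p : V * V => p.1) (fun u : V => u ord0 j)).
  exact: cvg_fst.
exact: coord_continuous.
Qed.

Lemma is_diff_coord_scale j f g x : differentiable f x -> differentiable g x ->
  is_diff x (fun y => f y ord0 j *: g y)
    (fun v => f x ord0 j *: 'd g x v + 'd f x v ord0 j *: g x).
Proof.
move=> df dg.
pose b := (fun q : V * V => coord_scale j q.1 q.2).
have h1 : is_diff x (fun y => (f y, g y)) (fun y => ('d f x y, 'd g x y)).
  by apply: is_diff_pair; exact: differentiableP.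
have h2 : is_diff (f x, g x) b
    (fun q : V * V => coord_scale j (f x) q.2 + coord_scale j q.1 (g x)).
  apply: DiffDef; first exact/differentiable_bilin/coord_scale_continuous.
  by rewrite diff_bilin//; exact: coord_scale_continuous.
exact: (is_diff_comp h1 h2).
Qed.

Lemma is_Ck_add k f g : is_Ck k f -> is_Ck k g -> is_Ck k (fun x => f x + g x).
Proof.
elim: k f g => [|k IH] f g /=; first by move=> cf cg x; exact: (continuousD (cf x) (cg x)).
move=> [df cf] [dg cg]; split=> [x|v]; first exact: differentiableD.
have -> : (fun x => 'd (fun x => f x + g x) x v) = (fun x => 'd f x v + 'd g x v).
  by apply/funext => x; exact: (congr1 (fun h : V -> V => h v) (diffD (df x) (dg x))).
exact: (IH (fun x => 'd f x v) (fun x => 'd g x v) (cf v) (cg v)).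
Qed.

Lemma is_Ck_coord_scale k j f g :
  is_Ck k f -> is_Ck k g -> is_Ck k (fun x => f x ord0 j *: g x).
Proof.
elim: k f g => [|k IH] f g.
  move=> cf cg x.
  have h1 : {for x, continuous (fun y => f y ord0 j)}.
    exact: (@continuous_comp _ _ _ f (fun u : V => u ord0 j) x (cf x) (@coord_continuous R 1 n ord0 j (f x))).
  exact: (cvgZ h1 (cg x)).
move=> Cf Cg; have [df cf] := Cf; have [dg cg] := Cg.
have h x := is_diff_coord_scale j (df x) (dg x).
split=> [x|v]; first by case: (h x).
have -> : (fun x => 'd (fun y => f y ord0 j *: g y) x v) =
    (fun x => f x ord0 j *: 'd g x v + 'd f x v ord0 j *: g x).
  by apply/funext => x; exact: (congr1 (fun h : V -> V => h v) (@diff_val _ _ _ _ _ _ _ (h x))).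
apply: (@is_Ck_add k (fun x => f x ord0 j *: 'd g x v) (fun x => 'd f x v ord0 j *: g x)).
  exact: (IH f (fun x => 'd g x v) (is_CkW Cf) (cg v)).
exact: (IH (fun x => 'd f x v) g (cf v) (is_CkW Cg)).
Qed.

Lemma is_Ck_const k (v : V) : is_Ck k (fun=> v).
Proof.
elim: k v => [|k IH] v /=; first exact: cst_continuous.
split=> [x|w]; first exact: differentiable_cst.
have -> : (fun x : V => 'd (fun=> v) x w) = (fun=> 0).
  by apply/funext => x; exact: (congr1 (fun h : V -> V => h w) (diff_cst v x)).
exact: IH.
Qed.

Lemma is_Ck_sum k (I : eqType) (s : seq I) (G : I -> V -> V) :
  (forall i, is_Ck k (G i)) -> is_Ck k (fun x => \sum_(i <- s) G i x).
Proof.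
move=> CG; elim: s => [|i s IH].
  have -> : (fun x => \sum_(i <- [::]) G i x) = (fun=> 0).
    by apply/funext => x; rewrite big_nil.
  exact: is_Ck_const.
have -> : (fun x => \sum_(j <- i :: s) G j x) = (fun x => G i x + \sum_(i <- s) G i x).
  by apply/funext => x; rewrite big_cons.
exact: (is_Ck_add (CG i) IH).
Qed.

(** Expanding [f x] in the basis leaves differentials in fixed directions, the only ones that
    [is_Ck] speaks of. *)
Lemma is_Ck_diff_apply k f g : is_Ck k f -> is_Ck k.+1 g ->
  is_Ck k (fun x => 'd g x (f x)).
Proof.
move=> Cf [dg Cg].
have -> : (fun x => 'd g x (f x)) =
    (fun x => \sum_(j <- enum 'I_n) f x ord0 j *: 'd g x (delta_mx ord0 j)).
  apply/funext => x; rewrite [X in 'd g x X = _]row_sum_delta linear_sum big_enum/=.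
  by apply: eq_bigr => j _; rewrite linearZ.
apply: (@is_Ck_sum k _ _ (fun j x => f x ord0 j *: 'd g x (delta_mx ord0 j))) => j.
exact: (is_Ck_coord_scale j Cf (Cg (delta_mx ord0 j))).
Qed.

Lemma smooth_lie_bracket f g : smooth f -> smooth g -> smooth (lie_bracket f g).
Proof.
move=> sf sg k.
exact: (is_Ck_add (is_Ck_diff_apply (sf k) (sg k.+1))
  (is_Ck_opp (is_Ck_diff_apply (sg k) (sf k.+1)))).
Qed.

Lemma smooth_bracket_family (E : finType) (F : E -> V -> V) k G :
  (forall i, smooth (F i)) -> G \in bracket_family F k -> smooth G.
Proof.
move=> sF; elim: k G => [|k IH] G /=; first by move=> /mapP[i _ ->].
rewrite mem_cat => /orP[/IH//|/allpairsP[[i H] [/= _ /IH sH ->]]].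
exact: smooth_lie_bracket.
Qed.

End smooth_fields.

(** * Words of switched flows *)

(** This is the Lie derivative: the field [G], transported back to [y] along the flow, has the
    bracket as right derivative at 0. Expanding [G] along the flow contributes
    [f y *m jacobian G y], and expanding the inverse Jacobian contributes
    [- G y *m jacobian f y]. *)
Lemma flow_pullback_derivative {R : realType} {n : nat} (f : 'rV[R]_n -> 'rV[R]_n)
  phi (K : R) J G :
  is_Ck 2 f -> (forall x, `|f x| <= K) -> is_flow f phi -> flow_jacobian phi J ->
  is_Ck 2 G -> forall y (e : R), 0 < e -> exists2 s0, 0 < s0 & forall s, 0 < s -> s <= s0 ->
  `|G (phi s y) *m J (- s) (phi s y) - G y - s *: lie_bracket f G y| <= e * s.
Proof.
move=> Cf fK fl HJ CG y e e0.
have K0 : 0 <= K by apply: le_trans (fK 0).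
have [C C0 hC] := C2_increment_ball (`|y| + 1) CG.
have [B B0 hB] := continuous_bounded_ball (`|y| + 1) (is_CkW (is_CkW CG)).
have jac (h : 'rV[R]_n -> 'rV[R]_n) :
    exists2 a, 0 <= a & forall v : 'rV[R]_n, `|v *m jacobian h y| <= a * `|v|.
  exists (n%:R * `|jacobian h y|) => [|v]; [exact: mulr_ge0|exact: norm_mulmx_le].
have [a a0 ha] := jac f; have [b b0 hb] := jac G.
pose c1 := 1 + b.
(* The three summands are the constants of the estimates [A4], [A3] and [A6] below. *)
pose D := B + c1 + a * (c1 + b * K).
have c10 : 0 <= c1 by rewrite addr_ge0.
have D0 : 0 <= D by rewrite !addr_ge0 ?mulr_ge0// addr_ge0// mulr_ge0.
have [e1 [e10 e11 e1D]] := small_multiple D0 e0.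
have [d1 d10 h1] := flow_strict Cf fK fl HJ 0 y e10.
have [d2 d20 h2] := flow_jacobian_expansion Cf fK fl HJ y e10.
have [d3 [d30 d31 d3e]] := small_multiple (addr_ge0 (mulr_ge0 (mulr_ge0 C0 K0) K0) (ler01 : (0 : R) <= 1)) e10.
have [d4 [d40 d41 d4e]] := small_multiple K0 d20.
have [d5 [d50 d51 d5e]] := small_multiple K0 (ltr01 : (0 : R) < 1).
pose s0 := Num.min (Num.min d1 d2) (Num.min d3 (Num.min d4 d5)).
exists s0; first by rewrite !lt_min d10 d20 d30 d40 d50.
move=> s s_gt0; rewrite !le_min => /andP[/andP[s1 s2] /and3P[s3 s4 s5]].
have sn : `|s| = s by rewrite gtr0_norm.
have hK : `|phi s y - y| <= K * s.
  by have := flow_time_lipschitz fl fK y 0 s; rewrite (fl y).1 subr0 sn.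
have Ky1 : K * s <= 1 by apply: le_trans d5e; rewrite mulrC ler_wpM2r.
have yr : `|phi s y| <= `|y| + 1.
  rewrite -(subrK y (phi s y)) addrC; apply: le_trans (ler_normD _ _) _.
  by rewrite lerD2l (le_trans hK).
have y1 : `|y| <= `|y| + 1 by rewrite lerDl.
have A1 : `|phi s y - y - s *: f y| <= e1 * s.
  have := h1 s 0 y y.
  rewrite !subrr !subr0 !normr0 (fl y).1 mul0mx !addr0 sn; apply => //; exact: ltW.
have se1 : s <= e1.
  apply: le_trans d3e; apply: le_trans s3 _; rewrite ler_peMr ?(ltW d30)//.
  by rewrite lerDr !mulr_ge0.
have A2 : `|G (phi s y) - G y - (phi s y - y) *m jacobian G y| <= e1 * s.
  apply: le_trans (hC _ _ _ yr y1 y1) _; rewrite subrr normr0 addr0.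
  apply: (@le_trans _ _ (C * (K * s) * (K * s))).
    by rewrite ler_pM ?mulr_ge0// ler_wpM2l.
  rewrite (_ : _ * _ * _ = s * (C * K * K) * s); last by ring.
  rewrite ler_wpM2r ?(ltW s_gt0)//; apply: le_trans d3e.
  by rewrite ler_pM ?(ltW s_gt0) ?mulr_ge0// lerDl.
set Gs := G (phi s y) in A2 *.
have hBs : `|Gs| <= B := hB _ yr.
clearbody Gs.
have A3 : `|Gs - G y - s *: (f y *m jacobian G y)| <= c1 * (e1 * s).
  have -> : Gs - G y - s *: (f y *m jacobian G y) =
    (Gs - G y - (phi s y - y) *m jacobian G y) +
    (phi s y - y - s *: f y) *m jacobian G y.
    by rewrite [X in _ = _ + X]mulmxBl -scalemxAl addrA subrK.
  apply: le_trans (ler_normD _ _) _; rewrite /c1 mulrDl mul1r.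
  apply: lerD; first exact: A2.
  by apply: le_trans (hb _) _; apply: (ler_wpM2l b0); exact: A1.
have A4 : `|Gs *m J (- s) (phi s y) - Gs + s *: (Gs *m jacobian f y)| <= B * (e1 * s).
  have := h2 (- s) (phi s y) Gs; rewrite normrN sn scaleNr opprK => H.
  apply: le_trans (H s2 _) _.
    by apply: le_trans hK _; apply: le_trans d4e; rewrite mulrC ler_wpM2r.
  rewrite mulrC; apply: ler_wpM2r; first by rewrite mulr_ge0 ?(ltW e10) ?(ltW s_gt0).
  exact: hBs.
have A5 : `|Gs - G y| <= (c1 + b * K) * s.
  rewrite -(subrK (s *: (f y *m jacobian G y)) (Gs - G y)).
  apply: le_trans (ler_normD _ _) _; rewrite mulrDl; apply: lerD.
    apply: le_trans A3 _; rewrite ler_wpM2l//.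
    by rewrite ler_piMl ?(ltW s_gt0).
  rewrite normrZ sn mulrC; apply: (ler_wpM2r (ltW s_gt0)).
  by apply: le_trans (hb _) _; apply: (ler_wpM2l b0); exact: fK.
have A6 : `|s *: ((Gs - G y) *m jacobian f y)| <= a * (c1 + b * K) * (e1 * s).
  rewrite normrZ sn; apply: (@le_trans _ _ (s * (a * ((c1 + b * K) * s)))).
    apply: (ler_wpM2l (ltW s_gt0)).
    by apply: le_trans (ha _) _; apply: (ler_wpM2l a0); exact: A5.
  rewrite (_ : s * _ = a * (c1 + b * K) * (s * s)); last by ring.
  by rewrite ler_wpM2l ?mulr_ge0 ?addr_ge0 ?mulr_ge0// ler_wpM2r ?(ltW s_gt0).
have -> : Gs *m J (- s) (phi s y) - G y - s *: lie_bracket f G y =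
  (Gs *m J (- s) (phi s y) - Gs + s *: (Gs *m jacobian f y)) +
  ((Gs - G y - s *: (f y *m jacobian G y)) - s *: ((Gs - G y) *m jacobian f y)).
  rewrite (_ : lie_bracket f G y = f y *m jacobian G y - G y *m jacobian f y); last first.
    by congr (_ - _); exact: diff_jacobian.
  rewrite (mulmxBl Gs).
  move: (Gs *m J (- s) (phi s y)) (Gs *m jacobian f y) (G y *m jacobian f y)
    (f y *m jacobian G y) => u1 u2 u3 u4.
  by apply/rowP => i; rewrite !mxE; ring.
apply: le_trans (ler_normD _ _) _.
apply: le_trans (lerD A4 (le_trans (ler_normB _ _) (lerD A3 A6))) _.
apply: (@le_trans _ _ (e1 * D * s)); last by rewrite ler_wpM2r ?(ltW s_gt0).
rewrite /D; lra.
Qed.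

Section words.
Context {R : realType} {n : nat} {E : eqType}.
Notation V := 'rV[R]_n.
Variables (F : E -> V -> V) (Phi : E -> R -> V -> V) (J : E -> R -> V -> 'M[R]_n).
Variable adm : V -> E -> E -> bool.
Implicit Types (w : seq (E * R)) (x : V).

Fixpoint word_flow w x : V :=
  if w is it :: w' then word_flow w' (Phi it.1 it.2 x) else x.

Fixpoint word_jacobian w x : 'M[R]_n :=
  if w is it :: w' then J it.1 it.2 x *m word_jacobian w' (Phi it.1 it.2 x) else 1%:M.

(* Row [k] is the derivative of the end point with respect to the [k]-th time. *)
Fixpoint word_tangent w x : 'M[R]_(size w, n) :=
  match w return 'M[R]_(size w, n) with
  | [::] => 0
  | it :: w' => col_mx (F it.1 (Phi it.1 it.2 x) *m word_jacobian w' (Phi it.1 it.2 x))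
                       (word_tangent w' (Phi it.1 it.2 x))
  end.

(* Each step of a word switches the state first, and then follows the flow. *)
Fixpoint admissible (i : E) x w : bool :=
  if w is it :: w' then adm x i it.1 && admissible it.1 (Phi it.1 it.2 x) w'
  else true.

Definition last_state (i : E) w := last i (map fst w).
Definition total_time w : R := \sum_(it <- w) it.2.

Lemma word_flow_rcons w it x :
  word_flow (rcons w it) x = Phi it.1 it.2 (word_flow w x).
Proof. by elim: w x => //= a w IH x; rewrite IH. Qed.

Lemma word_jacobian_rcons w it x :
  word_jacobian (rcons w it) x = word_jacobian w x *m J it.1 it.2 (word_flow w x).
Proof. by elim: w x => [|a w IH] x /=; rewrite ?mulmx1 ?mul1mx// IH mulmxA. Qed.

(** Words are built at the head but extended at the tail. The added piece transports the old rows by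
    its Jacobian and contributes its final velocity. Comparing row spaces avoids a cast between
    [size (rcons w it)] and [(size w).+1]. *)
Lemma word_tangent_rcons w it x :
  (word_tangent (rcons w it) x :=:
   word_tangent w x *m J it.1 it.2 (word_flow w x) + F it.1 (word_flow (rcons w it) x))%MS.
Proof.
have colE m (u : V) (B : 'M[R]_(m, n)) : (@col_mx R 1 m n u B :=: u + B)%MS.
  exact: eqmx_sym (addsmxE u B).
elim: w x => [|a w IH] x.
  have h := colE 0%N (F it.1 (Phi it.1 it.2 x) *m 1%:M) 0.
  rewrite /= mul0mx; apply: (eqmx_trans h).
  by rewrite mulmx1; apply: eqmx_trans (addsmx0 _ _) (eqmx_sym (adds0mx _ _)).
set y := Phi a.1 a.2 x.
have h1 := colE _ (F a.1 y *m word_jacobian (rcons w it) y) (word_tangent (rcons w it) y).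
have h2 := colE _ (F a.1 y *m word_jacobian w y) (word_tangent w y).
apply: (eqmx_trans h1).
apply: eqmx_trans (adds_eqmx (eqmx_refl _) (IH y)) _.
apply: eqmx_trans (eqmx_sym (adds_eqmx (eqmxMr _ h2) (eqmx_refl _))).
apply: eqmx_trans (eqmx_sym (adds_eqmx (addsmxMr _ _ _) (eqmx_refl _))).
by rewrite addsmxA word_jacobian_rcons mulmxA.
Qed.

Lemma admissible_rcons i x w it : admissible i x (rcons w it) =
  admissible i x w && adm (word_flow w x) (last_state i w) it.1.
Proof. by elim: w i x => [|a w IH] i x /=; rewrite ?andbT// IH andbA. Qed.

Lemma last_state_rcons i w it : last_state i (rcons w it) = it.1.
Proof. by rewrite /last_state map_rcons last_rcons. Qed.

Lemma total_time_rcons w it : total_time (rcons w it) = total_time w + it.2.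
Proof. by rewrite /total_time -cats1 big_cat big_seq1. Qed.

End words.

(** * Maximal rank and iterated brackets *)

Section full_rank_word.
Context {R : realType} {n : nat} {E : finType}.
Notation V := 'rV[R]_n.
Variables (F : E -> V -> V) (Phi : E -> R -> V -> V) (J : E -> R -> V -> 'M[R]_n).
Variables (adm : V -> E -> E -> bool) (M : set V) (K : R).
Hypothesis F_smooth : forall i, smooth (F i).
Hypothesis F_le : forall i x, `|F i x| <= K.
Hypothesis Phi_flow : forall i, is_flow (F i) (Phi i).
Hypothesis Phi_jacobian : forall i, flow_jacobian (Phi i) (J i).
Hypothesis M_invariant : forall i (t : R) x, 0 <= t -> M x -> M (Phi i t x).
Hypothesis adm_refl : forall x i, M x -> adm x i i.
Hypothesis adm_connect : forall x i j, M x -> connect (adm x) i j.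

Local Notation wflow := (word_flow Phi).
Local Notation tangent := (word_tangent F Phi J).
Local Notation admissible := (admissible Phi adm).

Definition nonneg_times (w : seq (E * R)) := forall it, it \in w -> 0 <= it.2.

Lemma nonneg_times_rcons w i t : nonneg_times w -> 0 <= t -> nonneg_times (rcons w (i, t)).
Proof. by move=> w0 t0 it; rewrite mem_rcons inE => /orP[/eqP -> //|/w0]. Qed.

Lemma word_flow_invariant w x : nonneg_times w -> M x -> M (wflow w x).
Proof.
elim: w x => //= it w IH x w0 Mx; apply: IH => [j jw|].
  by apply: w0; rewrite inE jw orbT.
by apply: M_invariant => //; apply: w0; rewrite mem_head.
Qed.

Lemma word_flow_dist w x : nonneg_times w -> `|wflow w x - x| <= K * total_time w.
Proof.
elim: w x => [|it w IH] x w0 /=.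
  by rewrite subrr normr0 /total_time big_nil mulr0.
have t0 : 0 <= it.2 by apply: w0; rewrite mem_head.
rewrite /total_time big_cons mulrDr -(subrK (Phi it.1 it.2 x) (wflow w _)) -addrA addrC.
apply: le_trans (ler_normD _ _) _; apply: lerD.
  have := flow_time_lipschitz (Phi_flow it.1) (F_le it.1) x 0 it.2.
  by rewrite (Phi_flow it.1 x).1 subr0 ger0_norm.
by apply: IH => j jw; apply: w0; rewrite inE jw orbT.
Qed.

(** Matrices [A] take the place of covectors because the conclusion is applied to [cokermx] of a
    tangent matrix, which is zero exactly when that matrix has full rank. *)
Lemma bracket_annihilator p : weak_bracket_condition F p ->
  exists k, forall m (A : 'M[R]_(n, m)),
  (forall G, G \in bracket_family F k -> G p *m A = 0) -> A = 0.
Proof.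
move=> [k hk]; exists k => m A hA.
apply/row_matrixP => i; rewrite row0 rowE.
have : delta_mx 0 i \in (<<[seq G p | G <- bracket_family F k]>>%VS : {vspace V}).
  by rewrite hk memvf.
rewrite -[X in <<X>>%VS]/(val (in_tuple _)) => /coord_span ->.
rewrite mulmx_suml big1// => j _; rewrite -scalemxAl.
have : (in_tuple [seq G p | G <- bracket_family F k])`_j \in [seq G p | G <- bracket_family F k].
  exact: mem_nth.
by move=> /mapP[G Gk ->]; rewrite hA// scaler0.
Qed.

(** The end point of a short word is near [p] but need not be [p], so the condition is needed on a
    neighbourhood. The bracket values at [p] have a left inverse [B]; near [p] they change by at
    most [e], so a matrix [X] that kills them satisfies [X = B *m (A p - A y) *m X], whose norm is
    at most half that of [X]. *)
Lemma bracket_annihilator_open p : weak_bracket_condition F p ->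
  exists k, exists2 e, 0 < e & forall y m (A : 'M[R]_(n, m)), `|y - p| <= e ->
  (forall G, G \in bracket_family F k -> G y *m A = 0) -> A = 0.
Proof.
move=> /bracket_annihilator[k hk]; exists k.
pose L := bracket_family F k.
pose A y : 'M[R]_(size L, n) := \matrix_i nth (fun=> 0) L i y.
have Afull : row_full (A p).
  rewrite -cokermx_eq0; apply/eqP/hk => G GL.
  have iL : (index G L < size L)%N by rewrite index_mem.
  have -> : G p = row (Ordinal iL) (A p) by rewrite rowK/= nth_index.
  by rewrite -row_mul mulmx_coker row0.
pose B := pinvmx (A p).
have BA : B *m A p = 1%:M by exact: mulVpmx.
pose c : R := n%:R * (size L)%:R * `|B|.
have c0 : 0 <= c by rewrite !mulr_ge0.
have [e [e0 _ ce]] := @small_multiple R c 2^-1 c0 ltac:(by rewrite invr_gt0).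
have : nbhs p (fun y => forall i : 'I_(size L),
    `|nth (fun=> 0) L i p - nth (fun=> 0) L i y| < e).
  apply: (@filter_forall V 'I_(size L) (fun i y => `|nth (fun=> 0) L i p - nth (fun=> 0) L i y| < e) (nbhs p) _) => i.
  have sG : smooth (nth (fun=> 0) L i).
    by apply: (@smooth_bracket_family _ _ _ F k) => //; exact: mem_nth.
  exact: ((cvgrPdist_lt _ _).1 (sG 0%N p) e e0).
move=> /nbhs_ballP[r /= r0 hr].
exists (r / 2); first exact: divr_gt0.
move=> y m X yp hX.
have yr : ball p r y.
  rewrite -ball_normE/= distrC; apply: le_lt_trans yp _.
  by rewrite ltr_pdivrMr// ltr_pMr// ltr1n.
have AX : A y *m X = 0.
  apply/row_matrixP => i; rewrite row_mul rowK row0; apply: hX; exact: mem_nth.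
have dA : `|A p - A y| <= e.
  rewrite [leLHS]/Num.Def.normr/= mx_normrE; apply: bigmax_le => [|[i j] _]; first exact: ltW.
  rewrite !mxE/=; apply: le_trans (ltW (hr y yr i)).
  by have := coord_le_norm (nth (fun=> 0) L i p - nth (fun=> 0) L i y) j; rewrite !mxE.
have XE : X = B *m (A p - A y) *m X.
  by rewrite -mulmxA mulmxBl AX subr0 mulmxA BA mul1mx.
apply/eqP; rewrite -normr_le0.
have : `|X| <= 2^-1 * `|X|.
  rewrite [X in `|X| <= _]XE; apply: le_trans (norm_mulmx_le _ _) _.
  rewrite [leLHS]mulrAC ler_wpM2r//; apply: le_trans ce.
  apply: le_trans (ler_wpM2l (ler0n _ _) (norm_mulmx_le _ _)) _.
  rewrite [leLHS](_ : _ = (n%:R * (size L)%:R * `|B|) * `|A p - A y|); last by ring.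
  by rewrite mulrC ler_wpM2r.
have := normr_ge0 X; lra.
Qed.


Section maximal_rank.
Variables (p : V) (i0 : E) (e : R).
Hypothesis Mp : M p.

(** The strict bound on the total time leaves room for a further piece of flow. *)
Definition short_word (w : seq (E * R)) :=
  [/\ nonneg_times w, admissible i0 p w & total_time w < e].

Definition max_rank_word w := short_word w /\
  forall w', short_word w' -> (\rank (tangent w' p) <= \rank (tangent w p))%N.

Lemma max_rank_word_exists : 0 < e -> exists w, max_rank_word w.
Proof.
move=> e0; pose P r := `[< exists2 w, short_word w & \rank (tangent w p) = r >].
have P0 : exists r, P r.
  exists (\rank (tangent [::] p)); apply/asboolP; exists [::] => //.
  by split => //; rewrite /total_time big_nil.
have Pn r : P r -> (r <= n)%N by move=> /asboolP[w _ <-]; exact: rank_leq_col.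
case: (ex_maxnP P0 Pn) => r /asboolP[w sw <-] hr; exists w; split=> // w' sw'.
by apply: hr; apply/asboolP; exists w'.
Qed.

(** The appended Jacobian is invertible, so the rank cannot drop; by maximality it cannot rise. The
    tangent space is therefore merely transported, and it contains the new velocity. *)
Lemma max_rank_word_step w j t : max_rank_word w -> 0 <= t -> total_time w + t < e ->
  adm (wflow w p) (last_state i0 w) j ->
  max_rank_word (rcons w (j, t)) /\
  (tangent (rcons w (j, t)) p :=: tangent w p *m J j t (wflow w p))%MS.
Proof.
move=> [[w0 aw tw] maxw] t0 te adj.
have sw : short_word (rcons w (j, t)).
  split; [exact: nonneg_times_rcons|by rewrite admissible_rcons aw|].
  by rewrite total_time_rcons.
have Jfree : row_free (J j t (wflow w p)).
  have := flow_jacobianK (is_CkW (F_smooth j 3)) (F_le j) (Phi_flow j) (Phi_jacobian j) t (wflow w p).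
  by move=> h; apply/row_freeP; eexists; exact: h.
have rJ : \rank (tangent w p *m J j t (wflow w p)) = \rank (tangent w p).
  exact: mxrankMfree.
have sub : (tangent w p *m J j t (wflow w p) <= tangent (rcons w (j, t)) p)%MS.
  by rewrite (word_tangent_rcons _ _ _ _ (j, t)) addsmxSl.
have rk : \rank (tangent (rcons w (j, t)) p) = \rank (tangent w p).
  apply/eqP; rewrite eqn_leq maxw//= -rJ; exact: mxrankS.
split; first by split=> // w' sw'; rewrite rk; exact: maxw.
apply/eqmx_sym/eqmxP; rewrite -(mxrank_leqif_eq sub).
by rewrite rJ rk.
Qed.

(** Pieces of zero duration change the state along a path of admissible switches without moving the
    end point. Each of them adds the velocity of its state to the tangent space, which by maximality
    contained it already. *)
Lemma max_rank_word_switch w j : max_rank_word w -> exists w',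
  [/\ max_rank_word w', wflow w' p = wflow w p, last_state i0 w' = j,
      total_time w' = total_time w &
      (tangent w' p :=: tangent w p)%MS /\ (F j (wflow w p) <= tangent w p)%MS].
Proof.
move=> mw.
have My : M (wflow w p) by apply: word_flow_invariant => //; case: mw => [[]].
have J0 i z : J i 0 z = 1%:M.
  exact: (flow_jacobian0 (is_CkW (F_smooth i 3)) (F_le i) (Phi_flow i) (Phi_jacobian i)).
have step w1 i : max_rank_word w1 -> wflow w1 p = wflow w p -> total_time w1 = total_time w ->
    (tangent w1 p :=: tangent w p)%MS -> adm (wflow w p) (last_state i0 w1) i ->
    let w2 := rcons w1 (i, 0) in
    [/\ max_rank_word w2, wflow w2 p = wflow w p, last_state i0 w2 = i,
      total_time w2 = total_time w &
      (tangent w2 p :=: tangent w p)%MS /\ (F i (wflow w p) <= tangent w p)%MS].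
  move=> mw1 y1 t1 T1 a1 w2.
  have te : total_time w1 + 0 < e by rewrite addr0; case: mw1 => [[]].
  have a1' : adm (wflow w1 p) (last_state i0 w1) i by rewrite y1.
  have [m2 T2] := max_rank_word_step mw1 (lexx 0) te a1'.
  have y2 : wflow w2 p = wflow w p.
    by rewrite word_flow_rcons /= (Phi_flow i _).1.
  have T3 : (tangent w2 p :=: tangent w p)%MS.
    by apply: eqmx_trans T1; apply: eqmx_trans T2 _; rewrite J0 mulmx1.
  split=> //.
  - by rewrite last_state_rcons.
  - by rewrite total_time_rcons /= addr0.
  - split=> //; rewrite -T3 (word_tangent_rcons _ _ _ _ (i, 0)) -/w2 y2; exact: addsmxSr.
have switch s : path (adm (wflow w p)) (last_state i0 w) s -> exists w',
  [/\ max_rank_word w', wflow w' p = wflow w p, last_state i0 w' = last (last_state i0 w) s,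
      total_time w' = total_time w & (tangent w' p :=: tangent w p)%MS].
  elim/last_ind: s => [|s i IH]; first by exists w; split.
  rewrite rcons_path last_rcons => /andP[/IH[w1 [m1 y1 l1 t1 T1]] ai].
  by have := @step w1 i m1 y1 t1 T1; rewrite l1 => /(_ ai)[? ? ? ? []]; exists (rcons w1 (i, 0)).
have /connectP[s sp sl] := adm_connect (last_state i0 w) j My.
have [w1 [m1 y1 l1 t1 T1]] := switch s sp.
(* A last piece of zero duration in the state [j] itself, allowed by [adm_refl], yields the claim on
   [F j] even when the path is empty. *)
exists (rcons w1 (j, 0)); apply: step => //.
by rewrite l1 -sl; exact: adm_refl.
Qed.

(** For the bracket of [F i] and [H], append a flow along [F i] of duration [s]. By induction [H] is
    tangent at the new end point; pulled back by the inverse Jacobian, it lies in the original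
    tangent space for every small [s]. So does its derivative at 0, the bracket, since subspaces are
    closed. Membership is tested by multiplying with the cokernel [X]. *)
Lemma max_rank_word_brackets k G w : G \in bracket_family F k -> max_rank_word w ->
  (G (wflow w p) <= tangent w p)%MS.
Proof.
elim: k G w => [|k IH] G w /=.
  by move=> /mapP[i _ ->] mw; have [w' [_ _ _ _ []]] := max_rank_word_switch i mw.
rewrite mem_cat => /orP[/IH/[apply]//|/allpairsP[[i H] [/= _ Hk ->]]] mw.
have sH : smooth H by exact: smooth_bracket_family Hk.
have [w0 [m0 y0 l0 t0 [T0 _]]] := max_rank_word_switch i mw.
set y := wflow w p in y0 *.
have te : 0 < e - total_time w0 by rewrite subr_gt0; case: m0 => [[]].
have My : M y by apply: word_flow_invariant => //; case: mw => [[]].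
have pull s : 0 <= s -> s < e - total_time w0 ->
    (H (Phi i s y) *m J i (- s) (Phi i s y) <= tangent w p)%MS.
  move=> s0 se.
  have a0 : adm (wflow w0 p) (last_state i0 w0) i by rewrite y0 l0; exact: adm_refl.
  have t1 : total_time w0 + s < e by rewrite addrC -ltrBrDr.
  have [m1 T1] := max_rank_word_step m0 s0 t1 a0.
  have := IH H _ Hk m1; rewrite word_flow_rcons /= y0 T1 y0 => h.
  apply: submx_trans (submxMr _ h) _.
  rewrite -mulmxA (flow_jacobianK (is_CkW (F_smooth i 3)) (F_le i) (Phi_flow i) (Phi_jacobian i)).
  by rewrite mulmx1 T0.
rewrite submxE -normr_le0.
set X := cokermx _ in pull *.
set l := lie_bracket _ _ _.
have a0 : 0 <= n%:R * `|X| by rewrite mulr_ge0.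
apply: (@le_of_small_increments _ _ _ (n%:R * `|X|) 1 ltr01 a0) => b b0 _.
rewrite add0r.
have [s1 s10 hs] := flow_pullback_derivative (is_CkW (F_smooth i 3)) (F_le i) (Phi_flow i)
  (Phi_jacobian i) (is_CkW (sH 3)) y b0.
pose s := Num.min s1 ((e - total_time w0) / 2).
have s0 : 0 < s by rewrite lt_min s10 divr_gt0.
have ss1 : s <= s1 by rewrite ge_min lexx.
have se : s < e - total_time w0.
  apply: (@le_lt_trans _ _ ((e - total_time w0) / 2)); first by rewrite ge_min lexx orbT.
  by rewrite ltr_pdivrMr// ltr_pMr// ltr1n.
have := hs s s0 ss1.
have := pull s (ltW s0) se; rewrite submxE => /eqP P1.
have := IH H _ Hk mw; rewrite submxE -/y => /eqP P0.
move: P1 P0; rewrite -/X -/l; set u := _ *m J i _ _; set v := H y => P1 P0 h.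
rewrite -(ler_pM2l s0) -[X in X * `|_| <= _](gtr0_norm s0) -normrZ.
have -> : s *: (l *m X) = - ((u - v - s *: l) *m X).
  by rewrite (mulmxBl (u - v)) (mulmxBl u) P1 P0 subr0 sub0r opprK scalemxAl.
rewrite normrN; apply: le_trans (norm_mulmx_le _ _) _.
apply: le_trans (ler_wpM2l a0 h) _.
by rewrite [leRHS](_ : _ = n%:R * `|X| * (b * s))//; ring.
Qed.

End maximal_rank.

(* A word of maximal rank among the short ones: if its tangent space were proper,
   extending the word by a short piece of flow would raise the rank. *)
Theorem full_rank_word (p : V) (i0 : E) : M p -> weak_bracket_condition F p ->
  exists w, [/\ nonneg_times w, admissible i0 p w & row_full (tangent w p)].
Proof.
move=> Mp /bracket_annihilator_open[k [e e0 hk]].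
have K0 : 0 <= K by apply: le_trans (F_le i0 p).
have [d [d0 _ dK]] := small_multiple K0 e0.
have [w mw] := @max_rank_word_exists p i0 d d0.
exists w; have [[w0 aw tw] _] := mw; split=> //.
rewrite -cokermx_eq0; apply/eqP; apply: (hk (wflow w p)).
  apply: le_trans (word_flow_dist _ w0) _; apply: le_trans dK.
  by rewrite mulrC ler_wpM2r// ltW.
move=> G Gk; have := max_rank_word_brackets Mp Gk mw.
by rewrite submxE => /eqP.
Qed.

End full_rank_word.

(** * The end point of a word as a function of the durations *)

Section time_vectors.
Context {R : realType} {n : nat} {E : eqType}.
Notation V := 'rV[R]_n.
Variables (F : E -> V -> V) (Phi : E -> R -> V -> V) (J : E -> R -> V -> 'M[R]_n).
Variable K : R.
Hypothesis F_C2 : forall i, is_Ck 2 (F i).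
Hypothesis F_le : forall i x, `|F i x| <= K.
Hypothesis Phi_flow : forall i, is_flow (F i) (Phi i).
Hypothesis Phi_jacobian : forall i, flow_jacobian (Phi i) (J i).

Local Notation wjac := (word_jacobian Phi J).
Local Notation tangent := (word_tangent F Phi J).

(* [vector_flow w t] follows the states of [w] during the times listed in [t];
   the times recorded in [w] are ignored. *)
Fixpoint vector_flow (w : seq (E * R)) : 'rV[R]_(size w) -> V -> V :=
  match w return 'rV[R]_(size w) -> V -> V with
  | [::] => fun _ x => x
  | it :: w' => fun (t : 'rV[R]_(1 + size w')) x =>
      vector_flow (rsubmx t) (Phi it.1 (t ord0 ord0) x)
  end.

Fixpoint word_times (w : seq (E * R)) : 'rV[R]_(size w) :=
  match w return 'rV[R]_(size w) with
  | [::] => 0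
  | it :: w' => row_mx (it.2)%:M (word_times w') : 'rV[R]_(1 + size w')
  end.

Lemma row_mx_ord0 m (a : R) (t : 'rV[R]_m) : (row_mx a%:M t : 'rV[R]_(1 + m)) ord0 ord0 = a.
Proof.
rewrite (_ : ord0 = lshift m (ord0 : 'I_1)); last exact: val_inj.
by rewrite row_mxEl mxE eqxx mulr1n.
Qed.

Lemma row_mx_split m (t : 'rV[R]_(1 + m)) : t = row_mx (t ord0 ord0)%:M (rsubmx t).
Proof.
rewrite -[LHS]hsubmxK; congr row_mx; apply/rowP => k; rewrite ord1 !mxE eqxx mulr1n.
by congr (t _ _); exact: val_inj.
Qed.

Lemma norm_rsubmx m (t : 'rV[R]_(1 + m)) : `|rsubmx t| <= `|t|.
Proof. by apply: norm_le_coord => // k; rewrite mxE coord_le_norm. Qed.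

(** Strict differentiability composes along the word. The single matrix [tangent w x0] then serves
    all durations and all starting points close to the base ones. *)
Lemma vector_flow_strict w x0 (e : R) : 0 < e -> exists2 d, 0 < d &
  forall (t s : 'rV[R]_(size w)) x y,
  `|t - word_times w| <= d -> `|s - word_times w| <= d ->
  `|x - x0| <= d -> `|y - x0| <= d ->
  `|vector_flow t x - vector_flow s y -
    ((t - s) *m tangent w x0 + (x - y) *m wjac w x0)| <= e * (`|t - s| + `|x - y|).
Proof.
elim: w x0 e => [|it w IH] x0 e e0.
  exists 1 => // t s x y _ _ _ _ /=.
  by rewrite mulmx0 add0r mulmx1 subrr normr0 mulr_ge0 ?addr_ge0// ltW.
set x1 := Phi it.1 it.2 x0.
(* [1 + a] is a local Lipschitz constant of the first piece (see [lip]). The factor of [e1] in [h1]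
   adds the error of the remaining word to the error of the first piece, amplified by
   [wjac w x1]. *)
pose a : R := `|F it.1 x1| + n%:R * `|J it.1 it.2 x0|.
have a0 : 0 <= a by rewrite addr_ge0// mulr_ge0.
have [e1 [e10 e11 h1]] := @small_multiple R (2 + a + n%:R * `|wjac w x1|) e
  (addr_ge0 (addr_ge0 (ler0n _ _) a0) (mulr_ge0 (ler0n _ _) (normr_ge0 _))) e0.
have [d1 d10 H1] := IH x1 e1 e10.
have [d2 d20 H2] := flow_strict (F_C2 it.1) (F_le it.1) (Phi_flow it.1) (Phi_jacobian it.1)
  it.2 x0 e10.
have [d3 [d30 d31 d3h]] := @small_multiple R ((1 + a) * 2) d1
  (mulr_ge0 (addr_ge0 ler01 a0) (ler0n _ _)) d10.
exists (Num.min d1 (Num.min d2 d3)); first by rewrite !lt_min d10 d20 d30.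
move=> t s x y; rewrite !le_min => /and3P[t1 t2 t3] /and3P[s1 s2 s3] /and3P[x_1 x2 x3] /and3P[y1 y2 y3].
pose t' : 'rV[R]_(1 + size w) := t; pose s' : 'rV[R]_(1 + size w) := s.
pose tau := t' ord0 ord0; pose sig := s' ord0 ord0.
have coord0 (v : 'rV[R]_(1 + size w)) : `|v ord0 ord0 - it.2| <= `|v - word_times (it :: w)|.
  apply: le_trans (coord_le_norm _ ord0).
  by rewrite [in leRHS]mxE [X in _ <= `|_ + X|]mxE row_mx_ord0.
have coordr (v : 'rV[R]_(1 + size w)) : `|rsubmx v - word_times w| <= `|v - word_times (it :: w)|.
  rewrite -{1}(row_mxKr (it.2)%:M (word_times w)) -linearB; exact: norm_rsubmx.
set X := Phi it.1 tau x; set Y := Phi it.1 sig y.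
set J1 := J it.1 it.2 x0 in a a0 h1 d3h *.
set Fx := F it.1 x1 in a a0 h1 d3h *.
have lip (p q : R) (x' y' : V) : `|p - it.2| <= d2 -> `|q - it.2| <= d2 ->
    `|x' - x0| <= d2 -> `|y' - x0| <= d2 ->
    `|Phi it.1 p x' - Phi it.1 q y'| <= (1 + a) * (`|p - q| + `|x' - y'|).
  move=> ht hs hx hy; have := H2 p q x' y' ht hs hx hy.
  rewrite -/x1 -/Fx -/J1 => h.
  rewrite -(subrK ((p - q) *: Fx + (x' - y') *m J1) (_ - Phi _ _ _)).
  apply: le_trans (ler_normD _ _) _; rewrite mulrDl; apply: lerD.
    by apply: le_trans h _; rewrite ler_wpM2r// addr_ge0.
  apply: le_trans (ler_normD _ _) _; rewrite normrZ.
  apply: le_trans (lerD (lexx _) (norm_mulmx_le _ _)) _; rewrite /a.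
  have p1 := mulr_ge0 (normr_ge0 Fx) (normr_ge0 (x' - y')).
  have p2 := mulr_ge0 (mulr_ge0 (ler0n R n) (normr_ge0 J1)) (normr_ge0 (p - q)).
  lra.
have base (p : R) x' : `|p - it.2| <= d2 -> `|p - it.2| <= d3 -> `|x' - x0| <= d2 ->
    `|x' - x0| <= d3 -> `|Phi it.1 p x' - x1| <= d1.
  move=> ht ht3 hx hx3.
  have z1 : `|it.2 - it.2| <= d2 by rewrite subrr normr0 ltW.
  have z2 : `|x0 - x0| <= d2 by rewrite subrr normr0 ltW.
  apply: le_trans (lip p it.2 x' x0 ht z1 hx z2) _; apply: le_trans d3h.
  rewrite (_ : d3 * _ = (1 + a) * (d3 + d3)); last by ring.
  by apply: ler_wpM2l; [rewrite addr_ge0|exact: lerD].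
have X1 : `|X - x1| <= d1.
  by apply: base => //; [exact: le_trans (coord0 t) t2|exact: le_trans (coord0 t) t3].
have Y1 : `|Y - x1| <= d1.
  by apply: base => //; [exact: le_trans (coord0 s) s2|exact: le_trans (coord0 s) s3].
have A1 := H1 (rsubmx t') (rsubmx s') X Y (le_trans (coordr _) t1) (le_trans (coordr _) s1) X1 Y1.
have A2 := H2 tau sig x y (le_trans (coord0 _) t2) (le_trans (coord0 _) s2) x2 y2.
rewrite -/x1 -/X -/Y -/Fx -/J1 in A1 A2.
have A3 := lip tau sig x y (le_trans (coord0 _) t2) (le_trans (coord0 _) s2) x2 y2.
rewrite -/X -/Y in A3.
have ts0 : `|tau - sig| <= `|t - s|.
  by have := coord_le_norm (t' - s') ord0; rewrite !mxE.
have tsr : `|rsubmx t' - rsubmx s'| <= `|t - s| by rewrite -linearB; exact: (norm_rsubmx (t' - s')).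
have dec : (t - s) *m tangent (it :: w) x0 =
    (tau - sig) *: (Fx *m wjac w x1) + (rsubmx t' - rsubmx s') *m tangent w x1.
  have := mul_row_col ((t' - s') ord0 ord0)%:M (rsubmx (t' - s')) (Fx *m wjac w x1) (tangent w x1).
  by rewrite -row_mx_split mul_scalar_mx linearB => ->; rewrite !mxE.
have jac : (x - y) *m wjac (it :: w) x0 = (x - y) *m J1 *m wjac w x1 by rewrite /= mulmxA.
rewrite dec jac.
have -> : vector_flow (t : 'rV_(size (it :: w))) x - vector_flow (s : 'rV_(size (it :: w))) y -
  ((tau - sig) *: (Fx *m wjac w x1) + (rsubmx t' - rsubmx s') *m tangent w x1 + (x - y) *m J1 *m wjac w x1) =
  (vector_flow (rsubmx t') X - vector_flow (rsubmx s') Y -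
    ((rsubmx t' - rsubmx s') *m tangent w x1 + (X - Y) *m wjac w x1)) +
  (X - Y - ((tau - sig) *: Fx + (x - y) *m J1)) *m wjac w x1.
  rewrite (mulmxBl (X - Y)) (mulmxDl ((tau - sig) *: Fx)) -scalemxAl /= -/tau -/sig -/X -/Y.
  move: (vector_flow _ X) (vector_flow _ Y) ((X - Y) *m _) (Fx *m _) (_ *m J1 *m _) (_ *m tangent w x1).
  by move=> u1 u2 u3 u4 u5 u6; apply/rowP => k; rewrite !mxE; ring.
apply: le_trans (ler_normD _ _) _.
apply: le_trans (lerD A1 (le_trans (norm_mulmx_le _ _) (ler_wpM2l (mulr_ge0 (ler0n _ _) (normr_ge0 _)) A2))) _.
set N := `|t - s| in ts0 tsr *; set D := `|x - y| in A2 A3 *.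
have N0 : 0 <= N by exact: normr_ge0.
have D0 : 0 <= D by exact: normr_ge0.
apply: (@le_trans _ _ (e1 * (N + (1 + a) * (N + D)) + n%:R * `|wjac w x1| * (e1 * (N + D)))).
  apply: lerD.
    apply: (ler_wpM2l (ltW e10)); apply: (lerD tsr); apply: le_trans A3 _.
    by rewrite ler_wpM2l ?addr_ge0// lerD2r.
  by rewrite ler_wpM2l ?mulr_ge0// ler_wpM2l ?(ltW e10)// lerD2r.
apply: (@le_trans _ _ ((e1 * (2 + a + n%:R * `|wjac w x1|)) * (N + D))); last first.
  by rewrite ler_wpM2r// addr_ge0.
have := mulr_ge0 (ltW e10) D0; lra.
Qed.

End time_vectors.

(** * Lebesgue measure on R^d *)

(** A solution of [g y = z] is a fixed point of [y - (g y - z)], which maps the closed ball of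
    radius [r] into itself and contracts by 1/2. *)
Lemma near_identity_surjective {R : realType} {n : nat} (g : 'rV[R]_n -> 'rV[R]_n) (r : R) :
  0 <= r ->
  (forall y y', `|y| <= r -> `|y'| <= r -> `|g y - g y' - (y - y')| <= 2^-1 * `|y - y'|) ->
  forall z, `|z - g 0| <= r / 2 -> exists2 y, `|y| <= r & g y = z.
Proof.
move=> r0 hg z hz.
pose U : set 'rV[R]_n := [set y | `|y| <= r].
pose h (y : 'rV[R]_n) := y - (g y - z).
have hU : set_fun U U h.
  move=> y /= yr; rewrite /U /= /h.
  have -> : y - (g y - z) = - (g y - g 0 - (y - 0)) + (z - g 0).
    by apply/rowP => i; rewrite !mxE; ring.
  apply: le_trans (ler_normD _ _) _; rewrite normrN.
  have := hg y 0 yr; rewrite normr0 subr0 => /(_ r0) h1.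
  have h2 : 2^-1 * `|y| <= 2^-1 * r by rewrite ler_wpM2l// invr_ge0.
  by rewrite (_ : r = 2^-1 * r + r / 2) ?lerD ?(le_trans h1)//; field.
pose H : {fun U >-> U} := HB.pack h (isFun.Build _ _ _ _ h hU).
have cH : is_contraction H.
  exists (@NngNum _ (2^-1 : R) ltac:(by rewrite invr_ge0)); split=> /=.
    by rewrite invf_lt1// ltr1n.
  move=> [y y'] [/= yr y'r]; rewrite /h.
  have -> : y - (g y - z) - (y' - (g y' - z)) = - (g y - g y' - (y - y')).
    by apply/rowP => i; rewrite !mxE; ring.
  by rewrite normrN hg.
have Ucl : closed U by apply: compact_closed; [exact: norm_hausdorff|exact: closed_ball0_compact].
have U0 : U !=set0 by exists 0; rewrite /U/= normr0.
pose X := HB.pack_for (completeNormedModType R) 'rV[R]_n.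
have [y yr /= ye] := @banach_fixed_point R X U H cH Ucl U0.
exists y => //; apply/eqP; rewrite -subr_eq0.
have {}ye : y = y - (g y - z) by exact: ye.
by move/eqP: ye; rewrite -subr_eq0 opprB addrCA subrr addr0.
Qed.

Section lebesgue_outer_measure.
Context {R : realType} {n : nat}.
Notation V := 'rV[R]_n.+1.
Notation leb := (@lebesgue_rV R n.+1).
Local Open Scope ereal_scope.

Lemma box_volume_ge0 (a b : V) : (forall k, a ord0 k <= b ord0 k)%R -> (0 <= box_volume a b)%R.
Proof. by move=> ab; apply: prodr_ge0 => k _; rewrite subr_ge0. Qed.

Lemma lebesgue_rV_cover (A : set V) (a b : nat -> V) :
  (forall m k, a m ord0 k <= b m ord0 k)%R -> A `<=` \bigcup_m box (a m) (b m) ->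
  leb A <= \sum_(0 <= m <oo) (box_volume (a m) (b m))%:E.
Proof. by move=> ab Aab; apply: ereal_inf_lbound; exists a, b. Qed.

Lemma lebesgue_rV_ge0 (A : set V) : 0 <= leb A.
Proof.
apply: le_ereal_inf_tmp => _ [a [b [ab _ ->]]].
by apply: nneseries_ge0 => m _ _; rewrite lee_fin box_volume_ge0.
Qed.

Lemma lebesgue_rV_le (A B : set V) : A `<=` B -> leb A <= leb B.
Proof.
move=> AB; apply: ereal_inf_le_tmp => _ [a [b [ab Bab ->]]].
by exists a, b; split=> //; exact: subset_trans Bab.
Qed.

Lemma box_volume_diag (a : V) : box_volume a a = 0%R.
Proof. by rewrite /box_volume (bigD1 ord0)//= subrr mul0r. Qed.

Lemma lebesgue_rV_box (a b : V) : (forall k, a ord0 k <= b ord0 k)%R ->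
  leb (box a b) <= (box_volume a b)%:E.
Proof.
move=> ab.
(* A cover by a single box, continued with degenerate boxes of volume 0. *)
pose b' (m : nat) := if m == 0%N then b else a.
have b'0 m : (0 <= box_volume a (b' m))%R.
  by rewrite box_volume_ge0// => k; rewrite /b'; case: ifP.
have := @lebesgue_rV_cover (box a b) (fun=> a) b' _ _.
rewrite (nneseries_split _ 1)//; last by move=> m _; rewrite lee_fin.
rewrite big_nat1 eseries0 ?adde0; last first.
  by move=> [//|m] _ _; rewrite box_volume_diag.
apply; first by move=> m k; rewrite /b'; case: ifP.
by move=> x xab; exists 0%N.
Qed.

Lemma lebesgue_rV0 : leb set0 = 0.
Proof.
apply/eqP; rewrite eq_le lebesgue_rV_ge0 andbT.
apply: le_trans (lebesgue_rV_le (sub0set (box 0 0))) _.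
by apply: le_trans (@lebesgue_rV_box 0 0 _) _ => //; rewrite box_volume_diag.
Qed.

(** Each [A m] is covered up to an error [e / 2 ^ m.+1], and the double sequence of boxes is listed
    as one sequence through a bijection of [nat] with pairs. *)
Lemma lebesgue_rV_sigma_subadditive : sigma_subadditive leb.
Proof.
move=> A; have [[i ioo]|] := pselect (exists i, leb (A i) = +oo).
  rewrite (eseries_pinfty _ _ ioo) ?leey// => m _.
  by rewrite -ltNye (lt_le_trans _ (lebesgue_rV_ge0 _)).
rewrite -forallNE => Aoo.
suff add2e (e : {posnum R}) :
    leb (\bigcup_n A n) <= \sum_(i <oo) leb (A i) + e%:num%:E.
  by apply/lee_addgt0Pr => _/posnumP[].
rewrite (le_trans _ (epsilon_trick _ _ _))//; last first.
  by move=> m; exact: lebesgue_rV_ge0.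
pose P m (B : nat -> V * V) := [/\ forall j k, ((B j).1 ord0 k <= (B j).2 ord0 k)%R,
  A m `<=` \bigcup_j box (B j).1 (B j).2 &
  \sum_(k <oo) (box_volume (B k).1 (B k).2)%:E <= leb (A m) + (e%:num / (2 ^ m.+1)%:R)%:E].
have [G PG] : {G : nat -> nat -> V * V & forall m, P m (G m)}.
  apply: (@choice _ _ P) => m.
  have fin : leb (A m) \is a fin_num.
    by rewrite ge0_fin_numE ?lebesgue_rV_ge0// ltey; apply/eqP; exact: Aoo.
  have en1 : (0 < e%:num / (2 ^ m.+1)%:R)%R by [].
  have [_ [a [b [ab Aab ->]]] hlt] := lb_ereal_inf_adherent en1 fin.
  by exists (fun j => (a j, b j)); split=> //=; exact: ltW.
have /card_esym/ppcard_eqP[f] := card_nat2.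
pose v (ij : nat * nat) : \bar R := (box_volume (G ij.1 ij.2).1 (G ij.1 ij.2).2)%:E.
have v_ge0 ij : 0 <= v ij.
  by rewrite lee_fin box_volume_ge0// => k; case: (PG ij.1).
apply: (@le_trans _ _ (\esum_(i in setT) v i)).
  apply: le_trans (@lebesgue_rV_cover _ (fun m => (G (f m).1 (f m).2).1)
     (fun m => (G (f m).1 (f m).2).2) _ _) _.
  - by move=> m k; case: (PG (f m).1).
  - move=> t [i _ Ait]; have [_ Ai _] := PG i; have [j _ tj] := Ai _ Ait.
    by exists (f^-1%FUN (i, j)) => //=; rewrite invK ?inE.
  rewrite -[X in X <= _]/(\sum_(0 <= m <oo | xpredT m) (v \o f) m).
  rewrite -(esum_pred_image v _ xpredT) ?[fun=> _]set_true//.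
  by rewrite image_eq.
rewrite (_ : esum _ _ = \sum_(i <oo) \sum_(j <oo) v (i, j)); last first.
  pose J : nat -> set (nat * nat) := fun i => [set (i, j) | j in setT].
  rewrite (_ : setT = \bigcup_k J k); last first.
    by rewrite predeqE => -[a b]; split => // _; exists a => //; exists b.
  rewrite esum_bigcupT //=; last first.
    apply/trivIsetP => i j _ _ ij.
    rewrite predeqE => -[m k] /=; split => //= -[] [_] _ [<-{m} _].
    by move=> [m' _] [] /esym/eqP; rewrite (negbTE ij).
  rewrite -(image_id [set: nat]) -fun_true esum_pred_image//; last first.
    by move=> m _; exact: esum_ge0.
  apply: eq_eseriesr => /= j _.
  rewrite -(esum_pred_image v (pair j) predT)//=; last first.
    by move=> ? ? _ _; exact: (@can_inj _ _ _ snd).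
  by congr esum; rewrite predeqE => -[a b]; split; move=> [i _ <-]; exists i.
apply: lee_nneseries => [m _ _|m _]; first exact: nneseries_ge0.
by case: (PG m).
Qed.

HB.instance Definition _ := isOuterMeasure.Build R V leb lebesgue_rV0
  lebesgue_rV_ge0 lebesgue_rV_le lebesgue_rV_sigma_subadditive.

End lebesgue_outer_measure.

(** * Borel sets of R^n and rational cubes *)

Section borel_rV.
Context {R : realType} {n : nat}.
Notation V := 'rV[R]_n.

Lemma measurable_open_rV (O : set V) : open O -> measurable O.
Proof. by move=> oO; apply: sub_gen_smallest. Qed.

Lemma bigcap_fin_measurable d (T : measurableType d) (I : finType) (A : I -> set T) :
  (forall i, measurable (A i)) -> measurable (\bigcap_(i in [set: I]) A i).
Proof.
move=> mA; rewrite -[X in measurable X]setCK setC_bigcap; apply: measurableC.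
by apply: fin_bigcup_measurable => [|i _]; [exact: finite_finset|exact: measurableC].
Qed.

Definition rat_cube (q : 'rV[rat]_n) (m : nat) : set V :=
  [set y | forall k, `|y ord0 k - ratr (q ord0 k)| <= m.+1%:R^-1].

(** The Borel sets are generated by all open sets, while coordinates only give access to cubes; a
    countable family of cubes bridges the two. *)
Lemma open_rat_cubes (O : set V) : open O ->
  O = \bigcup_(p in [set p : 'rV[rat]_n * nat | rat_cube p.1 p.2 `<=` O]) rat_cube p.1 p.2.
Proof.
move=> oO; apply/seteqP; split => [x Ox|x [p /= pO px]]; last exact: pO.
have /nbhs_ballP[e /= e0 eO] : nbhs x O by exact: open_nbhs_nbhs.
have [m me] : exists m : nat, 2 * m.+1%:R^-1 < e.
  have e20 : 0 < e / 2 by exact: divr_gt0.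
  have /cvgrPdist_lt/(_ _ e20) := @cvg_harmonic R.
  move=> [m _ /(_ m (leqnn m))] /=; rewrite sub0r normrN ger0_norm// => h.
  by exists m; rewrite mulrC -ltr_pdivlMr.
have m0 : 0 < (m.+1%:R^-1 : R) by rewrite invr_gt0.
have /choice[q hq] : forall k : 'I_n, exists q : rat, `|x ord0 k - ratr q| <= m.+1%:R^-1.
  move=> k.
  move: (m.+1%:R^-1) m0 => h h0.
  have [|q] := @rat_in_itvoo R (x ord0 k - h) (x ord0 k + h); first by lra.
  rewrite in_itv/= => /andP[q1 q2]; exists q; rewrite ler_norml.
  by apply/andP; split; lra.
exists (\row_k q k, m) => [y /= hy|k /=]; last by rewrite mxE.
apply: eO; rewrite -ball_normE/=; apply: le_lt_trans me.
apply: norm_le_coord => [|k]; first by rewrite mulr_ge0// ltW.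
have := hy k; have := hq k; rewrite !mxE mulr_natl mulr2n => h1 h2.
rewrite (_ : x ord0 k - y ord0 k = (x ord0 k - ratr (q k)) - (y ord0 k - ratr (q k))); last by ring.
by apply: le_trans (ler_normB _ _) _; exact: lerD.
Qed.

Lemma measurable_coord k : measurable_fun setT (fun x : V => x ord0 k).
Proof.
apply: (measurability _ (RGenInftyO.measurableE R)) => _ [_ [a ->] <-].
rewrite setTI; apply: measurable_open_rV.
apply: open_comp; last exact: interval_open.
by move=> x _; exact: coord_continuous.
Qed.

Lemma measurable_fun_coords d (T : measurableType d) (f : T -> V) :
  (forall k, measurable_fun setT (fun x => f x ord0 k)) -> measurable_fun setT f.
Proof.
move=> mf; apply: (@measurability _ _ _ _ setT f (@open V)); first by [].
move=> _ [A oA <-].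
rewrite setTI (open_rat_cubes oA) preimage_bigcup bigcup_mkcond.
apply: countable_bigcupT_measurable => // -[q m]; case: ifPn => // _.
rewrite (_ : _ @^-1` _ = \bigcap_(k in [set: 'I_n])
    ((fun x => f x ord0 k) @^-1` [set t : R | `|t - ratr (q ord0 k)| <= m.+1%:R^-1])).
  apply: bigcap_fin_measurable.
  move=> k; rewrite -[X in measurable X]setTI; apply: mf => //.
  rewrite (_ : mkset _ = `[ratr (q ord0 k) - m.+1%:R^-1, ratr (q ord0 k) + m.+1%:R^-1]%classic)//.
  by apply/seteqP; split => t /=; rewrite in_itv/= ler_distl.
by apply/seteqP; split => x /= h k; [move=> _; exact: h|exact: (h k I)].
Qed.

End borel_rV.

Section lebesgue_borel.
Context {R : realType} {n : nat}.
Notation V := 'rV[R]_n.+1.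
Notation leb := (@lebesgue_rV R n.+1).
Local Open Scope ereal_scope.

(* Both orientations of a closed or open half space are covered. *)
Lemma caratheodory_halfspace (H : set V) (k : 'I_n.+1) (c : R) :
  (forall x, H x -> x ord0 k <= c)%R -> (forall x, ~ H x -> c <= x ord0 k)%R ->
  caratheodory_measurable leb H.
Proof.
move=> Hc HC; apply: le_caratheodory_measurable => X.
apply: le_ereal_inf_tmp => _ [a [b [ab Xab ->]]].
pose mid m : R := Num.max (a m ord0 k) (Num.min (b m ord0 k) c).
have am m : (a m ord0 k <= mid m)%R by rewrite le_max lexx.
have mb m : (mid m <= b m ord0 k)%R by rewrite ge_max ab ge_min lexx.
pose b1 m : V := \row_j if j == k then mid m else b m ord0 j.
pose a2 m : V := \row_j if j == k then mid m else a m ord0 j.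
have v1 m : (box_volume (a m) (b m) = box_volume (a m) (b1 m) + box_volume (a2 m) (b m))%R.
  rewrite /box_volume [LHS](bigD1 k)//= [X in _ = (X + _)%R](bigD1 k)//= [X in _ = (_ + X)%R](bigD1 k)//=.
  rewrite !mxE eqxx.
  have -> : (\prod_(i < n.+1 | i != k) (b1 m ord0 i - a m ord0 i) =
             \prod_(i < n.+1 | i != k) (b m ord0 i - a m ord0 i))%R.
    by apply: eq_bigr => i /negPf ik; rewrite mxE ik.
  have -> : (\prod_(i < n.+1 | i != k) (b m ord0 i - a2 m ord0 i) =
             \prod_(i < n.+1 | i != k) (b m ord0 i - a m ord0 i))%R.
    by apply: eq_bigr => i /negPf ik; rewrite mxE ik.
  by rewrite -mulrDl; congr (_ * _)%R; ring.
have ab1 m j : (a m ord0 j <= b1 m ord0 j)%R.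
  by rewrite mxE; case: eqP => [->|_]; [exact: am|exact: ab].
have a2b m j : (a2 m ord0 j <= b m ord0 j)%R.
  by rewrite mxE; case: eqP => [->|_]; [exact: mb|exact: ab].
under eq_eseriesr do rewrite v1 EFinD.
rewrite nneseriesD; last 2 first.
- by move=> m _; rewrite lee_fin box_volume_ge0.
- by move=> m _; rewrite lee_fin box_volume_ge0.
apply: leeD.
  apply: lebesgue_rV_cover => // x [/Xab[m _ xm] Hx]; exists m => // j.
  have /andP[x1 x2] := xm j; rewrite x1 mxE; case: eqP => [jk|//].
  by rewrite le_max le_min; subst j; rewrite x2 (Hc _ Hx) orbT.
apply: lebesgue_rV_cover => // x [/Xab[m _ xm] Hx]; exists m => // j.
have /andP[x1 x2] := xm j; rewrite x2 mxE; case: eqP => [jk|_]; last by rewrite x1.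
by rewrite ge_max ge_min; subst j; rewrite x1 (HC _ Hx) orbT.
Qed.

(** An open set is a countable union of rational cubes, a cube is a finite intersection of half
    spaces, and the Caratheodory sets form a sigma-algebra. *)
Lemma caratheodory_borel (B : set V) : measurable B -> caratheodory_measurable leb B.
Proof.
have cara_sigma : sigma_algebra setT (caratheodory_measurable leb).
  split; first exact: caratheodory_measurable_set0.
    by move=> A; rewrite setTD; exact: caratheodory_measurable_setC.
  by move=> A mA; exact: caratheodory_measurable_bigcup.
have caraI (A : 'I_n.+1 -> set V) : (forall k, caratheodory_measurable leb (A k)) ->
    caratheodory_measurable leb (\bigcap_(k in setT) A k).
  move=> cA; have -> : \bigcap_(k in setT) A k = \big[setI/setT]_(k < n.+1) A k.
    apply/seteqP; split => x.
      by move=> Ax; elim/big_rec : _ => // k S _ Sx; split; [exact: Ax|].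
    move=> h k _; have : x \in \big[setI/setT]_(k < n.+1) A k by rewrite inE.
    by rewrite (bigD1 k)//= inE => -[].
  elim/big_rec : _ => [|k S _ cS].
    by rewrite -setC0; apply: caratheodory_measurable_setC; exact: caratheodory_measurable_set0.
  exact: caratheodory_measurable_setI.
apply: smallest_sub => // O oO; rewrite (open_rat_cubes oO) bigcup_mkcond.
have cube q m : caratheodory_measurable leb (@rat_cube R n.+1 q m).
  have -> : @rat_cube R n.+1 q m = \bigcap_(k in setT)
     ([set x : V | x ord0 k <= ratr (q ord0 k) + m.+1%:R^-1]%R `&`
      ~` [set x : V | x ord0 k < ratr (q ord0 k) - m.+1%:R^-1]%R).
    apply/seteqP; split => x /=.
      move=> h k _; have := h k; rewrite ler_distl => /andP[h1 h2]; split => //=.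
      by apply/negP; rewrite -leNgt.
    by move=> h k; have [/= h1 /negP] := h k I; rewrite -leNgt ler_distl h1 => ->.
  apply: caraI => k; apply: caratheodory_measurable_setI.
    apply: (@caratheodory_halfspace _ k (ratr (q ord0 k) + m.+1%:R^-1)%R) => x //=.
    by move=> /negP; rewrite -ltNge => /ltW.
  apply: caratheodory_measurable_setC.
  apply: (@caratheodory_halfspace _ k (ratr (q ord0 k) - m.+1%:R^-1)%R) => x /=.
    exact: ltW.
  by move=> /negP; rewrite -leNgt.
have /card_esym/ppcard_eqP[f] := card_nat2.
pose g (i : nat) : option ('rV[rat]_n.+1 * nat) := unpickle i.
rewrite (_ : \bigcup_i _ = \bigcup_i (if g i is Some p then
   (if p \in [set p : 'rV[rat]_n.+1 * nat | rat_cube p.1 p.2 `<=` O] then @rat_cube R n.+1 p.1 p.2 else set0) else set0)).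
  apply: caratheodory_measurable_bigcup => i; case: (g i) => [p|].
    by case: ifP => _; [exact: cube|exact: caratheodory_measurable_set0].
  exact: caratheodory_measurable_set0.
apply/seteqP; split => x [p _ px].
  by exists (pickle p) => //; rewrite /g pickleK.
by move: px; case: (g p) => [q qx|//]; exists q.
Qed.

Lemma lebesgue_rV_shift (S T : set V) (v : V) :
  (forall x, S x -> T (x + v)%R) -> leb S <= leb T.
Proof.
move=> ST; apply: le_ereal_inf_tmp => _ [a [b [ab Tab ->]]].
have -> : \sum_(0 <= m <oo) (box_volume (a m) (b m))%:E =
    \sum_(0 <= m <oo) (box_volume (a m - v) (b m - v))%:E.
  apply: eq_eseriesr => m _; congr (_%:E); apply: eq_bigr => k _.
  by rewrite !mxE; ring.
apply: lebesgue_rV_cover => [m k|x /ST/Tab[m _ xm]].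
  by rewrite !mxE lerD2r.
exists m => // k; have := xm k; rewrite !mxE => /andP[h1 h2].
by rewrite lerBlDr h1 lerBrDr h2.
Qed.

Lemma lebesgue_rV_finite_cover (I : eqType) (s : seq I) (A : set V) (F : I -> set V) :
  A `<=` [set x | exists2 i, i \in s & F i x] -> leb A <= \sum_(i <- s) leb (F i).
Proof.
elim: s A => [|i s IH] A AF.
  by rewrite big_nil (_ : A = set0) ?lebesgue_rV0// -subset0 => x /AF[].
rewrite big_cons; apply: le_trans (leeD2l _ (IH (A `\` F i) _)).
  apply: le_trans (outer_measureU2 _ _ _); apply: lebesgue_rV_le => x Ax.
  by have [Fx|nFx] := pselect (F i x); [left|right; split].
move=> x [Ax nFx]; have [j] := AF _ Ax.
by rewrite inE => /orP[/eqP -> //|js Fj]; exists j.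
Qed.

(** Rounding each side up to a multiple of [s] adds at most [s], and the product of the [s + c k] is
    a polynomial in [s], hence continuous at 0. *)
Lemma cube_grid (c : 'I_n.+1 -> R) (e : R) : (forall k, 0 <= c k)%R -> (0 < e)%R ->
  exists s (N : 'I_n.+1 -> nat), [/\ (0 < s)%R, (forall k, c k < (N k)%:R * s)%R &
    ((\prod_k (N k)%:R) * s ^+ n.+1 <= \prod_k c k + e)%R].
Proof.
move=> c0 e0.
pose p : {poly R} := (\prod_k ('X + (c k)%:P))%R.
have /cvgrPdist_lt/(_ e e0) := @continuous_horner R p 0%R.
move=> /nbhs_ballP[r /= r0 hr].
pose s := (r / 2)%R.
have s0 : (0 < s)%R by exact: divr_gt0.
have sr : ball (0 : R)%R r s.
  by rewrite -ball_normE/= sub0r normrN gtr0_norm// ltr_pdivrMr// ltr_pMr// ltr1n.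
have pE t : (p.[t] = \prod_k (t + c k))%R.
  by rewrite horner_prod; apply: eq_bigr => k _; rewrite hornerD hornerX hornerC.
exists s, (fun k => (Num.truncn (c k / s)).+1); split => // [k|].
  rewrite -ltr_pdivrMr//.
  by have /andP[] := truncn_itv (divr_ge0 (c0 k) (ltW s0)).
have := hr _ sr; rewrite /= !pE distrC => /ltW/(le_trans (ler_norm _)).
rewrite lerBlDl => /le_trans; move=> h.
have -> : (\prod_k c k = \prod_k (0 + c k))%R by apply: eq_bigr => k _; rewrite add0r.
apply: (@le_trans _ _ (\prod_k (s + c k))%R); last first.
  by have := hr _ sr; rewrite /= !pE distrC => /ltW/(le_trans (ler_norm _)); rewrite lerBlDl.
rewrite -[in X in (_ * _ ^+ X)%R](card_ord n.+1) -prodr_const -big_split/=.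
apply: ler_prod => k _; rewrite mulr_ge0 ?(ltW s0)//=.
rewrite -natr1 mulrDl mul1r addrC lerD2l -ler_pdivlMr//.
by have /andP[] := truncn_itv (divr_ge0 (c0 k) (ltW s0)).
Qed.

(** A grid of cubes of side [s] covers the box, and each piece is mapped into a cube of side
    [2 * L * s] around the image of one of its points in [S]. The centre of a piece may lie outside
    [S], whence the factor 2. *)
Lemma lebesgue_rV_lipschitz_box (g : V -> V) (a b : V) (S : set V) (L e : R) :
  (0 <= L)%R -> (0 < e)%R -> (forall k, a ord0 k <= b ord0 k)%R ->
  (forall x y, S x -> S y -> `|g x - g y| <= L * `|x - y|)%R ->
  leb (g @` (S `&` box a b)) <= ((2 * L) ^+ n.+1 * (box_volume a b + e))%:E.
Proof.
move=> L0 e0 ab gL.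
have [|s [N [s0 cN Ns]]] := @cube_grid (fun k => b ord0 k - a ord0 k)%R e _ e0.
  by move=> k; rewrite subr_ge0.
pose I := {dffun forall k : 'I_n.+1, 'I_(N k)}.
pose cube (f : I) : set V := [set x | forall k,
  a ord0 k + (f k)%:R * s <= x ord0 k <= a ord0 k + (f k)%:R * s + s]%R.
have cardI : #|{: I}| = (\prod_k N k)%N.
  rewrite card_dep_ffun foldrE big_map big_enum/=.
  by apply: eq_bigr => k _; rewrite card_ord.
apply: le_trans (@lebesgue_rV_finite_cover _ (enum {: I}) _
   (fun f => g @` (S `&` cube f)) _) _.
  move=> _ [x [Sx xab] <-].
  have bound k : (Num.truncn ((x ord0 k - a ord0 k) / s) < N k)%N.
    have /andP[x1 x2] := xab k.
    have h0 : (0 <= (x ord0 k - a ord0 k) / s)%R by rewrite divr_ge0 ?subr_ge0 ?(ltW s0).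
    have /andP[h1 _] := truncn_itv h0.
    rewrite -(@ltr_nat R); apply: le_lt_trans h1 _; rewrite ltr_pdivrMr//.
    by apply: le_lt_trans (cN k); rewrite lerD2r.
  exists [ffun k => Ordinal (bound k)]; first by rewrite mem_enum.
  exists x => //; split => // k; rewrite ffunE/=.
  have /andP[x1 x2] := xab k.
  have h0 : (0 <= (x ord0 k - a ord0 k) / s)%R by rewrite divr_ge0 ?subr_ge0 ?(ltW s0).
  have /andP[h1 h2] := truncn_itv h0.
  set t := Num.truncn _ in h1 h2 *.
  have {}h1 : (t%:R * s <= x ord0 k - a ord0 k)%R by rewrite -ler_pdivlMr.
  have {}h2 : (x ord0 k - a ord0 k < t%:R * s + s)%R.
    by rewrite -[X in (_ < _ + X)%R]mul1r -mulrDl natr1 -ltr_pdivrMr.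
  by apply/andP; split; lra.
have each f : leb (g @` (S `&` cube f)) <= ((2 * L * s) ^+ n.+1)%:E.
  have [[x0 [Sx0 x0f]]|ne] := pselect (exists x, S x /\ cube f x); last first.
    rewrite (_ : g @` _ = set0) ?lebesgue_rV0 ?lee_fin ?exprn_ge0 ?mulr_ge0 ?(ltW s0)//.
    by rewrite -subset0 => y [x Sx _]; apply: ne; exists x.
  pose u : V := const_mx (L * s)%R.
  have us k : (u ord0 k = L * s)%R by rewrite mxE.
  have Ls0 : (0 <= L * s)%R by rewrite mulr_ge0// ltW.
  apply: le_trans (lebesgue_rV_le (B := box (g x0 - u) (g x0 + u)) _) _.
    move=> _ [x [Sx xf] <-] k.
    have : (`|g x - g x0| <= L * s)%R.
      apply: le_trans (gL _ _ Sx Sx0) _; rewrite ler_wpM2l//.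
      apply: norm_le_coord => [|j]; first exact: ltW.
      rewrite !mxE ler_norml; have /andP[p1 p2] := xf j; have /andP[q1 q2] := x0f j.
      by apply/andP; split; lra.
    move=> /(le_trans (coord_le_norm _ k)); rewrite !mxE ler_norml => /andP[p1 p2].
    by apply/andP; split; lra.
  apply: le_trans (lebesgue_rV_box _) _.
    by move=> k; rewrite !mxE; lra.
  rewrite lee_fin /box_volume (eq_bigr (fun=> 2 * L * s)%R).
    by rewrite prodr_const card_ord.
  by move=> k _; rewrite !mxE; ring.
apply: le_trans (lee_sum _ (fun f _ => each f)) _.
rewrite sumEFin big_enum/= sumr_const cardI lee_fin -[X in (X <= _)%R]mulr_natl natr_prod.
rewrite [in X in (X <= _)%R]exprMn mulrCA; apply: ler_wpM2l Ns.
by rewrite exprn_ge0// mulr_ge0.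
Qed.

Lemma lebesgue_rV_lipschitz (g : V -> V) (S : set V) (L : R) : (0 < L)%R ->
  (forall x y, S x -> S y -> `|g x - g y| <= L * `|x - y|)%R ->
  leb (g @` S) <= ((2 * L) ^+ n.+1)%:E * leb S.
Proof.
move=> L0 gL; set C := ((2 * L) ^+ n.+1)%R.
have C0 : (0 < C)%R by rewrite exprn_gt0// mulr_gt0.
rewrite -lee_pdivrMl//; apply: le_ereal_inf_tmp => _ [a [b [ab Sab ->]]].
rewrite lee_pdivrMl//; apply/lee_addgt0Pr => e e0.
have eC : (0 < e / C)%R by rewrite divr_gt0.
apply: le_trans (lebesgue_rV_le (B := \bigcup_m g @` (S `&` box (a m) (b m))) _) _.
  by move=> _ [x Sx <-]; have [m _ xm] := Sab _ Sx; exists m => //; exists x.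
apply: le_trans (lebesgue_rV_sigma_subadditive _) _.
apply: (@le_trans _ _ (\sum_(0 <= m <oo) (C%:E * (box_volume (a m) (b m))%:E + (e / (2 ^ m.+1)%:R)%:E))).
  apply: lee_nneseries => [m _ _|m _]; first exact: lebesgue_rV_ge0.
  have em : (0 < e / C / (2 ^ m.+1)%:R)%R by rewrite divr_gt0// ltr0n expn_gt0.
  apply: le_trans (lebesgue_rV_lipschitz_box (ltW L0) em (ab m) gL) _.
  rewrite -EFinM -EFinD lee_fin -/C mulrDr lerD2l.
  by rewrite mulrA mulrCA mulfV ?mulr1// gt_eqF.
apply: le_trans (epsilon_trick _ _ (ltW e0)) _ => //.
  by move=> m; rewrite mule_ge0 ?lee_fin ?(ltW C0)// box_volume_ge0.
by rewrite nneseriesZl// => m _; rewrite lee_fin box_volume_ge0.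
Qed.

End lebesgue_borel.

(** * Uniform laws on cubes *)

Section cube_law.
Context {R : realType}.
Variable T : R.
Hypothesis T0 : - T < T.

Definition cons_time n (p : measurableTypeR R * 'rV[R]_n) : 'rV[R]_(1 + n) :=
  row_mx (p.1 : R)%:M p.2.

Lemma measurable_cons_time n : measurable_fun setT (@cons_time n).
Proof.
apply: measurable_fun_coords => k.
have -> : (fun p => cons_time p ord0 k) = match fintype.split k with
    | inl _ => fun p : measurableTypeR R * 'rV[R]_n => p.1 : R
    | inr j => fun p : measurableTypeR R * 'rV[R]_n => p.2 ord0 j end.
  apply/funext => p; rewrite /cons_time mxE; case: splitP => j _ //.
  by rewrite mxE (ord1 j) eqxx mulr1n.
case: (fintype.split k) => j; first exact: measurable_fst.
exact: (measurableT_comp (measurable_coord j) measurable_snd).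
Qed.

Definition time_law : giry (measurableTypeR R) R := uniform_prob T0.

(** Normalised Lebesgue measure on a cube, built as an iterated product so that durations can be
    integrated one at a time. Two inequalities below relate it to the outer measure. *)
Fixpoint cube_law n : giry 'rV[R]_n R :=
  match n return giry 'rV[R]_n R with
  | 0%N => giry_ret (0 : 'rV[R]_0)
  | n'.+1 => giry_map (@measurable_cons_time n') (giry_prod (time_law, cube_law n'))
  end.

Lemma measurable_box n (a b : 'rV[R]_n) : measurable (box a b).
Proof.
have -> : box a b = \bigcap_(k in setT) ((fun x : 'rV[R]_n => x ord0 k) @^-1` `[a ord0 k, b ord0 k]%classic).
  by apply/seteqP; split => x h k; have := h k; rewrite /= in_itv/=; [|apply].
apply: bigcap_fin_measurable => k; rewrite -[X in measurable X]setTI.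
exact: measurable_coord.
Qed.

Lemma cube_law_integral n (f : 'rV[R]_n.+1 -> \bar R) :
  measurable_fun setT f -> (forall x, 0 <= f x)%E ->
  (\int[cube_law n.+1]_x f x =
   \int[time_law]_t \int[cube_law n]_u f (cons_time (t, u)))%E.
Proof.
move=> mf f0.
have mc := @measurable_cons_time n.
have mfc : measurable_fun setT (fun p => f (@cons_time n p)) by exact: measurableT_comp.
rewrite -[LHS]/(giry_int (giry_map mc (giry_prod (time_law, cube_law n))) f).
rewrite giry_int_map//; exact: (giry_int_prod1 _ _ mfc (fun p => f0 _)).
Qed.

Lemma cube_law_box n (a b : 'rV[R]_n) :
  cube_law n (box a b) = (\prod_k time_law `[a ord0 k, b ord0 k]%classic)%E.
Proof.
elim: n a b => [|n IH] a b.
  have h : box a b (0 : 'rV[R]_0) by case.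
  by rewrite big_ord0 /= /giry_ret diracE mem_set.
pose a' : 'rV[R]_n := rsubmx (a : 'rV_(1 + n)); pose b' : 'rV[R]_n := rsubmx (b : 'rV_(1 + n)).
rewrite big_ord_recl.
have -> : (\prod_(i < n) time_law `[a ord0 (lift ord0 i), b ord0 (lift ord0 i)]%classic =
    cube_law n (box a' b'))%E.
  rewrite IH; apply: eq_bigr => i _; rewrite !mxE.
  by rewrite (_ : rshift 1 i = lift ord0 i)//; exact: val_inj.
have -> : cube_law n.+1 (box a b) =
  (time_law \x cube_law n)%E (`[a ord0 ord0, b ord0 ord0]%classic `*` box a' b').
  rewrite /= /pushforward; congr (_ _); apply/seteqP; split => -[t u] /=.
    move=> h; split => [|k].
      by have := h ord0; rewrite /= row_mx_ord0 in_itv.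
    have := h (rshift 1 k).
    have -> : cons_time (t, u) ord0 (rshift 1 k) = u ord0 k by exact: row_mxEr.
    by rewrite !mxE.
  rewrite in_itv/= => -[h1 h2] k; rewrite /cons_time mxE; case: splitP => j kj /=.
    by rewrite mxE (ord1 j) eqxx mulr1n (_ : k = ord0)//; apply: ord_inj; rewrite kj (ord1 j).
  by have := h2 j; rewrite !mxE (_ : rshift 1 j = k)//; apply: ord_inj.
by rewrite product_measure1E//; exact: measurable_box.
Qed.

Let len := T - (- T).
Let len0 : 0 < len. Proof. by rewrite subr_gt0. Qed.

Lemma time_law_itv (a b : R) : a <= b ->
  (time_law `[a, b]%classic <= ((b - a) / len)%:E)%E.
Proof.
move=> ab; rewrite /time_law /= /uniform_prob.
apply: (@le_trans _ _ (\int[lebesgue_measure]_(x in `[a, b]%classic) (len^-1)%:E)%E).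
  apply: ge0_le_integral => //=.
  - by move=> x _; rewrite lee_fin uniform_pdf_ge0.
  - by apply/measurable_EFinP/measurable_funTS; exact: measurable_uniform_pdf.
  - move=> x _; rewrite lee_fin /uniform_pdf; case: ifP => // _.
    by rewrite invr_ge0 ltW.
rewrite integral_cst//= lebesgue_measure_itv/= lte_fin.
case: ifP => [_|]; first by rewrite -EFinD -EFinM mulrC.
by rewrite mule0 lee_fin divr_ge0 ?subr_ge0// ltW.
Qed.

Lemma time_law_full : time_law `[- T, T]%classic = 1%E.
Proof.
apply/eqP; rewrite eq_le; apply/andP; split; first exact: (@probability_le1 _ _ _ (uniform_prob T0)).
rewrite /time_law /= /uniform_prob.
by rewrite integral_uniform_pdf1.
Qed.

Definition time_box n : set 'rV[R]_n := box (const_mx (- T)) (const_mx T).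

Lemma measurable_time_box n : measurable (@time_box n).
Proof. exact: measurable_box. Qed.

Lemma cube_law_full n : cube_law n (@time_box n) = 1%E.
Proof.
rewrite cube_law_box big1// => k _; rewrite !mxE; exact: time_law_full.
Qed.

Lemma cube_law_box_le n (a b : 'rV[R]_n) : (forall k, a ord0 k <= b ord0 k) ->
  (cube_law n (box a b) <= (len^-1 ^+ n * box_volume a b)%:E)%E.
Proof.
move=> ab; rewrite cube_law_box /box_volume.
have -> : len^-1 ^+ n * \prod_k (b ord0 k - a ord0 k) =
    \prod_(k < n) ((b ord0 k - a ord0 k) / len).
  by rewrite big_split/= prodr_const card_ord mulrC.
rewrite -prodEFin.
apply: (@proj2 (0 <= \prod_(k < n) time_law `[a ord0 k, b ord0 k]%classic)%E).
elim/big_rec2 : _ => [|k y x _ [h1 h2]]; first by split.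
split; first by rewrite mule_ge0.
by apply: lee_pmul => //; exact: time_law_itv.
Qed.

Lemma cube_law_le_lebesgue n (A : set 'rV[R]_n.+1) : measurable A ->
  (cube_law n.+1 A <= (len^-1 ^+ n.+1)%:E * lebesgue_rV A)%E.
Proof.
move=> mA; set c := len^-1 ^+ n.+1.
have c0 : 0 < c by rewrite exprn_gt0// invr_gt0.
rewrite -lee_pdivrMl//; apply: le_ereal_inf_tmp => _ [a [b [ab Aab ->]]].
rewrite lee_pdivrMl// -nneseriesZl//; last by move=> m _; rewrite lee_fin box_volume_ge0.
apply: le_trans (_ : \sum_(0 <= m <oo) cube_law n.+1 (box (a m) (b m)) <= _)%E.
  by apply: measure_sigma_subadditive => // m; exact: measurable_box.
by apply: lee_nneseries => [//|m _]; rewrite -EFinM; exact: cube_law_box_le.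
Qed.

(** The upper bound [cube_law_le_lebesgue] is applied to the complement of [A] in the cube; the
    Caratheodory property of [A] splits the volume of the cube, which is at most [c^-1]. *)
Lemma lebesgue_le_cube_law n (A : set 'rV[R]_n.+1) : measurable A ->
  A `<=` @time_box n.+1 -> ((len^-1 ^+ n.+1)%:E * lebesgue_rV A <= cube_law n.+1 A)%E.
Proof.
move=> mA AQ; set c := len^-1 ^+ n.+1; set Q := @time_box n.+1.
have c0 : 0 < c by rewrite exprn_gt0// invr_gt0.
have mQ : measurable Q by exact: measurable_time_box.
have Qv : (lebesgue_rV Q <= (c^-1)%:E)%E.
  apply: le_trans (lebesgue_rV_box _) _.
    by move=> k; rewrite !mxE ltW.
  rewrite lee_fin /box_volume (eq_bigr (fun=> len)); last by move=> k _; rewrite !mxE.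
  by rewrite prodr_const card_ord /c exprVn invrK.
have := caratheodory_borel mA Q; rewrite (setIidr AQ) => E.
have fA : (lebesgue_rV A <= (c^-1)%:E)%E by apply: le_trans (lebesgue_rV_le AQ) Qv.
have fC : (lebesgue_rV (Q `&` ~` A) <= (c^-1)%:E)%E.
  by apply: le_trans (lebesgue_rV_le _) Qv => x [].
have mC : measurable (Q `&` ~` A) by apply: measurableI => //; exact: measurableC.
have h1 := cube_law_le_lebesgue mC.
have : (cube_law n.+1 A + cube_law n.+1 (Q `&` ~` A) = 1)%E.
  rewrite -(cube_law_full n.+1) -/Q.
  rewrite -measureU//; first by rewrite -[A in A `|` _](setIidr AQ) -setIUr setUCr setIT.
  by rewrite setICA setICr setI0.
have fin (B : set 'rV[R]_n.+1) : (lebesgue_rV B <= (c^-1)%:E)%E -> lebesgue_rV B \is a fin_num.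
  by move=> h; rewrite ge0_fin_numE ?lebesgue_rV_ge0//; apply: le_lt_trans h (ltry _).
have finm (B : set 'rV[R]_n.+1) : measurable B -> cube_law n.+1 B \is a fin_num.
  by move=> mB; exact: fin_num_measure.
move: E h1 Qv; rewrite -/c.
rewrite -(fineK (fin _ fA)) -(fineK (fin _ fC)) -(fineK (finm _ mA)) -(fineK (finm _ mC)).
rewrite -!EFinD -!EFinM !lee_fin => -> h1; rewrite lee_fin => h2 [h3].
have h4 : c * (fine (lebesgue_rV A) + fine (lebesgue_rV (Q `&` ~` A))) <= 1.
  by rewrite mulrC -ler_pdivlMr// div1r.
lra.
Qed.

(** Each comparison with Lebesgue measure is used in one direction, so that only [B] has to lie in
    the cube. *)
Lemma cube_law_shift n (A B : set 'rV[R]_n.+1) v : measurable A -> measurable B ->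
  B `<=` @time_box n.+1 -> (forall x, A x -> B (x + v)) ->
  (cube_law n.+1 A <= cube_law n.+1 B)%E.
Proof.
move=> mA mB BQ AB; apply: le_trans (cube_law_le_lebesgue mA) _.
apply: le_trans (lebesgue_le_cube_law mB BQ).
by rewrite lee_wpmul2l ?(lebesgue_rV_shift AB)// lee_fin exprn_ge0// invr_ge0 ltW.
Qed.

Lemma cube_law_lipschitz n (g : 'rV[R]_n.+1 -> 'rV[R]_n.+1) (A B : set 'rV[R]_n.+1) (L : R) :
  0 < L -> measurable A -> measurable B -> A `<=` @time_box n.+1 ->
  (forall x y, A x -> A y -> `|g x - g y| <= L * `|x - y|) -> B `<=` g @` A ->
  (cube_law n.+1 B <= ((2 * L) ^+ n.+1)%:E * cube_law n.+1 A)%E.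
Proof.
move=> L0 mA mB AQ gL BgA; apply: le_trans (cube_law_le_lebesgue mB) _.
have c0 : 0 <= len^-1 ^+ n.+1 by rewrite exprn_ge0// invr_ge0 ltW.
have C0 : 0 <= (2 * L) ^+ n.+1 by rewrite exprn_ge0// mulr_ge0// ltW.
apply: le_trans (lee_wpmul2l _ (lebesgue_le_cube_law mA AQ)); rewrite ?lee_fin//.
rewrite muleCA lee_wpmul2l ?lee_fin//.
exact: le_trans (lebesgue_rV_le BgA) (lebesgue_rV_lipschitz L0 gL).
Qed.

Lemma time_law_itvE (a b : R) : - T <= a -> a <= b -> b <= T ->
  time_law `[a, b]%classic = ((b - a) / len)%:E.
Proof.
move=> Ta ab bT; rewrite /time_law /= /uniform_prob.
rewrite (eq_integral (fun=> (len^-1)%:E)); last first.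
  move=> x; rewrite inE/= in_itv/= => /andP[ax xb]; congr (_%:E).
  by rewrite /uniform_pdf (le_trans Ta ax) (le_trans xb bT).
rewrite integral_cst//= lebesgue_measure_itv/= lte_fin.
case: ltgtP ab => // [ab _|-> _]; first by rewrite -EFinD -EFinM mulrC.
by rewrite subrr mul0r mule0.
Qed.

Lemma cube_law_box_gt0 n (a b : 'rV[R]_n) :
  (forall k, [/\ - T <= a ord0 k, a ord0 k < b ord0 k & b ord0 k <= T]) ->
  (0 < cube_law n (box a b))%E.
Proof.
move=> ab; rewrite cube_law_box; elim/big_ind : _ => [||k _]; first exact: lte01.
  by move=> x y; exact: mule_gt0.
have [h1 h2 h3] := ab k.
by rewrite time_law_itvE ?(ltW h2)// lte_fin divr_gt0 ?subr_gt0.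
Qed.

End cube_law.

(** * Markov operators and the Doeblin condition *)

Section unit_functions.
Context {R : realType} d (X : measurableType d).
Local Open Scope ereal_scope.

(** These test functions have finite integrals, which lets the contraction argument run in [R]
    rather than in [\bar R]. *)
Definition unit_fun (f : X -> R) :=
  measurable_fun setT f /\ (forall x, 0 <= f x <= 1)%R.

(** Elements of [giry] are subprobabilities; statements that need total mass 1 carry [mu setT = 1]
    as a hypothesis. *)
Definition mean (mu : giry X R) (f : X -> R) : R := fine (\int[mu]_x (f x)%:E).

Lemma meanE (mu : giry X R) f : unit_fun f -> \int[mu]_x (f x)%:E = (mean mu f)%:E.
Proof.
move=> [mf f01]; rewrite fineK// ge0_fin_numE; last first.
  by apply: integral_ge0 => x _; rewrite lee_fin; case/andP: (f01 x).
apply: (@le_lt_trans _ _ (\int[mu]_x (cst 1 x))).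
  apply: ge0_le_integral => //.
  - by move=> x _; rewrite lee_fin; case/andP: (f01 x).
  - exact/measurable_EFinP.
  - by move=> x _; rewrite lee_fin; case/andP: (f01 x).
rewrite integral_cst// mul1e; apply: le_lt_trans (sprobability_setT) _.
exact: ltry.
Qed.

Lemma mean_indic (mu : giry X R) A : measurable A -> (mean mu \1_A)%:E = mu A.
Proof.
move=> mA; rewrite -meanE; first by rewrite integral_indic// setIT.
split; first exact: measurable_indic.
by move=> x; rewrite indicE; case: (_ \in _); rewrite /= ?lexx ?ler01.
Qed.

Lemma unit_fun_indic A : measurable A -> unit_fun \1_A.
Proof.
move=> mA; split; first exact: measurable_indic.
by move=> x; rewrite indicE; case: (_ \in _); rewrite /= ?lexx ?ler01.
Qed.

Lemma mean_le (mu : giry X R) f g : unit_fun f -> unit_fun g -> (forall x, f x <= g x)%R ->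
  (mean mu f <= mean mu g)%R.
Proof.
move=> uf ug fg; rewrite -lee_fin -!meanE//; apply: ge0_le_integral => //.
- by move=> x _; rewrite lee_fin; case/andP: (uf.2 x).
- by apply/measurable_EFinP; case: uf.
- by apply/measurable_EFinP; case: ug.
- by move=> x _; rewrite lee_fin.
Qed.

Lemma mean_const (mu : giry X R) (c : R) : mu setT = 1 -> (0 <= c)%R -> mean mu (cst c) = c.
Proof. by move=> mu1 c0; rewrite /mean/= integral_cst// -[X in (_ * X)%E]/(mu setT) mu1 mule1. Qed.

Lemma mean_shift (mu : giry X R) f (a : R) : mu setT = 1 -> unit_fun f ->
  (0 <= a)%R -> (forall x, a <= f x)%R -> mean mu (fun x => f x - a)%R = (mean mu f - a)%R.
Proof.
move=> mu1 uf a0 af; have [mf f01] := uf.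
have ufa : unit_fun (fun x => f x - a)%R.
  split; first exact: measurable_funB.
  move=> x; rewrite subr_ge0 af/=; case/andP: (f01 x) => _ f1.
  by rewrite (le_trans _ f1)// gerBl.
apply/eqP; rewrite eq_sym subr_eq; apply/eqP/EFin_inj.
rewrite EFinD -(meanE mu uf) -(meanE mu ufa) -[in X in _ = _ + X](mean_const mu1 a0) /mean/=.
rewrite fineK; last by rewrite integral_cst// -[X in (_ * X)%E]/(mu setT) mu1 mule1.
rewrite -ge0_integralD//.
- by apply: eq_integral => x _; rewrite -EFinD subrK.
- by move=> x _; rewrite lee_fin; case/andP: (ufa.2 x).
- by apply/measurable_EFinP; case: ufa.
Qed.

Lemma mean_compl (mu : giry X R) f (a : R) : mu setT = 1 -> unit_fun f ->
  (0 <= a)%R -> (forall x, 0 <= a - f x <= 1)%R ->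
  mean mu (fun x => a - f x)%R = (a - mean mu f)%R.
Proof.
move=> mu1 uf a0 af; have [mf f01] := uf.
have ufa : unit_fun (fun x => a - f x)%R by split=> //; exact: measurable_funB.
apply/eqP; rewrite eq_sym subr_eq; apply/eqP/EFin_inj.
rewrite EFinD -(meanE mu uf) -(meanE mu ufa) -[in X in X = _](mean_const mu1 a0) /mean/=.
rewrite fineK; last by rewrite integral_cst// -[X in (_ * X)%E]/(mu setT) mu1 mule1.
rewrite -ge0_integralD//.
- by apply: eq_integral => x _; rewrite -EFinD subrK.
- by move=> x _; rewrite lee_fin; case/andP: (ufa.2 x).
- by apply/measurable_EFinP; case: ufa.
- by move=> x _; rewrite lee_fin; case/andP: (f01 x).
- exact/measurable_EFinP.
Qed.

(* Level sets reduce an inequality between means to one between measures. *)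
Lemma mean_le_of_measure_le (mu nu : giry X R) (a w : R) f : (0 <= a <= 1)%R -> (0 <= w)%R ->
  (forall B, measurable B -> a%:E * mu B <= nu B + w%:E) -> unit_fun f ->
  (a * mean mu f <= mean nu f + w)%R.
Proof.
move=> /andP[a0 a1] w0 hB uf; have [mf f01] := uf.
apply/ler_addgt0Pr => e e0.
have [N Ne] : exists N : nat, (N.+1%:R^-1 <= e)%R.
  have /cvgrPdist_lt/(_ _ e0)[m _ /(_ m (leqnn m))] := @cvg_harmonic R.
  by rewrite /= sub0r normrN ger0_norm// => /ltW h; exists m.
pose M : R := N.+1%:R; have M0 : (0 < M)%R by [].
pose B k := [set x | (k.+1%:R / M <= f x)%R].
have mB k : measurable (B k).
  rewrite -[B k]setTI (_ : B k = f @^-1` `[(k.+1%:R / M)%R, +oo[%classic); first exact: mf.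
  by apply/seteqP; split => x /=; rewrite in_itv/= andbT.
(* [g] rounds [f] down to a multiple of [M^-1], written as a sum of indicators of level sets. *)
pose g x : R := (\sum_(k < N.+1) M^-1 * \1_(B k) x)%R.
have gf x : (g x <= f x <= g x + M^-1)%R.
  have /andP[f0 f1] := f01 x.
  have Mf0 : (0 <= M * f x)%R by rewrite mulr_ge0// ltW.
  have /andP[t1 t2] := truncn_itv Mf0.
  set t := Num.truncn _ in t1 t2.
  have tN : (t <= N.+1)%N.
    rewrite -(@ler_nat R); apply: le_trans t1 _; rewrite -/M ler_piMr// ltW.
  have -> : (g x = t%:R / M)%R.
    rewrite /g -mulr_sumr mulrC; congr (_ * _)%R.
    rewrite (eq_bigr (fun k : 'I_N.+1 => (k < t)%N%:R)%R); last first.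
      move=> k _; rewrite indicE; congr (_%:R); congr (nat_of_bool _).
      apply/idP/idP.
        rewrite inE /B/= ler_pdivrMr// mulrC => h; rewrite -ltnS -(@ltr_nat R).
        exact: le_lt_trans h t2.
      move=> kt; rewrite inE /B/= ler_pdivrMr// mulrC; apply: le_trans t1.
      by rewrite ler_nat.
    rewrite -natr_sum; congr (_%:R).
    transitivity (\sum_(k < N.+1 | (k < t)%N) 1)%N.
      by rewrite [RHS]big_mkcond; apply: eq_bigr => k _; case: ltnP.
    by rewrite -(big_ord_widen _ (fun=> 1%N) tN) sum1_card card_ord.
  apply/andP; split; first by rewrite ler_pdivrMr// mulrC.
  by rewrite -[X in (_ + X)%R]mul1r -mulrDl ler_pdivlMr// mulrC natr1 ltW.
have mg : measurable_fun setT g.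
  apply: measurable_sum => k; apply: measurable_funM => //; exact: measurable_indic.
have g0 x : (0 <= g x)%R.
  by apply: sumr_ge0 => k _; rewrite mulr_ge0 ?indicE// invr_ge0 ltW.
have ug : unit_fun g.
  split=> // x; rewrite g0/=; have /andP[h1 _] := gf x; apply: le_trans h1 _.
  by case/andP: (f01 x).
have meang (m : giry X R) : (mean m g = \sum_(k < N.+1) M^-1 * fine (m (B k)))%R.
  apply: EFin_inj; rewrite -meanE// -sumEFin.
  under eq_integral do rewrite /g -sumEFin.
  rewrite ge0_integral_sum//; last 2 first.
  - move=> k; apply/measurable_EFinP; apply: measurable_funM => //; exact: measurable_indic.
  - by move=> k x _; rewrite lee_fin mulr_ge0 ?indicE// invr_ge0 ltW.
  apply: eq_bigr => k _; under eq_integral do rewrite EFinM.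
  rewrite ge0_integralZl_EFin//; last 2 first.
  - by apply/measurable_EFinP; exact: measurable_indic.
  - by rewrite invr_ge0 ltW.
  by rewrite integral_indic// setIT EFinM fineK// fin_num_measure.
have up (m : giry X R) : (mean m f <= mean m g + M^-1)%R.
  rewrite -lee_fin EFinD -!meanE//.
  apply: (@le_trans _ _ (\int[m]_x ((g x)%:E + (M^-1)%:E))).
    apply: ge0_le_integral => //.
    - by move=> x _; rewrite lee_fin; case/andP: (f01 x).
    - exact/measurable_EFinP.
    - by apply: emeasurable_funD => //; exact/measurable_EFinP.
    - by move=> x _; rewrite -EFinD lee_fin; case/andP: (gf x).
  have mG : measurable_fun setT (fun x => (g x)%:E) by exact/measurable_EFinP.
  have G0 : forall x, setT x -> 0 <= (g x)%:E by move=> x _; rewrite lee_fin.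
  have c0 : forall x : X, setT x -> 0 <= (M^-1)%:E by move=> x _; rewrite lee_fin invr_ge0 ltW.
  rewrite ge0_integralD//.
  rewrite leeD2l// integral_cst// -[leRHS]mule1; apply: lee_wpmul2l; first by rewrite lee_fin invr_ge0 ltW.
  exact: (@sprobability_setT _ _ _ m).
have low (m : giry X R) : (mean m g <= mean m f)%R.
  by apply: mean_le => // x; case/andP: (gf x).
apply: (@le_trans _ _ (a * (mean mu g + M^-1))%R); first by rewrite ler_wpM2l.
rewrite mulrDr; apply: lerD; last by apply: le_trans Ne; rewrite ler_piMl// invr_ge0 ltW.
apply: le_trans (_ : (mean nu g + w <= _)%R); last by rewrite lerD2r.
rewrite !meang mulr_sumr.
have -> : (w = \sum_(k < N.+1) M^-1 * w)%R.
  by rewrite sumr_const card_ord -[RHS]mulr_natl mulrA mulfV ?mul1r// gt_eqF.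
rewrite -big_split/=; apply: ler_sum => k _.
rewrite mulrCA -mulrDr ler_wpM2l ?invr_ge0 ?(ltW M0)// -lee_fin EFinM EFinD.
by rewrite !fineK ?fin_num_measure//; exact: hB.
Qed.

End unit_functions.

Section markov_operator.
Context {R : realType} d (X : measurableType d).
Variables (K : X -> giry X R) (mK : measurable_fun setT K).
Hypothesis K1 : forall z, (K z setT = 1)%E.

Definition markov_op (f : X -> R) (z : X) : R := mean (K z) f.
Definition push (mu : giry X R) : giry X R := giry_bind mu mK.

Lemma mean_bounds (mu : giry X R) (f : X -> R) (a b : R) : (mu setT = 1)%E -> unit_fun f ->
  0 <= a -> (forall x, a <= f x <= b) -> a <= mean mu f <= b.
Proof.
move=> mu1 uf a0 fab.
have f1 x : f x <= 1 by case/andP: (uf.2 x).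
have a1 : a <= 1.
  by have /andP[h _] := fab point; exact: le_trans (f1 point).
have ucst (c : R) : 0 <= c -> c <= 1 -> unit_fun (cst c : X -> R).
  by move=> c0 c1; split=> // x; rewrite c0.
apply/andP; split.
  rewrite -[a in a <= _](mean_const mu1 a0).
  by apply: mean_le => //; [exact: ucst|move=> x; case/andP: (fab x)].
have [b1|b1] := leP 1 b.
  apply: le_trans b1; rewrite -[X in _ <= X](mean_const mu1 ler01).
  by apply: mean_le => //; exact: ucst.
have b0 : 0 <= b.
  by have /andP[h1 h2] := fab point; rewrite (le_trans a0)// (le_trans h1).
rewrite -[b in _ <= b](mean_const mu1 b0).
by apply: mean_le => //; [apply: ucst => //; exact: ltW|move=> x; case/andP: (fab x)].
Qed.

Lemma unit_fun_op f : unit_fun f -> unit_fun (markov_op f).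
Proof.
move=> uf; have [mf f01] := uf; split; last first.
  by move=> z; exact: mean_bounds.
have f0 x : (0 <= (f x)%:E)%E by rewrite lee_fin; case/andP: (f01 x).
have mF : measurable_fun setT (fun x => (f x)%:E) by exact/measurable_EFinP.
have h := measurableT_comp (measurable_giry_int mF f0) mK.
exact: (measurableT_comp (fine_measurable measurableT) h).
Qed.

Lemma unit_fun_iter n f : unit_fun f -> unit_fun (iter n markov_op f).
Proof. by move=> uf; elim: n => //= n IH; exact: unit_fun_op. Qed.

Lemma mean_push mu f : unit_fun f -> mean (push mu) f = mean mu (markov_op f).
Proof.
move=> uf; have [mf f01] := uf.
have f0 x : (0 <= (f x)%:E)%E by rewrite lee_fin; case/andP: (f01 x).
have mF : measurable_fun setT (fun x => (f x)%:E) by exact/measurable_EFinP.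
rewrite /mean; congr fine.
rewrite -[LHS]/(giry_int (giry_bind mu mK) (fun x => (f x)%:E)) giry_int_bind//.
by apply: eq_integral => x _; rewrite /giry_int meanE.
Qed.

Lemma giry_mean_ext (mu nu : giry X R) A : measurable A ->
  mean mu \1_A = mean nu \1_A -> mu A = nu A.
Proof. by move=> mA h; rewrite -!mean_indic// h. Qed.

Lemma push_setT (mu : giry X R) : (mu setT = 1)%E -> (push mu setT = 1)%E.
Proof.
move=> mu1; rewrite -mean_indic// mean_push; last exact: unit_fun_indic.
have -> : markov_op \1_setT = cst 1.
  apply/funext => z; rewrite /markov_op; apply: EFin_inj.
  by rewrite mean_indic// -[LHS]/(K z setT) K1.
by rewrite mean_const.
Qed.

Definition law n (mu : giry X R) := iter n push mu.

Lemma law_setT n (mu : giry X R) : (mu setT = 1)%E -> (law n mu setT = 1)%E.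
Proof. by move=> mu1; elim: n => //= n IH; exact: push_setT. Qed.

Lemma mean_law n (mu : giry X R) f : unit_fun f -> mean (law n mu) f = mean mu (iter n markov_op f).
Proof.
elim: n f => //= n IH f uf; rewrite mean_push// IH; last exact: unit_fun_op.
by rewrite -iterS -iterSr.
Qed.

Lemma mean_ret (z : X) (f : X -> R) : unit_fun f -> mean (giry_ret z : giry X R) f = f z.
Proof.
move=> [mf _]; have mF : measurable_fun setT (fun x => (f x)%:E) by exact/measurable_EFinP.
by rewrite /mean -[X in fine X]/(giry_int (giry_ret z) (fun x => (f x)%:E)) giry_int_ret.
Qed.

Section doeblin.
Variables (m : nat) (delta : R) (nu : giry X R).
Hypotheses (m0 : (0 < m)%N) (delta0 : 0 < delta) (delta1 : delta < 1).
Hypothesis nu1 : (nu setT = 1)%E.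
Hypothesis minorization : forall z B, measurable B ->
  (delta%:E * nu B <= (iter m markov_op \1_B z)%:E)%E.

(** The minorization is applied to [f - a] and to [a + w - f]. It pushes both ends of the range
    towards the mean under [nu], so that a fraction [delta] of the width is lost. *)
Lemma doeblin_step f (a w : R) : unit_fun f -> 0 <= a -> 0 <= w <= 1 ->
  (forall z, a <= f z <= a + w) ->
  exists2 a', 0 <= a' & forall z, a' <= iter m markov_op f z <= a' + (1 - delta) * w.
Proof.
move=> uf a0 /andP[w0 w1] fa; have [mf f01] := uf.
have /andP[an nw] := mean_bounds nu1 uf a0 fa.
exists (a + delta * (mean nu f - a)).
  by rewrite addr_ge0// mulr_ge0 ?subr_ge0// ltW.
move=> z; pose kz := law m (giry_ret z : giry X R).
have r1 : ((giry_ret z : giry X R) setT = 1)%E by rewrite /giry_ret/= -[LHS]/(\d_z setT) diracE mem_set.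
have kz1 : (kz setT = 1)%E by exact: law_setT.
have kzE g : unit_fun g -> mean kz g = iter m markov_op g z.
  by move=> ug; rewrite mean_law// mean_ret//; exact: unit_fun_iter.
have kzB B : measurable B -> (delta%:E * nu B <= kz B + 0%:E)%E.
  move=> mB; rewrite adde0 -[kz B]mean_indic// kzE; last exact: unit_fun_indic.
  exact: minorization.
have d01 : 0 <= delta <= 1 by rewrite !ltW.
have main g : unit_fun g -> delta * mean nu g <= mean kz g.
  by move=> ug; have := mean_le_of_measure_le d01 (lexx 0) kzB ug; rewrite addr0.
have ufa : unit_fun (fun x => f x - a).
  split; first exact: measurable_funB.
  move=> x; have /andP[h1 h2] := f01 x; have /andP[h3 h4] := fa x.
  by apply/andP; split; lra.
have aw01 x : 0 <= a + w - f x <= 1.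
  by have /andP[h3 h4] := fa x; apply/andP; split; lra.
have ufb : unit_fun (fun x => a + w - f x).
  by split=> //; exact: measurable_funB.
have aw0 : 0 <= a + w by exact: addr_ge0.
have fa' x : a <= f x by case/andP: (fa x).
have := main _ ufa; have := main _ ufb.
rewrite !mean_shift// !mean_compl// -(kzE f)//.
by move=> h1 h2; apply/andP; split; lra.
Qed.

Lemma doeblin_iter k f : unit_fun f ->
  exists2 a, 0 <= a & forall z, a <= iter (k * m) markov_op f z <= a + (1 - delta) ^+ k.
Proof.
move=> uf; elim: k => [|k [a a0 IH]].
  by exists 0 => // z; rewrite mul0n/= expr0 add0r; exact: uf.2.
have w01 : 0 <= (1 - delta) ^+ k <= 1.
  rewrite exprn_ge0 ?subr_ge0 ?(ltW delta1)//= exprn_ile1// ?subr_ge0 ?(ltW delta1)//.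
  by rewrite gerBl ltW.
have [a' a'0 h] := doeblin_step (unit_fun_iter (k * m) uf) a0 w01 IH.
by exists a' => // z; rewrite mulSn iterD exprS.
Qed.

Lemma doeblin_oscillation n f : unit_fun f -> exists2 a, 0 <= a &
  forall mu : giry X R, (mu setT = 1)%E -> a <= mean (law n mu) f <= a + (1 - delta) ^+ (n %/ m).
Proof.
move=> uf; have [a a0 h] := doeblin_iter (n %/ m) uf; exists a => // mu mu1.
rewrite [X in law X](divn_eq n m) addnC mean_law// iterD -mean_law; last exact: unit_fun_iter.
apply: mean_bounds => //; [exact: law_setT|exact: unit_fun_iter].
Qed.

(** By Bernoulli's inequality the [m]-th power of this rate is at least [1 - delta], which avoids an
    [m]-th root. *)
Definition doeblin_rate : R := 1 - delta / m%:R.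
(** The inverse power pays for the remainder of [n] modulo [m]; adding 1 makes the constant exceed
    1. *)
Definition doeblin_const : R := doeblin_rate ^- m + 1.

Lemma doeblin_rate01 : 0 < doeblin_rate < 1.
Proof.
have mR : 0 < (m%:R : R) by rewrite ltr0n.
rewrite /doeblin_rate; apply/andP; split.
  rewrite subr_gt0 ltr_pdivrMr// mul1r; apply: lt_le_trans delta1 _.
  by rewrite ler1n.
by rewrite gtrBl divr_gt0.
Qed.

Lemma doeblin_rate_le n : (1 - delta) ^+ (n %/ m) <= doeblin_const * doeblin_rate ^+ n.
Proof.
have /andP[r0 r1] := doeblin_rate01.
have bern k (x : R) : 0 <= x -> x <= 1 -> 1 - k%:R * x <= (1 - x) ^+ k.
  move=> x0 x1; elim: k => [|k IH]; first by rewrite mul0r subr0 expr0.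
  rewrite exprS -natr1; apply: le_trans (ler_wpM2l _ IH); last by rewrite subr_ge0.
  have : 0 <= k%:R * x * x by rewrite !mulr_ge0.
  lra.
have mR : 0 < (m%:R : R) by rewrite ltr0n.
have h1 : 1 - delta <= doeblin_rate ^+ m.
  apply: le_trans (bern m (delta / m%:R) _ _).
  - by rewrite mulrCA mulfV ?mulr1// gt_eqF.
  - by rewrite divr_ge0// ltW.
  - by rewrite ler_pdivrMr// mul1r; apply: le_trans (ltW delta1) _; rewrite ler1n.
have h2 : (1 - delta) ^+ (n %/ m) <= doeblin_rate ^+ (m * (n %/ m)).
  by rewrite exprM lerXn2r ?nnegrE ?subr_ge0 ?(ltW delta1)// exprn_ge0// ltW.
apply: le_trans h2 _.
rewrite /doeblin_const mulrDl mul1r; apply: le_trans (_ : doeblin_rate ^- m * doeblin_rate ^+ n <= _); last first.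
  by rewrite lerDl exprn_ge0// ltW.
rewrite mulrC ler_pdivlMr ?exprn_gt0// -exprD.
apply: ler_wiXn2l; [exact: ltW|exact: ltW|].
by rewrite [leqLHS](divn_eq n m) mulnC leq_add2l ltnW// ltn_mod.
Qed.

Lemma law_contraction n f (mu mu' : giry X R) : unit_fun f ->
  (mu setT = 1)%E -> (mu' setT = 1)%E ->
  `|mean (law n mu) f - mean (law n mu') f| <= doeblin_const * doeblin_rate ^+ n.
Proof.
move=> uf mu1 mu'1; apply: le_trans (doeblin_rate_le n).
have [a a0 h] := doeblin_oscillation n uf.
have /andP[h1 h2] := h _ mu1; have /andP[h3 h4] := h _ mu'1.
by rewrite ler_norml; apply/andP; split; lra.
Qed.

Lemma doeblin_const_gt1 : 1 < doeblin_const.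
Proof.
have /andP[r0 _] := doeblin_rate01.
by rewrite /doeblin_const ltrDr invr_gt0 exprn_gt0.
Qed.

End doeblin.
End markov_operator.

(** * Existence and uniqueness of the invariant probability *)

Section uniform_limit.
Context {R : realType} d (X : measurableType d).
Variables (mu : nat -> giry X R) (p : set X -> R).
Hypothesis mu1 : forall n, mu n setT = 1%E.
Hypothesis close : forall e : R, 0 < e ->
  exists N, forall A, measurable A -> `|fine (mu N A) - p A| <= e.

Local Lemma limit_ge0 A : measurable A -> 0 <= p A.
Proof.
move=> mA; apply/ler_addgt0Pr => e e0; have [N /(_ A mA)] := close e0.
have : 0 <= fine (mu N A) by exact: fine_ge0.
by rewrite ler_norml => h /andP[h1 h2]; lra.
Qed.

(* The maximum only matters for nonmeasurable sets, where [p] is unconstrained. *)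
Local Definition limit_measure A : \bar R := (Num.max 0 (p A))%:E.

Local Lemma limit_measureE A : measurable A -> limit_measure A = (p A)%:E.
Proof. by move=> mA; rewrite /limit_measure max_r// limit_ge0. Qed.

Local Lemma small_eq0 (x c : R) : 0 <= c -> (forall e, 0 < e -> `|x| <= c * e) -> x = 0.
Proof.
move=> c0 h; apply/eqP; rewrite -normr_le0; apply/ler_addgt0Pr => e e0; rewrite add0r.
have c1 : 0 < c + 1 by rewrite ltr_wpDl.
apply: le_trans (h (e / (c + 1)) (divr_gt0 e0 c1)) _.
by rewrite mulrA ler_pdivrMr// mulrC ler_wpM2l ?(ltW e0)// lerDl.
Qed.

Local Lemma limit_val (A : set X) (c : R) : measurable A ->
  (forall n, mu n A = c%:E) -> p A = c.
Proof.
move=> mA h; apply/eqP; rewrite -subr_eq0; apply/eqP/(@small_eq0 _ 1) => // e e0.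
by rewrite mul1r; have [N /(_ A mA)] := close e0; rewrite h/= distrC.
Qed.

Local Lemma limit_measure0 : limit_measure set0 = 0%E.
Proof. by rewrite limit_measureE// (@limit_val _ 0)// => n; rewrite measure0. Qed.

Local Lemma limit_measure_ge0 A : (0 <= limit_measure A)%E.
Proof. by rewrite lee_fin le_max lexx. Qed.

Local Lemma limit_finite_additive (A : (set X)^nat) n :
  (forall i, measurable (A i)) -> trivIset setT A ->
  p (\big[setU/set0]_(i < n) A i) = \sum_(i < n) p (A i).
Proof.
move=> mA tA; apply/eqP; rewrite -subr_eq0; apply/eqP/(@small_eq0 _ (n%:R + 1)).
  by rewrite addr_ge0.
move=> e e0; have [N h] := close e0.
have mU : measurable (\big[setU/set0]_(i < n) A i) by exact: bigsetU_measurable.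
have muU : fine (mu N (\big[setU/set0]_(i < n) A i)) = \sum_(i < n) fine (mu N (A i)).
  rewrite measure_bigsetU//.
  by rewrite sum_fine// => i _; exact: fin_num_measure.
have hU := h _ mU; rewrite muU in hU.
set a := p _; set b := \sum_(i < n) p (A i).
have hb : `|\sum_(i < n) fine (mu N (A i)) - b| <= n%:R * e.
  rewrite -sumrB; apply: le_trans (ler_norm_sum _ _ _) _.
  apply: le_trans (_ : \sum_(i < n) e <= _); first by apply: ler_sum => i _; exact: h.
  by rewrite sumr_const card_ord mulr_natl.
rewrite mulrDl mul1r -(subrKA (\sum_(i < n) fine (mu N (A i)))) addrC.
by apply: le_trans (ler_normD _ _) _; apply: lerD => //; rewrite distrC.
Qed.

(** An argument with three errors of [e / 3]: since [close] is uniform over measurable sets, one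
    index [N] serves the union and all its finite parts at once. *)
Local Lemma limit_sigma_additive : semi_sigma_additive limit_measure.
Proof.
move=> A mA tA mU.
rewrite (_ : (fun n => _) = (fun n => (p (\big[setU/set0]_(i < n) A i))%:E)); last first.
  apply/funext => n; rewrite limit_finite_additive// -sumEFin big_mkord.
  by apply: eq_bigr => i _; rewrite limit_measureE.
rewrite limit_measureE//; apply: cvg_EFin; first by apply: nearW.
apply/cvgrPdist_le => e e0.
have e3 : 0 < e / 3 by rewrite divr_gt0.
have [N h] := close e3.
have fm B : measurable B -> mu N B \is a fin_num by move=> mB; exact: fin_num_measure.
have : (fun n => \sum_(0 <= i < n) mu N (A i))%E @ \oo --> (fine (mu N (\bigcup_n A n)))%:E.
  by rewrite fineK; [exact: measure_semi_sigma_additive|exact: fm].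
move=> /fine_cvg/cvgrPdist_le/(_ _ e3)[n0 _ hn].
exists n0 => // n /hn/=; rewrite big_mkord -measure_bigsetU//.
have mB : measurable (\big[setU/set0]_(i < n) A i) by exact: bigsetU_measurable.
have := h _ mU; have := h _ mB; rewrite /= !ler_norml.
by move=> /andP[a1 a2] /andP[b1 b2] /andP[c1 c2]; apply/andP; split; lra.
Qed.

HB.instance Definition _ := isMeasure.Build _ _ _ limit_measure
  limit_measure0 limit_measure_ge0 limit_sigma_additive.

Local Lemma limit_measure_setT : limit_measure setT = 1%E.
Proof. by rewrite limit_measureE// (@limit_val _ 1). Qed.

HB.instance Definition _ :=
  Measure_isProbability.Build _ _ _ limit_measure limit_measure_setT.

Lemma uniform_limit_probability :
  exists pi : probability X R, forall A, measurable A -> pi A = (p A)%:E.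
Proof. by exists limit_measure; exact: limit_measureE. Qed.

End uniform_limit.

Section invariant_law.
Context {R : realType} d (X : measurableType d).
Variables (K : X -> giry X R) (mK : measurable_fun setT K).
Hypothesis K1 : forall z, (K z setT = 1)%E.
Variables (m : nat) (delta : R) (nu : giry X R).
Hypotheses (m0 : (0 < m)%N) (delta0 : 0 < delta) (delta1 : delta < 1).
Hypothesis nu1 : (nu setT = 1)%E.
Hypothesis minorization : forall z B, measurable B ->
  (delta%:E * nu B <= (iter m (markov_op K) \1_B z)%:E)%E.
Let c := doeblin_const m delta.
Let rho := doeblin_rate m delta.

Local Lemma small_rate (e : R) : 0 < e -> exists n, c * rho ^+ n <= e.
Proof.
move=> e0; have /andP[r0 r1] := doeblin_rate01 m0 delta0 delta1.
have : (fun n => c * rho ^+ n) @ \oo --> 0.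
  rewrite -(mulr0 c); apply: cvgMl_tmp; apply: cvg_expr.
  by rewrite gtr0_norm.
move=> /cvgrPdist_le/(_ _ e0)[n _ /(_ n (leqnn n))] h; exists n.
by move: h; rewrite /= sub0r normrN; apply: le_trans; exact: ler_norm.
Qed.

Let mean1 (mu : giry X R) A : measurable A -> mean mu \1_A = fine (mu A).
Proof. by move=> mA; rewrite -mean_indic. Qed.

(** The law after [n + j] steps from [nu] is the law after [n] steps from [L j]; the contraction
    thus makes [L n] Cauchy uniformly over sets. Convergence and uniqueness are the contraction
    again, applied to laws that the kernel fixes. *)
Lemma doeblin_invariant_law : exists pi : probability X R,
  [/\ forall A, measurable A -> push mK pi A = pi A,
      forall (mu : giry X R) n A, mu setT = 1%E -> measurable A ->
        `|fine (law mK n mu A) - fine (pi A)| <= c * rho ^+ n &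
      forall pi' : probability X R,
        (forall A, measurable A -> push mK pi' A = pi' A) ->
        forall A, measurable A -> pi' A = pi A].
Proof.
have contr := law_contraction mK K1 m0 delta0 delta1 nu1 minorization.
pose L n := law mK n nu.
have L1 n : L n setT = 1%E by exact: law_setT.
have cL n j A : measurable A -> `|fine (L n A) - fine (L (n + j)%N A)| <= c * rho ^+ n.
  move=> mA; have := contr n _ nu (L j) (unit_fun_indic mA) nu1 (L1 j).
  by rewrite !mean1// /L /law iterD.
have cau A : measurable A -> cvgn (fun n => fine (L n A)).
  move=> mA; apply: cauchy_cvg; apply: cauchy_exP => e e0.
  have [n hn] := small_rate (divr_gt0 e0 (ltr0Sn R 1)).
  exists (fine (L n A)); exists n => // k /= /subnKC <-.
  rewrite /ball/=; apply: le_lt_trans (cL _ _ _ mA) _; apply: le_lt_trans hn _.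
  by rewrite ltr_pdivrMr// ltr_pMr// ltr1n.
pose p A := lim (fine (L n A) @[n --> \oo]).
have Lp n A : measurable A -> `|fine (L n A) - p A| <= c * rho ^+ n.
  move=> mA; have h : (fun j => `|fine (L n A) - fine (L (n + j)%N A)|) @ \oo --> `|fine (L n A) - p A|.
    apply: cvg_norm; apply: cvgB; first exact: cvg_cst.
    under eq_fun do rewrite addnC.
    by have := cau _ mA; rewrite -(cvg_shiftn n).
  rewrite -(cvg_lim _ h)//; apply: limr_le; first by apply/cvg_ex; eexists; exact: h.
  by apply: nearW => j; exact: cL.
have [pi piE] : exists pi : probability X R, forall A, measurable A -> pi A = (p A)%:E.
  apply: (@uniform_limit_probability _ _ _ L) => //.
  move=> e e0; have [n hn] := small_rate e0; exists n => A mA.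
  exact: le_trans (Lp _ _ mA) hn.
have pi1 : pi setT = 1%E by exact: probability_setT.
have Lpi n A : measurable A -> `|fine (L n A) - fine (pi A)| <= c * rho ^+ n.
  by move=> mA; rewrite piE//; exact: Lp.
(* Closeness on sets becomes closeness of means through [mean_le_of_measure_le] with factor 1, in
   both directions. The identity between [L n.+1] and the push of [L n] then passes to the limit. *)
have inv A : measurable A -> push mK pi A = pi A.
  move=> mA; have ug : unit_fun (markov_op K \1_A : X -> R).
    by apply: unit_fun_op => //; exact: unit_fun_indic.
  have w0 n : 0 <= c * rho ^+ n.
    by apply: le_trans (Lpi n _ mA); exact: normr_ge0.
  have g1 n : `|mean pi (markov_op K \1_A) - mean (L n) (markov_op K \1_A)| <= c * rho ^+ n.
    have b01 : (0 : R) <= (1 : R) <= 1 by rewrite ler01 lexx.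
    have fm (mu : giry X R) B : measurable B -> mu B = (fine (mu B))%:E.
      by move=> mB; rewrite fineK// fin_num_measure.
    have h1 B : measurable B -> (1%:E * pi B <= L n B + (c * rho ^+ n)%:E)%E.
      move=> mB; rewrite mul1e (fm pi)// (fm (L n))// lee_fin.
      by have := Lpi n _ mB; rewrite ler_norml => /andP[]; lra.
    have h2 B : measurable B -> (1%:E * L n B <= pi B + (c * rho ^+ n)%:E)%E.
      move=> mB; rewrite mul1e (fm pi)// (fm (L n))// lee_fin.
      by have := Lpi n _ mB; rewrite ler_norml => /andP[]; lra.
    have := mean_le_of_measure_le b01 (w0 n) h1 ug.
    have := mean_le_of_measure_le b01 (w0 n) h2 ug.
    by rewrite !mul1r ler_norml => i1 i2; apply/andP; split; lra.
  apply: giry_mean_ext => //; rewrite mean_push; last exact: unit_fun_indic.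
  apply/eqP; rewrite -subr_eq0; apply/eqP/(@small_eq0 _ _ 2) => // e e0.
  have [n hn] := small_rate e0.
  have h1 := le_trans (g1 n) hn.
  have h2 : `|mean (L n.+1) \1_A - mean pi \1_A| <= e.
    rewrite !mean1//; apply: le_trans (Lpi _ _ mA) _; apply: le_trans hn.
    rewrite exprS mulrCA ler_piMl//.
    by have /andP[_ /ltW] := doeblin_rate01 m0 delta0 delta1.
  have e1 : mean (L n.+1) \1_A = mean (L n) (markov_op K \1_A).
    by rewrite -(mean_push mK)//; exact: unit_fun_indic.
  rewrite e1 in h2.
  by move: h1 h2; rewrite !ler_norml => /andP[a1 a2] /andP[b1 b2]; apply/andP; split; lra.
have lawpi (mu : giry X R) : (forall A, measurable A -> push mK mu A = mu A) ->
    forall n A, measurable A -> law mK n mu A = mu A.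
  move=> invmu; elim=> //= n IH A mA; rewrite -[RHS]invmu//.
  have mf := unit_fun_indic mA.
  apply: (giry_mean_ext (mu := push mK (law mK n mu)) (nu := push mK mu) mA).
  rewrite !mean_push//; congr fine.
  by apply: eq_measure_integral => B mB _; exact: IH.
exists pi; split => //.
- move=> mu n A mu1 mA; rewrite -(lawpi _ inv n)// -!mean1//.
  exact: contr (unit_fun_indic mA) mu1 pi1.
- move=> pi' inv' A mA.
  have pi'1 : pi' setT = 1%E by exact: probability_setT.
  apply: giry_mean_ext => //.
  apply/eqP; rewrite -subr_eq0; apply/eqP/(@small_eq0 _ _ 1) => // e e0.
  have [n hn] := small_rate e0; rewrite mul1r; apply: le_trans hn.
  rewrite !mean1// -(lawpi _ inv n)// -(lawpi _ inv' n)// -!mean1//.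
  exact: contr (unit_fun_indic mA) pi'1 pi1.
Qed.
End invariant_law.

(** * From bounds on sets to the total variation norm *)

Section total_variation.
Context {R : realType} d (X : measurableType d).

(** The positive and the negative part of a Hahn decomposition contribute at most [e] each. The
    decomposition is arbitrary because [tv_norm] picks one by choice. *)
Lemma charge_variation_prob_diff_le (mu nu : probability X R) (e : R) P N
    (H : hahn_decomposition (prob_diff mu nu) P N) :
  (forall A, measurable A -> `|fine (mu A) - fine (nu A)| <= e) ->
  (charge_variation H setT <= (2 * e)%:E)%E.
Proof.
move=> h; have [[mP _] [mN _] _ _] := H.
have dE A : measurable A -> prob_diff mu nu A = (fine (mu A) - fine (nu A))%:E.
  move=> mA; rewrite -[LHS]/(mu A + (-1)%:E * nu A)%E EFinB mulN1e.
  by rewrite !(fineK (fin_num_measure _ _ mA)).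
rewrite /charge_variation/= jordan_posE jordan_negE cjordan_posE cjordan_negE.
rewrite /crestr0 !mem_set// /crestr !setTI !dE//.
rewrite -EFinN -EFinD lee_fin mulr_natl mulr2n.
have := h _ mP; have := h _ mN; rewrite !ler_norml => /andP[a1 a2] /andP[b1 b2].
by apply: lerD => //; lra.
Qed.

Lemma tv_norm_le (mu nu : probability X R) (e : R) :
  (forall A, measurable A -> `|fine (mu A) - fine (nu A)| <= e) ->
  (tv_norm (prob_diff mu nu) <= (2 * e)%:E)%E.
Proof. exact: charge_variation_prob_diff_le. Qed.

End total_variation.

(** * The kernel of the switched chain *)

Section finite_second_component.
Context d1 (V : measurableType d1) (E : pfinType).

Lemma measurable_fun_pfin d2 (Y : measurableType d2) (f : V * E -> Y) :
  (forall i, measurable_fun setT (fun x => f (x, i))) -> measurable_fun setT f.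
Proof.
move=> mf _ B mB; rewrite setTI.
have -> : f @^-1` B = \bigcup_(i in [set: E])
    (((fun x => f (x, i)) @^-1` B) `*` [set i]).
  apply/seteqP; split => [[x i] h|[x j] [i _ [/= h ->]]//].
  by exists i.
apply: fin_bigcup_measurable => [|i _]; first exact: finite_finset.
by apply: measurableX => //; rewrite -[X in measurable X]setTI; exact: mf.
Qed.

End finite_second_component.

Section density.
Context {R : realType} d (X : measurableType d).
Variables (mu nu : {measure set X -> \bar R}) (g : X -> R).
Hypothesis mg : measurable_fun setT g.
Hypothesis g0 : forall x, 0 <= g x.
Hypothesis nuE : forall A, measurable A -> nu A = (\int[mu]_(x in A) (g x)%:E)%E.
Local Open Scope ereal_scope.
Import HBNNSimple.

Local Lemma integral_density_nnsfun (f : {nnsfun X >-> R}) :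
  \int[nu]_x (f x)%:E = \int[mu]_x ((g x)%:E * (f x)%:E).
Proof.
under [LHS]eq_integral do rewrite fimfunE -fsumEFin//.
rewrite [LHS]ge0_integral_fsum//; last 2 first.
  - by move=> r; exact/measurable_EFinP/measurableT_comp.
  - by move=> n x _; rewrite EFinM nnfun_muleindic_ge0.
under [RHS]eq_integral.
  move=> x xD; rewrite fimfunE -fsumEFin// ge0_mule_fsumr; last first.
    by move=> r; rewrite EFinM nnfun_muleindic_ge0.
  over.
rewrite [RHS]ge0_integral_fsum//; last 2 first.
  - move=> r; apply: emeasurable_funM; first exact/measurable_EFinP.
    by apply/measurable_EFinP; apply/measurableT_comp => //.
  - move=> n x _; apply: mule_ge0; first by rewrite lee_fin.
    by rewrite EFinM nnfun_muleindic_ge0.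
apply: eq_fsbigr => r; rewrite inE => -[x _ <-].
have fx0 : (0 <= f x)%R by [].
under eq_integral do rewrite EFinM.
rewrite ge0_integralZl_EFin//; last by exact/measurable_EFinP/measurable_indic.
rewrite integral_indic// setIT nuE// integral_mkcond -ge0_integralZl_EFin//.
- apply: eq_integral => y _; rewrite patchE EFinM [RHS]muleCA; congr (_ * _).
  rewrite indicE; case: ifP => _; first by rewrite mule1.
  by rewrite mule0.
- by move=> y _; rewrite patchE; case: ifP; rewrite ?lee_fin.
- apply/measurable_restrict => //; apply/measurable_funTS.
  exact/measurable_EFinP.
Qed.

(** Serves twice: for the exponential density, and for a probability restricted to an event, whose
    density is an indicator. *)
Lemma integral_density (f : X -> \bar R) : measurable_fun setT f -> (forall x, 0 <= f x) ->
  \int[nu]_x f x = \int[mu]_x ((g x)%:E * f x).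
Proof.
move=> mf f0.
pose f_ := nnsfun_approx measurableT mf.
transitivity (lim (\int[nu]_x (f_ n x)%:E @[n --> \oo])).
  rewrite -monotone_convergence//=.
  - apply: eq_integral => ? /[!inE] xD; apply/esym/cvg_lim => //=.
    exact: cvg_nnsfun_approx.
  - by move=> n; exact/measurable_EFinP/measurable_funTS.
  - by move=> n ? _; rewrite lee_fin.
  - by move=> ? _ ? ? mn; rewrite lee_fin; exact/lefP/nd_nnsfun_approx.
under eq_fun do rewrite integral_density_nnsfun.
rewrite -monotone_convergence//=.
- apply: eq_integral => x _; apply/cvg_lim => //; apply: cvgeZl => //.
  exact: cvg_nnsfun_approx.
- by move=> n; apply: emeasurable_funM; exact/measurable_EFinP.
- by move=> n x _; rewrite mule_ge0// lee_fin.
- move=> x _ m n mn; rewrite lee_wpmul2l// lee_fin//; exact/lefP/nd_nnsfun_approx.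
Qed.

End density.

Section switching_kernel.
Context {R : realType} d1 (V : measurableType d1) (E : pfinType).
Variables (Psi : E -> R -> V -> V) (q : V -> E -> E -> R) (lambda : R).
Hypothesis mPsi : forall i,
  measurable_fun setT (fun p : V * measurableTypeR R => Psi i p.2 p.1).
Hypothesis mq : forall i j, measurable_fun setT (fun x => q x i j).
Hypothesis q_ge0 : forall x i j, 0 <= q x i j.
Hypothesis q_sum : forall x i, \sum_j q x i j = 1.
Hypothesis lambda0 : 0 < lambda.
Notation Z := (V * E)%type.

(** [msum] is indexed by integers, hence this enumeration of the states; the default [point] is
    never reached for indices below [#|E|]. *)
Let state n : E := nth point (enum E) n.

Lemma sum_state (F : E -> \bar R) : (\sum_(n < #|E|) F (state n) = \sum_j F j)%E.
Proof.
by rewrite -[RHS]big_enum/= (big_nth point) big_mkord -cardE.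
Qed.

Let jump_term (z : Z) (n : nat) : {measure set Z -> \bar R} :=
  mscale (NngNum (q_ge0 z.1 z.2 (state n))) (dirac (z.1, state n)).

Definition jump (z : Z) : set Z -> \bar R := msum (jump_term z) #|E|.

HB.instance Definition _ z := Measure.on (jump z).

Lemma jumpE z A : (jump z A = \sum_j (q z.1 z.2 j)%:E * \d_(z.1, j) A)%E.
Proof. by rewrite -sum_state. Qed.

Local Lemma jump_setT z : (jump z setT <= 1)%E.
Proof.
rewrite jumpE (eq_bigr (fun j => (q z.1 z.2 j)%:E)) => [|j _].
  by rewrite sumEFin q_sum.
by rewrite diracT mule1.
Qed.

HB.instance Definition _ z :=
  Measure_isSubProbability.Build _ _ _ (jump z) (jump_setT z).

Definition jump_kernel (z : Z) : giry Z R := jump z.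

Lemma measurable_jump_kernel : measurable_fun setT jump_kernel.
Proof.
apply: measurable_giry_codensity => // B mB.
apply: measurable_fun_pfin => i.
apply: (eq_measurable_fun (fun x => \sum_j (q x i j)%:E * (\1_B (x, j))%:E)%E).
  by move=> x _; rewrite /= -[RHS]/(jump (x, i) B) jumpE.
apply: emeasurable_sum => j; apply: emeasurable_funM.
  by apply/measurable_EFinP; exact: mq.
apply/measurable_EFinP; apply: (measurableT_comp (measurable_indic mB)).
exact: pair2_measurable.
Qed.

Lemma jump_integral z (f : Z -> \bar R) : measurable_fun setT f -> (forall x, 0 <= f x)%E ->
  (\int[jump_kernel z]_x f x = \sum_j (q z.1 z.2 j)%:E * f (z.1, j))%E.
Proof.
move=> mf f0; rewrite -[LHS]/(\int[msum (jump_term z) #|E|]_x f x)%E.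
rewrite ge0_integral_measure_sum// -sum_state; apply: eq_bigr => n _.
by rewrite ge0_integral_mscale//= integral_dirac// diracT mul1e.
Qed.

Let flow_map (p : Z * measurableTypeR R) : Z := (Psi p.1.2 p.2 p.1.1, p.1.2).

Lemma measurable_flow_map : measurable_fun setT flow_map.
Proof.
apply: measurable_fun_pair; last exact: (measurableT_comp measurable_snd measurable_fst).
pose g (p : (V * measurableTypeR R) * E) := Psi p.2 p.1.2 p.1.1.
have mg : measurable_fun setT g by apply: measurable_fun_pfin => i; exact: mPsi.
apply: (measurableT_comp mg (g := fun p : Z * measurableTypeR R => ((p.1.1, p.2), p.1.2))).
apply: measurable_fun_pair; last exact: (measurableT_comp measurable_snd measurable_fst).
apply: measurable_fun_pair; last exact: measurable_snd.
exact: (measurableT_comp measurable_fst measurable_fst).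
Qed.

Definition exponential_law : probability (measurableTypeR R) R :=
  exponential_distribution_exponential_prob__canonical__probability_measure_Probability
    lambda0.

(** Written with the operations of the Giry monad, so that measurability in the starting point
    follows by composition. *)
Definition switching_kernel (z : Z) : giry Z R :=
  giry_bind (giry_map measurable_flow_map (giry_prod (giry_ret z, exponential_law : giry _ R)))
    measurable_jump_kernel.

Lemma measurable_switching_kernel : measurable_fun setT switching_kernel.
Proof.
have h1 := measurable_giry_bind (R := R) measurable_jump_kernel.
have h2 := measurable_giry_map (R := R) measurable_flow_map.
apply: (measurableT_comp (measurableT_comp h1 h2)).
apply: (measurableT_comp measurable_giry_prod).
by apply: measurable_fun_pair => //; exact: measurable_giry_ret.
Qed.

Lemma switching_kernel_integral z (f : Z -> \bar R) :
  measurable_fun setT f -> (forall x, 0 <= f x)%E ->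
  (\int[switching_kernel z]_x f x =
   \int[exponential_law]_t \sum_j (q (Psi z.2 t z.1) z.2 j)%:E * f (Psi z.2 t z.1, j))%E.
Proof.
move=> mf f0.
pose g y := (\int[jump_kernel y]_x f x)%E.
have g0 y : (0 <= g y)%E by exact: integral_ge0.
have mg : measurable_fun setT g.
  exact: (measurableT_comp (measurable_giry_int mf f0) measurable_jump_kernel).
have mgf : measurable_fun setT (g \o flow_map).
  exact: (measurableT_comp mg measurable_flow_map).
rewrite -[LHS]/(giry_int (switching_kernel z) f) giry_int_bind// giry_int_map//.
apply: etrans (giry_int_prod2 _ _ mgf (fun p => g0 _)) _.
apply: eq_integral => t _.
rewrite giry_int_ret; first exact: jump_integral.
exact: (measurableT_comp mgf (pair2_measurable t)).
Qed.

Lemma switching_kernel_setT z : (switching_kernel z setT = 1)%E.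
Proof.
rewrite -[LHS]mul1e -integral_cst// switching_kernel_integral//.
rewrite (eq_integral (cst 1%E)) ?integral_cst//.
  by rewrite -[X in (_ * X)%E]/(exponential_law setT) probability_setT mule1.
move=> t _; rewrite (eq_bigr (fun j => (q (Psi z.2 t z.1) z.2 j)%:E)) => [|j _].
  by rewrite sumEFin q_sum.
by rewrite mule1.
Qed.

End switching_kernel.

Section exponential_law.
Context {R : realType}.
Variables (lambda : R) (lambda0 : 0 < lambda).
Local Open Scope ereal_scope.

Lemma exponential_law_integral (f : measurableTypeR R -> \bar R) :
  measurable_fun setT f -> (forall x, 0 <= f x) ->
  \int[exponential_law lambda0]_t f t =
  \int[lebesgue_measure]_(t in `[0%R, +oo[) ((exponential_pdf lambda t)%:E * f t).
Proof.
move=> mf f0; have mg := measurable_exponential_pdf lambda.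
have g0 x : (0 <= exponential_pdf lambda x)%R by apply: exponential_pdf_ge0; exact: ltW.
rewrite (@integral_density _ _ (measurableTypeR R) lebesgue_measure (exponential_law lambda0) _ mg g0)//.
rewrite [RHS]integral_mkcond; apply: eq_integral => t _; rewrite patchE.
case: ifPn => // /negP; rewrite inE/= in_itv/= andbT => /negP; rewrite -ltNge => t0.
by rewrite lt0_exponential_pdf// mul0e.
Qed.

End exponential_law.

Section continuous_borel.
Context {R : realType}.

Lemma continuous_measurable_rV m n (f : 'rV[R]_m -> 'rV[R]_n) :
  continuous f -> measurable_fun setT f.
Proof.
move=> cf; apply: (@measurability _ _ _ _ setT f (@open 'rV[R]_n)); first by [].
move=> _ [A oA <-]; rewrite setTI; apply: measurable_open_rV.
by apply: open_comp => // x _; exact: cf.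
Qed.

Lemma measurable_closed_rV n (A : set 'rV[R]_n) : closed A -> measurable A.
Proof.
by rewrite -openC => /measurable_open_rV mA; rewrite -[A]setCK; exact: measurableC.
Qed.

End continuous_borel.

Section flow_continuity.
Context {R : realType} {n : nat}.
Variables (f : 'rV[R]_n -> 'rV[R]_n) (phi : R -> 'rV[R]_n -> 'rV[R]_n) (K : R).
Hypotheses (Cf : is_Ck 2 f) (fK : forall x, `|f x| <= K) (fl : is_flow f phi).

Lemma flow_near t0 x0 (e : R) : 0 < e -> exists2 d, 0 < d &
  forall t x, `|t - t0| <= d -> `|x - x0| <= d -> `|phi t x - phi t0 x0| <= e.
Proof.
move=> e0; have K0 : 0 <= K by apply: le_trans (fK x0).
have [C C0 hC] := flow_space_lipschitz Cf fK fl (`|t0|) (`|x0| + 1).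
have [d [d0 d1 dle]] := small_multiple (addr_ge0 K0 C0) e0.
exists d => // t x ht hx.
rewrite -(subrK (phi t0 x) (phi t x)) -addrA; apply: le_trans (ler_normD _ _) _.
apply: le_trans dle; rewrite mulrDr; apply: lerD.
  by apply: le_trans (flow_time_lipschitz fl fK _ _ _) _; rewrite mulrC ler_wpM2r.
rewrite mulrC; apply: le_trans (hC _ _ _ _ _ _) _ => //; last 2 first.
- by rewrite lerDl.
- by rewrite ler_wpM2l.
- rewrite -(subrK x0 x); apply: le_trans (ler_normD _ _) _; rewrite addrC lerD2l.
  exact: le_trans hx d1.
Qed.

(** Time and position are packed into one row vector, where continuity gives Borel measurability,
    and [cons_time] transports this to the product sigma-algebra. The absolute value defines the
    flow map for every real time while using nonnegative durations only, for which the region is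
    invariant. *)
Lemma measurable_flow :
  measurable_fun setT (fun p : 'rV[R]_n * measurableTypeR R => phi `|p.2 : R| p.1).
Proof.
pose g (u : 'rV[R]_(1 + n)) : 'rV[R]_n := phi `|u ord0 ord0| (rsubmx u).
have cg : continuous g.
  move=> u; have fu : Filter (nbhs u) by exact: nbhs_filter.
  apply: (@cvgrPdist_le _ _ _ (nbhs u) fu _ _).2 => e e0.
  have [d d0 hd] := flow_near `|u ord0 ord0| (rsubmx u) e0.
  apply/nbhs_ballP; exists d => //= v; rewrite -ball_normE /= distrC => /ltW uv.
  rewrite distrC.
  apply: hd; last by rewrite -linearB; exact: le_trans (norm_rsubmx _) uv.
  apply: le_trans (ler_dist_dist _ _) _; apply: le_trans uv.
  by have := coord_le_norm (v - u) ord0; rewrite !mxE.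
have -> : (fun p : 'rV[R]_n * measurableTypeR R => phi `|p.2 : R| p.1) =
    g \o (fun p => cons_time (p.2, p.1)).
  by apply/funext => p; rewrite /g/= /cons_time row_mx_ord0 row_mxKr.
apply: (measurableT_comp (continuous_measurable_rV cg)).
apply: (measurableT_comp (@measurable_cons_time _ n)).
by apply: measurable_fun_pair; [exact: measurable_snd|exact: measurable_fst].
Qed.

End flow_continuity.

(** * Extension of the chain outside the region *)

Section retraction.
Context {R : realType} {n : nat}.
Variables (M : set 'rV[R]_n) (x0 : 'rV[R]_n).
Hypotheses (M_closed : closed M) (Mx0 : M x0).

Definition retract x := if x \in M then x else x0.

Lemma retract_in x : M (retract x).
Proof. by rewrite /retract; case: ifPn => //; rewrite inE. Qed.

Lemma retract_id x : M x -> retract x = x.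
Proof. by move=> Mx; rewrite /retract mem_set. Qed.

Local Lemma measurable_retraction_comp d (Y : measurableType d) (g : 'rV[R]_n -> Y) :
  measurable_fun M g -> measurable_fun setT (g \o retract).
Proof.
move=> mg; have mM := measurable_closed_rV M_closed.
have -> : g \o retract = fun x => if x \in M then g x else g x0.
  by apply/funext => x; rewrite /retract /=; case: ifP.
apply: measurable_fun_if => //.
- apply: (@measurable_fun_bool _ _ _ _ true); rewrite setTI.
  by rewrite (_ : _ @^-1` _ = M)//; apply/seteqP; split => x /=; [move/set_mem|move/mem_set].
- by apply: measurable_funS mg => // x [_] /= /set_mem.
Qed.

Lemma measurable_retract : measurable_fun setT retract.
Proof. exact: (measurable_retraction_comp (g := id)). Qed.

Lemma measurable_comp_retract (g : 'rV[R]_n -> R) :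
  {within M, continuous g} -> measurable_fun setT (g \o retract).
Proof.
move=> cg; apply: measurable_retraction_comp => mM.
apply: (measurability _ (RGenOpens.measurableE R)) => // _ [_ [a [b ->] <-]].
have /continuousP/(_ _ (interval_open (a := BRight a) (b := BLeft b) isT isT))/open_subspaceP[U Uopen UM] := cg.
rewrite setIC -UM; apply: measurableI => //; exact: measurable_open_rV.
Qed.

End retraction.

(* The data of the theorem, to which a uniform bound on the fields and a base
   point of the region are added. *)
Record switched_flow (R : realType) (n : nat) (E : pfinType) := SwitchedFlow {
  field : E -> 'rV[R]_n -> 'rV[R]_n;
  flow : E -> R -> 'rV[R]_n -> 'rV[R]_n;
  region : set 'rV[R]_n;
  rate : 'rV[R]_n -> E -> E -> R;
  clock : R;
  bound : R;
  base : 'rV[R]_n;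
  field_smooth : forall i, smooth (field i);
  field_le : forall i x, `|field i x| <= bound;
  flowP : forall i, is_flow (field i) (flow i);
  region_compact : compact region;
  base_in : region base;
  region_invariant : forall i (t : R) x, 0 <= t -> region x -> region (flow i t x);
  rate_continuous : forall i j, {within region, continuous (fun x => rate x i j)};
  rate_ge0 : forall x i j, region x -> i != j -> 0 <= rate x i j;
  rate_irreducible : forall x, region x -> forall i j, connect (fun k l => 0 < rate x k l) i j;
  clock_gt : forall x i, region x -> \sum_(j | j != i) rate x i j < clock }.

Section switched_kernel.
Context {R : realType} {n : nat} {E : pfinType} (S : switched_flow R n E).
Notation V := 'rV[R]_n.
Notation Z := (V * E)%type.
Notation M := (region S).

Lemma clock0 : 0 < clock S.
Proof.
apply: le_lt_trans (clock_gt point (base_in S)).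
by apply: sumr_ge0 => j ji; apply: rate_ge0 (base_in S) _; rewrite eq_sym.
Qed.

Lemma region_closed : closed M.
Proof. by apply: compact_closed; [exact: norm_hausdorff|exact: region_compact]. Qed.

Definition jumpq := jump_matrix (rate S) (clock S).

Lemma jumpq_ge0 x i j : M x -> 0 <= jumpq x i j.
Proof.
move=> Mx; rewrite /jumpq /jump_matrix; have c0 := clock0.
case: eqVneq => [_|ij]; last by rewrite divr_ge0 ?(ltW c0)//; exact: rate_ge0.
rewrite -mulr_suml subr_ge0 ler_pdivrMr// mul1r; exact/ltW/clock_gt.
Qed.

Lemma jumpq_refl x i : M x -> 0 < jumpq x i i.
Proof.
move=> Mx; rewrite /jumpq /jump_matrix eqxx -mulr_suml subr_gt0 ltr_pdivrMr ?mul1r ?clock0//.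
exact: clock_gt.
Qed.

Lemma jumpq_connect x i j : M x -> connect (fun k l => 0 < jumpq x k l) i j.
Proof.
move=> Mx; apply: connect_sub (rate_irreducible Mx i j) => k l kl.
apply: connect1; have [->|neq] := eqVneq k l; first exact: jumpq_refl.
by rewrite /jumpq /jump_matrix (negPf neq) divr_gt0// clock0.
Qed.

Lemma jumpq_sum x i : \sum_j jumpq x i j = 1.
Proof.
rewrite (bigD1 i)//= /jumpq {1}/jump_matrix eqxx.
rewrite [X in _ + X](eq_bigr (fun j => rate S x i j / clock S)) ?subrK// => j ji.
by rewrite /jump_matrix eq_sym (negPf ji).
Qed.

Lemma jumpq_continuous i j : {within M, continuous (fun x => jumpq x i j)}.
Proof.
rewrite /jumpq /jump_matrix; case: eqVneq => _ x; last first.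
  by apply: cvgMr_tmp; exact: rate_continuous.
apply: cvgB; first exact: cvg_cst.
apply: cvg_big => [|k _]; first exact: add_continuous.
by apply: cvgMr_tmp; exact: rate_continuous.
Qed.

Definition retr := retract M (base S).

Lemma retr_in x : M (retr x).
Proof. exact: retract_in (base_in S) x. Qed.

Lemma retr_id x : M x -> retr x = x.
Proof. exact: retract_id. Qed.

(* The kernel is made total by retracting the space onto the region; outside it,
   the chain behaves as if started from the base point. *)
Definition retract_flow i (t : R) x := flow S i `|t| (retr x).

Definition retract_jump x i j := jumpq (retr x) i j.

Lemma measurable_retract_flow i :
  measurable_fun setT (fun p : V * measurableTypeR R => retract_flow i p.2 p.1).
Proof.
have mf := measurable_flow (field_smooth S i 2) (field_le S i) (flowP S i).
apply: (measurableT_comp mf (g := fun p : V * measurableTypeR R => (retr p.1, p.2))).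
apply: measurable_fun_pair; last exact: measurable_snd.
exact: (measurableT_comp (measurable_retract (base S) region_closed) measurable_fst).
Qed.

Lemma measurable_retract_jump i j : measurable_fun setT (fun x => retract_jump x i j).
Proof. exact: (measurable_comp_retract (base S) region_closed (@jumpq_continuous i j)). Qed.

Lemma retract_jump_ge0 x i j : 0 <= retract_jump x i j.
Proof. exact/jumpq_ge0/retr_in. Qed.

Lemma retract_jump_sum x i : \sum_j retract_jump x i j = 1.
Proof. exact: jumpq_sum. Qed.

Definition clock_law := exponential_law clock0.

Definition kernel : Z -> giry Z R :=
  switching_kernel measurable_retract_flow measurable_retract_jump
    retract_jump_ge0 retract_jump_sum clock0.

Lemma measurable_kernel : measurable_fun setT kernel.
Proof. exact: measurable_switching_kernel. Qed.

Lemma kernel_setT z : (kernel z setT = 1)%E.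
Proof. exact: switching_kernel_setT. Qed.

Lemma retract_flow_in i t x : M (retract_flow i t x).
Proof. by apply: region_invariant => //; exact: retr_in. Qed.

Lemma retr_flow i t x : retr (retract_flow i t x) = retract_flow i t x.
Proof. exact/retr_id/retract_flow_in. Qed.

Lemma kernel_integral z (f : Z -> \bar R) :
  measurable_fun setT f -> (forall x, 0 <= f x)%E ->
  (\int[kernel z]_x f x = \int[clock_law]_t \sum_j
    (jumpq (retract_flow z.2 t z.1) z.2 j)%:E * f (retract_flow z.2 t z.1, j))%E.
Proof.
move=> mf f0; rewrite [LHS]switching_kernel_integral//; apply: eq_integral => t _.
by apply: eq_bigr => j _; rewrite /retract_jump retr_flow.
Qed.

Definition op : (Z -> R) -> Z -> R := markov_op kernel.

Lemma measurable_one_step z (f : Z -> R) : measurable_fun setT f ->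
  measurable_fun setT (fun t : measurableTypeR R => \sum_j
    jumpq (retract_flow z.2 t z.1) z.2 j * f (retract_flow z.2 t z.1, j)).
Proof.
move=> mf.
have mt : measurable_fun setT (fun t : measurableTypeR R => retract_flow z.2 t z.1).
  exact: (measurableT_comp (measurable_retract_flow z.2) (pair1_measurable z.1)).
apply: measurable_sum => j; apply: measurable_funM.
  under eq_fun do rewrite -retr_flow.
  exact: (measurableT_comp (measurable_retract_jump z.2 j) mt).
exact: (measurableT_comp mf (measurableT_comp (pair2_measurable j) mt)).
Qed.

Lemma opE f z : unit_fun f -> ((op f z)%:E = \int[clock_law]_t (\sum_j
    jumpq (retract_flow z.2 t z.1) z.2 j * f (retract_flow z.2 t z.1, j))%:E)%E.
Proof.
move=> uf; have [mf f01] := uf; rewrite -meanE// kernel_integral.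
- by apply: eq_integral => t _; rewrite -sumEFin.
- exact/measurable_EFinP.
- by move=> x; rewrite lee_fin; case/andP: (f01 x).
Qed.

Lemma kernel_transition z A : measurable A -> state_space M z ->
  kernel z A = transition (flow S) (rate S) (clock S) z A.
Proof.
move=> mA [Mz _].
rewrite -[LHS]mean_indic// [LHS]opE; last exact: unit_fun_indic.
rewrite exponential_law_integral.
- apply: eq_integral => t; rewrite inE/= in_itv/= andbT => t0.
  by rewrite -EFinM /retract_flow ger0_norm// retr_id.
- by apply/measurable_EFinP; exact: (measurable_one_step z (measurable_indic mA)).
- move=> t; rewrite lee_fin; apply: sumr_ge0 => j _; rewrite mulr_ge0//.
  exact/jumpq_ge0/retract_flow_in.
Qed.

End switched_kernel.

(** * Reachability *)

(** Compactness as a near covering property, with the filter at infinity on [nat]: monotonicity in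
    [k] makes each local statement hold for all large indices. *)
Lemma uniform_on_compact {R : realType} {n : nat} (M : set 'rV[R]_n) (Q : nat -> 'rV[R]_n -> Prop) :
  compact M -> (forall k l y, (k <= l)%N -> M y -> Q k y -> Q l y) ->
  (forall x, M x -> exists k e, 0 < e /\ forall y, M y -> `|y - x| <= e -> Q k y) ->
  exists k, forall y, M y -> Q k y.
Proof.
move=> /compact_near_coveringP cM Qmono Qloc.
have [x Mx|k _ hk] := cM nat \oo (fun k y => M y -> Q k y) _.
  have [k [e [e0 h]]] := Qloc x Mx.
  exists ([set y | `|y - x| <= e], [set l | (k <= l)%N]).
    split=> /=; last by exists k.
    by apply/nbhs_ballP; exists e => //= y; rewrite -ball_normE /= distrC; exact: ltW.
  by move=> [y l] [/= ye kl] My; exact: (Qmono _ _ _ kl My (h _ My ye)).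
by exists k => y My; exact: (hk k (leqnn k) y My My).
Qed.

Lemma uniform_radius {R : realType} (E : finType) (P : E -> R -> Prop) :
  (forall i e e', 0 < e' -> e' <= e -> P i e -> P i e') ->
  (forall i, exists2 e, 0 < e & P i e) -> exists2 e, 0 < e & forall i, P i e.
Proof.
move=> Pmono h.
have /choice[e he] : forall i, exists e, 0 < e /\ P i e by move=> i; have [e] := h i; exists e.
have m0 : 0 < \big[Num.min/1]_i e i by apply: lt_bigmin => // i _; case: (he i).
exists (\big[Num.min/1]_i e i) => // i; have [ei0 Pi] := he i.
by apply: Pmono m0 _ Pi; exact: bigmin_le.
Qed.

Section reachability.
Context {R : realType} {n : nat} {E : pfinType} (S : switched_flow R n E).
Notation V := 'rV[R]_n.
Notation Z := (V * E)%type.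
Notation M := (region S).
Notation T := (op S).

Definition clock_mass (a b : R) : R := fine (clock_law S `[a, b]%classic).

Lemma clock_mass_gt0 a b : 0 <= a -> a < b -> 0 < clock_mass a b.
Proof.
move=> a0 ab; have c0 := clock0 S.
have h : ((clock S * expR (- clock S * b) * (b - a))%:E <= clock_law S `[a, b]%classic)%E.
  rewrite /clock_law /= /exponential_prob.
  apply: (@le_trans _ _ (\int[lebesgue_measure]_(x in `[a, b]%classic)
      (clock S * expR (- clock S * b))%:E)%E).
    by rewrite integral_cst//= lebesgue_measure_itv/= lte_fin ab.
  apply: ge0_le_integral => //=.
  - by move=> x _; rewrite lee_fin mulr_ge0 ?expR_ge0// ltW.
  - by apply/measurable_EFinP/measurable_funTS; exact: measurable_exponential_pdf.
  - move=> x; rewrite in_itv/= => /andP[ax xb].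
    rewrite exponential_pdfE ?(le_trans a0 ax)// lee_fin ler_wpM2l ?(ltW c0)//.
    by rewrite ler_expR !mulNr lerN2 ler_wpM2l// ltW.
rewrite -lte_fin /clock_mass fineK ?fin_num_measure//; apply: lt_le_trans h.
by rewrite lte_fin !mulr_gt0 ?expR_gt0// subr_gt0.
Qed.

Lemma op_ge_itv f z a b (k : R) : unit_fun f -> 0 <= k ->
  (forall t, a <= t <= b -> k <= \sum_j
    jumpq S (retract_flow S z.2 t z.1) z.2 j * f (retract_flow S z.2 t z.1, j)) ->
  k * clock_mass a b <= T f z.
Proof.
move=> uf k0 h; rewrite -lee_fin opE// EFinM fineK ?fin_num_measure//.
have -> : (k%:E * clock_law S `[a, b]%classic = \int[clock_law S]_(t in `[a, b]%classic) k%:E)%E.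
  by rewrite integral_cst.
have g0 t : 0 <= \sum_j jumpq S (retract_flow S z.2 t z.1) z.2 j * f (retract_flow S z.2 t z.1, j).
  apply: sumr_ge0 => j _; rewrite mulr_ge0//; first exact/jumpq_ge0/retract_flow_in.
  by case/andP: (uf.2 (retract_flow S z.2 t z.1, j)).
have mg := measurable_one_step S z uf.1.
apply: (@le_trans _ _ (\int[clock_law S]_(t in `[a, b]%classic) (\sum_j
   jumpq S (retract_flow S z.2 t z.1) z.2 j * f (retract_flow S z.2 t z.1, j))%:E)%E).
  by apply: ge0_le_integral => //=; apply/measurable_EFinP/measurable_funTS.
apply: ge0_subset_integral => //=; first exact/measurable_EFinP.
by move=> t _; rewrite lee_fin.
Qed.

(** A single duration has probability zero, so positivity at one point would not survive an
    application of [op]; a lower bound on a neighbourhood does. *)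
Definition positive_near (f : Z -> R) (z : Z) := exists e c : R, [/\ 0 < e, 0 < c &
  forall x, M x -> `|x - z.1| <= e -> c <= f (x, z.2)].

Lemma jumpq_near x i j (c : R) : M x -> c < jumpq S x i j ->
  exists2 e, 0 < e & forall y, M y -> `|y - x| <= e -> c <= jumpq S y i j.
Proof.
move=> Mx cx.
have : (fun y => jumpq S y i j) @ within M (nbhs x) --> jumpq S x i j.
  by rewrite (nbhs_subspace_in Mx); exact: jumpq_continuous.
have Fx : Filter (within M (nbhs x)) by exact: within_filter.
rewrite -subr_gt0 in cx.
move=> /(@cvgrPdist_le _ _ _ (within M (nbhs x)) Fx _ _).1/(_ _ cx)/nbhs_ballP[e /= e0 he].
have e20 : 0 < e / 2 by rewrite divr_gt0.
exists (e / 2) => // y My yx.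
have : ball x e y.
  rewrite -ball_normE /= distrC; apply: le_lt_trans yx _.
  by rewrite ltr_pdivrMr// ltr_pMr// ltr1n.
by move=> /he/(_ My); rewrite ler_norml => /andP[]; lra.
Qed.

(** One [d] bounds both the displacement of the starting point and the excess of the duration. The
    durations are taken in the interval from [t] to [t + d], to the right of [t], so that [t = 0] is
    allowed. *)
Lemma positive_near_step f i j t x : unit_fun f -> M x -> 0 <= t ->
  0 < jumpq S (flow S i t x) i j -> positive_near f (flow S i t x, j) ->
  positive_near (T f) (x, i).
Proof.
move=> uf Mx t0 qp [e [c [e0 c0 h]]].
set y := flow S i t x in qp h.
have My : M y by exact: region_invariant.
have q2 : jumpq S y i j / 2 < jumpq S y i j by rewrite ltr_pdivrMr// ltr_pMr// ltr1n.
have [e2 e20 hq] := jumpq_near My q2.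
have em0 : 0 < Num.min e e2 by rewrite lt_min e0.
have [d d0 hd] := flow_near (field_smooth S i 2) (field_le S i) (flowP S i) t x em0.
have td : t < t + d by rewrite ltrDl.
have q20 : 0 < jumpq S y i j / 2 by rewrite divr_gt0.
exists d, (jumpq S y i j / 2 * c * clock_mass t (t + d)).
split=> //; first by rewrite !mulr_gt0// clock_mass_gt0.
move=> x' Mx' /= xx'; apply: op_ge_itv => //; first by rewrite mulr_ge0 ?ltW.
move=> s /andP[ts sd] /=.
have s0 : 0 <= s by exact: le_trans ts.
rewrite /retract_flow ger0_norm// retr_id//.
have Ms : M (flow S i s x') by exact: region_invariant.
have : `|flow S i s x' - y| <= Num.min e e2.
  by apply: hd => //; rewrite ger0_norm ?subr_ge0// lerBlDl.
rewrite le_min => /andP[s1 s2].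
rewrite (bigD1 j)//=; apply: le_trans (_ : jumpq S (flow S i s x') i j * f (flow S i s x', j) <= _).
  by apply: ler_pM; rewrite ?(ltW q20) ?(ltW c0)//; [exact: hq|exact: h].
rewrite lerDl; apply: sumr_ge0 => k _; rewrite mulr_ge0 ?jumpq_ge0//.
by case/andP: (uf.2 (flow S i s x', k)).
Qed.

Lemma flow0 i x : flow S i 0 x = x.
Proof. by case: (flowP S i x). Qed.

Lemma positive_near_op f i j x : unit_fun f -> M x -> 0 < jumpq S x i j ->
  positive_near f (x, j) -> positive_near (T f) (x, i).
Proof.
by move=> uf Mx qp h; apply: (@positive_near_step f i j 0); rewrite ?flow0.
Qed.

Lemma unit_fun_op_iter k f : unit_fun f -> unit_fun (iter k T f).
Proof. by move=> uf; apply: unit_fun_iter => //; [exact: measurable_kernel|exact: kernel_setT]. Qed.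

(** Waiting is possible: short durations and jumps from a state to itself have positive probability.
    Points and states that need different numbers of steps can thus share one. *)
Lemma positive_near_iter k l f z : unit_fun f -> M z.1 -> (k <= l)%N ->
  positive_near (iter k T f) z -> positive_near (iter l T f) z.
Proof.
move=> uf Mz /subnK <- h; elim: (l - k)%N => //= {}l IH.
by case: z Mz h IH => x i /= Mx _ IH; apply: (@positive_near_op _ i i) => //;
  [exact: unit_fun_op_iter|exact: jumpq_refl].
Qed.

Lemma positive_near_connect f i j x : unit_fun f -> M x -> positive_near f (x, j) ->
  exists k, positive_near (iter k T f) (x, i).
Proof.
move=> uf Mx hj; have /connectP[s ps js] := jumpq_connect i j Mx.
elim: s i ps js => [|l s IH] i /=; first by move=> _ <-; exists 0%N.
move=> /andP[il ps] js; have [k hk] := IH _ ps js; exists k.+1 => /=.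
by apply: positive_near_op hk => //; exact: unit_fun_op_iter.
Qed.

(** The orbit is followed backwards from its end point: for each piece, first switch to its state,
    then undo its flow. A switch may take several jumps, so the number of steps is not the number of
    pieces. *)
Lemma positive_near_orbit f j x y k0 : unit_fun f -> M x ->
  positive_orbit (flow S) x y -> positive_near f (y, j) ->
  exists k, positive_near (iter k T f) (x, k0).
Proof.
move=> uf Mx [m [i [u [_ u0 ->]]]].
have Mc l : M (composite_flow (flow S) i u l x).
  by elim: l => //= l IH; exact: region_invariant.
elim: m j f uf => [|m IH] j f uf /= h; first exact: positive_near_connect h.
have [k hk] := positive_near_connect (i m) uf (Mc m.+1) h.
have ufk := unit_fun_op_iter k uf.
have h1 : positive_near (T (iter k T f)) (composite_flow (flow S) i u m x, i m).
  by apply: (positive_near_step ufk (Mc m) (u0 _) _ hk); exact/jumpq_refl/(Mc m.+1).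
have [l hl] := IH _ _ (unit_fun_op_iter k.+1 uf) h1.
by exists (l + k.+1)%N; rewrite iterD.
Qed.

Lemma op_ge_region f (c : R) z : unit_fun f -> 0 <= c ->
  (forall y j, M y -> c <= f (y, j)) -> c <= T f z.
Proof.
move=> uf c0 h; rewrite -lee_fin opE//.
rewrite -[leLHS]mule1 -(probability_setT (clock_law S)) -integral_cst//.
apply: ge0_le_integral => //=.
- by apply/measurable_EFinP; exact: (measurable_one_step S z uf.1).
- move=> t _; rewrite lee_fin -[leLHS]mul1r -(jumpq_sum S (retract_flow S z.2 t z.1) z.2).
  rewrite mulr_suml; apply: ler_sum => j _; apply: ler_wpM2l; last exact/h/retract_flow_in.
  exact/jumpq_ge0/retract_flow_in.
Qed.

Theorem uniform_reachability f (p : V) (j0 : E) (r : R) : unit_fun f -> 0 < r ->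
  accessible_set (flow S) M p ->
  (forall y, M y -> `|y - p| <= r -> positive_near f (y, j0)) ->
  exists k (c : R), 0 < c /\ forall z, c <= iter k T f z.
Proof.
move=> uf r0 pacc hf.
have reach x i : M x -> exists k, positive_near (iter k T f) (x, i).
  move=> Mx; have [y [oy yp]] := pacc x Mx _ (nbhsx_ballx p _ r0).
  have My : M y.
    move: oy => [m [s [u [_ u0 ->]]]].
    by elim: m => //= m IH; exact: region_invariant.
  apply: (positive_near_orbit i uf Mx oy (hf y My _)).
  by move: yp; rewrite -ball_normE /= distrC => /ltW.
(* A first use of compactness fixes the number of steps. *)
have [||k hk] := uniform_on_compact (@region_compact _ _ _ S)
    (Q := fun k x => forall i, positive_near (iter k T f) (x, i)).
- by move=> k l y kl My h i; apply: positive_near_iter kl (h i).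
- move=> x Mx; have /choice[K hK] := fun i => reach x i Mx.
  pose k := \max_i K i.
  have hk i : positive_near (iter k T f) (x, i).
    by apply: positive_near_iter (hK i) => //; rewrite /k leq_bigmax.
  have [e e0 he] : exists2 e : R, 0 < e & forall i y, M y -> `|y - x| <= e -> positive_near (iter k T f) (y, i).
    apply: uniform_radius => [i a b _ ba h y My yb|i]; first by apply: h => //; exact: le_trans ba.
    have [a [c [a0 c0 h]]] := hk i; have a20 : 0 < a / 2 by rewrite divr_gt0.
    exists (a / 2) => // y My ya; exists (a / 2), c; split=> //= z Mz za; apply: h => //=.
    by rewrite -(subrKA y) (splitr a); apply: le_trans (ler_normD _ _) _; exact: lerD.
  by exists k, e; split=> // y My yx i; exact: he.
(* A second use, with the number of steps fixed, makes the lower bound uniform. *)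
have [||m hm] := uniform_on_compact (@region_compact _ _ _ S)
    (Q := fun m x => forall i, m.+1%:R^-1 <= iter k T f (x, i)).
- move=> a b y ab My h i; apply: le_trans (h i).
  by rewrite lef_pV2 ?posrE// ler_nat.
- move=> x Mx.
  have [c c0 hc] : exists2 c : R, 0 < c & forall i, exists2 e, 0 < e &
      forall y, M y -> `|y - x| <= e -> c <= iter k T f (y, i).
    apply: uniform_radius => [i a b _ ba [e e0 h]|i].
      by exists e => // y My ye; apply: le_trans ba _; exact: h.
    by have [e [c [e0 c0 h]]] := hk x Mx i; exists c => //; exists e.
  have [e e0 he] : exists2 e : R, 0 < e & forall i y, M y -> `|y - x| <= e -> c <= iter k T f (y, i).
    apply: uniform_radius => [i a b _ ba h y My yb|]; last exact: hc.
    by apply: h => //; exact: le_trans ba.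
  have /cvgrPdist_lt/(_ _ c0)[m _ /(_ m (leqnn m))] := @cvg_harmonic R.
  rewrite /= sub0r normrN ger0_norm// => /ltW mc.
  by exists m, e; split=> // y My ye i; apply: le_trans mc _; exact: he.
(* One more step lands in the region from any state, so the bound extends from the region to the
   whole space. *)
exists k.+1, m.+1%:R^-1; split; first by rewrite invr_gt0.
by move=> z; apply: op_ge_region => [||y j My]; rewrite ?invr_ge0//; [exact: unit_fun_op_iter|exact: hm].
Qed.

End reachability.

(** * Minorization along a word *)

Section word_minorization.
Context {R : realType} {n : nat} {E : pfinType} (S : switched_flow R n E).
Notation V := 'rV[R]_n.
Notation Z := (V * E)%type.
Notation M := (region S).
Notation T := (op S).
Notation vflow := (vector_flow (flow S)).
Variables (L : R) (L0 : - L < L).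
Notation tlaw := (time_law L0).
Notation claw := (cube_law L0).

(** On the support of [h] the exponential density is at least [clock S * expR (- clock S * L)],
    while the uniform density is the constant [1 / (L - - L)]. *)
Lemma clock_law_ge_time_law : exists2 c : R, 0 < c &
  forall h : measurableTypeR R -> \bar R, measurable_fun setT h -> (forall t, 0 <= h t)%E ->
  (forall t : R, h t != 0%E -> 0 <= t <= L) ->
  (c%:E * \int[tlaw]_t h t <= \int[clock_law S]_t h t)%E.
Proof.
have c0 := clock0 S; have len0 : 0 < L - - L by rewrite subr_gt0.
set a := clock S * expR (- clock S * L).
have a0 : 0 < a by rewrite mulr_gt0// expR_gt0.
exists (a * (L - - L)); first exact: mulr_gt0.
move=> h mh h0 hL.
rewrite exponential_law_integral// integral_uniform// muleA -EFinM mulfK ?gt_eqF//.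
have mhL : measurable_fun `[- L, L]%classic h by exact: measurable_funTS.
rewrite -ge0_integralZl_EFin ?(ltW a0)//.
have mp : measurable_fun setT (fun t : measurableTypeR R => ((exponential_pdf (clock S) t)%:E * h t)%E).
  by apply: emeasurable_funM => //; apply/measurable_EFinP; exact: measurable_exponential_pdf.
have p0 t : (0 <= (exponential_pdf (clock S) t)%:E * h t)%E.
  by rewrite mule_ge0// lee_fin exponential_pdf_ge0// ltW.
rewrite integral_mkcond [leRHS]integral_mkcond; apply: ge0_le_integral => //=.
- by move=> t _; rewrite patchE; case: ifP => // _; rewrite mule_ge0// lee_fin ltW.
- by apply/(measurable_restrictT _ _).1 => //; apply: measurable_funTS; exact: measurable_funeM.
- by apply/(measurable_restrictT _ _).1 => //; exact: measurable_funTS.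
- move=> t _; rewrite !patchE.
  have [/eqP ->|ht] := boolP (h t == 0%E); first by rewrite !mule0; do 2 case: ifP.
  have /andP[t0 tL] := hL t ht.
  rewrite ifT; last by rewrite inE/= in_itv/= tL (le_trans _ t0)// oppr_le0 (le_trans t0).
  rewrite ifT; last by rewrite inE/= in_itv/= t0.
  apply: lee_wpmul2r => //; rewrite lee_fin exponential_pdfE// /a.
  by rewrite ler_wpM2l ?(ltW c0)// ler_expR !mulNr lerN2 ler_wpM2l// ltW.
Qed.

(** The box is cut at 0 because a word may contain zero durations, while clock times are
    nonnegative. *)
Definition times_near (w : seq (E * R)) (e : R) : set 'rV[R]_(size w) :=
  box (\row_k Num.max 0 (word_times w ord0 k - e)) (\row_k (word_times w ord0 k + e)).

Arguments times_near : clear implicits.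

Lemma times_nearP w e u : times_near w e u <->
  forall k, 0 <= u ord0 k /\ `|u ord0 k - word_times w ord0 k| <= e.
Proof.
rewrite /times_near /box /=; split=> h k; have := h k; rewrite !mxE ge_max ler_distl.
  by move=> /andP[/andP[-> ->] ->].
by move=> [-> /andP[-> ->]].
Qed.

Lemma times_near_le w e e' u : e <= e' -> times_near w e u -> times_near w e' u.
Proof.
move=> ee' /times_nearP h; apply/times_nearP => k; have [-> h1] := h k; split=> //.
exact: le_trans ee'.
Qed.

Lemma times_near_cons it w e (s : R) u : times_near (it :: w) e (cons_time (s, u)) ->
  [/\ 0 <= s, `|s - it.2| <= e & times_near w e u].
Proof.
move=> /times_nearP h; have := h ord0; rewrite /cons_time row_mx_ord0 /= row_mx_ord0 => -[s0 sit].
split=> //; apply/times_nearP => k; have := h (rshift 1 k).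
have -> : cons_time (s, u) ord0 (rshift 1 k) = u ord0 k by exact: row_mxEr.
by have -> : word_times (it :: w) ord0 (rshift 1 k) = word_times w ord0 k by exact: row_mxEr.
Qed.

Lemma vector_flow_near w u0 x0 (e : R) : 0 < e -> exists2 d, 0 < d &
  forall u x, `|u - u0| <= d -> `|x - x0| <= d -> `|vflow (w := w) u x - vflow u0 x0| <= e.
Proof.
elim: w u0 x0 e => [|it w IH] u0 x0 e e0 /=; first by exists e.
have [d1 d10 h1] := IH (rsubmx (u0 : 'rV_(1 + size w))) (flow S it.1 (u0 ord0 ord0) x0) e e0.
have [d2 d20 h2] := flow_near (field_smooth S it.1 2) (field_le S it.1) (flowP S it.1)
  (u0 ord0 ord0) x0 d10.
exists (Num.min d1 d2); first by rewrite lt_min d10.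
move=> u x; rewrite !le_min => /andP[u1 u2] /andP[x1 x2]; apply: h1.
  by rewrite -linearB; apply: le_trans (norm_rsubmx _) u1.
apply: h2 => //; apply: le_trans u2.
by have := coord_le_norm (u - u0) ord0; rewrite !mxE.
Qed.

Lemma measurable_vector_flow w x : measurable_fun setT (fun u => vflow (w := w) u x).
Proof.
apply: continuous_measurable_rV => u; have fu : Filter (nbhs u) by exact: nbhs_filter.
apply: (@cvgrPdist_le _ _ _ (nbhs u) fu _ _).2 => e e0.
have [d d0 hd] := vector_flow_near u x e0.
apply/nbhs_ballP; exists d => //= v; rewrite -ball_normE /= distrC => /ltW uv.
by rewrite distrC; apply: hd => //; rewrite subrr normr0 ltW.
Qed.

Definition word_integrand (g : Z -> R) w e x l (u : 'rV[R]_(size w)) : R :=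
  \1_(times_near w e) u * g (vflow u x, l).

Lemma word_integrand_ge0 g w e x l u : unit_fun g -> 0 <= word_integrand g e x l (w := w) u.
Proof.
move=> [_ g01]; rewrite /word_integrand mulr_ge0//.
by case/andP: (g01 (vflow u x, l)).
Qed.

Lemma measurable_word_integrand g w e x l : unit_fun g ->
  measurable_fun setT (word_integrand g e x l (w := w)).
Proof.
move=> [mg _]; apply: measurable_funM; first by apply: measurable_indic; exact: measurable_box.
exact: (measurableT_comp mg (measurableT_comp (pair2_measurable l) (@measurable_vector_flow w x))).
Qed.

(** A step of the kernel flows and then jumps, a word switches and then flows. The lower bound along
    a word therefore alternates between two forms: the chain at [x] is about to jump out of [i], or
    it is about to flow in the state [it.1]. *)
Definition jumped_bound w i x0 := exists e c : R, [/\ 0 < e, 0 < c & forall g x,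
  unit_fun g -> M x -> `|x - x0| <= e ->
  (c%:E * \int[claw (size w)]_u (word_integrand g e x (last_state i w) u)%:E <=
   (\sum_k jumpq S x i k * iter (size w) T g (x, k))%:E)%E].

Definition flowed_bound it w x0 := exists e c : R, [/\ 0 < e, 0 < c & forall g x,
  unit_fun g -> M x -> `|x - x0| <= e ->
  (c%:E * \int[claw (size (it :: w))]_u
     (word_integrand g e x (last_state it.1 w) (w := it :: w) u)%:E <=
   (iter (size w).+1 T g (x, it.1))%:E)%E].

Lemma word_integrand_le g w e e' x l u : unit_fun g -> e <= e' ->
  word_integrand g e x l (w := w) u <= word_integrand g e' x l u.
Proof.
move=> [_ g01] ee'; rewrite /word_integrand ler_wpM2r//.
  by case/andP: (g01 (vflow u x, l)).
rewrite !indicE; case: (boolP (u \in times_near w e)) => // h.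
by rewrite (mem_set (times_near_le ee' (set_mem h))).
Qed.

Lemma word_integrand_cons g it w e x l s u : unit_fun g ->
  word_integrand g e x l (w := it :: w) (cons_time (s, u)) != 0 ->
  [/\ 0 <= s, `|s - it.2| <= e &
    word_integrand g e x l (w := it :: w) (cons_time (s, u)) <=
    word_integrand g e (flow S it.1 s x) l u].
Proof.
move=> [_ g01]; rewrite /word_integrand !indicE /=.
case: (boolP (_ \in _)) => [/set_mem h _|_]; last by rewrite mul0r eqxx.
have [s0 se uw] := times_near_cons h; split=> //.
by rewrite (mem_set uw) /cons_time row_mx_ord0 row_mxKr.
Qed.

(** The first duration is integrated separately, by [cube_law_integral] on one side and [opE] on the
    other; [clock_law_ge_time_law] replaces the exponential law by the uniform one. *)
Lemma jumped_flowed_bound it w x0 : M x0 -> 0 <= it.2 -> it.2 + 1 <= L ->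
  jumped_bound w it.1 (flow S it.1 it.2 x0) -> flowed_bound it w x0.
Proof.
move=> Mx0 t0 tL [e [c [e0 c0 h]]].
have [a a0 ha] := clock_law_ge_time_law.
have [d d0 hd] := flow_near (field_smooth S it.1 2) (field_le S it.1) (flowP S it.1) it.2 x0 e0.
(* The cap 1 matches [it.2 + 1 <= L]: durations within [e'] of [it.2] stay below [L]. *)
pose e' := Num.min (Num.min e d) 1.
have e'0 : 0 < e' by rewrite !lt_min e0 d0 ltr01.
have [e'e e'd e'1] : [/\ e' <= e, e' <= d & e' <= 1].
  by rewrite /e' !ge_min !lexx/= !orbT.
clearbody e'.
exists e', (a * c); split=> //; first exact: mulr_gt0.
move=> g x ug Mx xx0; have umg := unit_fun_op_iter S (size w) ug.
set l := last_state it.1 w in h *.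
pose F u := (word_integrand g e' x l (w := it :: w) u)%:E.
have F0 u : (0 <= F u)%E by rewrite lee_fin word_integrand_ge0.
have mF : measurable_fun setT F by apply/measurable_EFinP; exact: measurable_word_integrand.
have mFc : measurable_fun setT (fun p : measurableTypeR R * 'rV[R]_(size w) => F (cons_time p)).
  exact: (measurableT_comp mF (@measurable_cons_time _ (size w))).
pose h1 (s : measurableTypeR R) : \bar R := (\int[claw (size w)]_u F (cons_time (s, u)))%E.
have mh1 : measurable_fun setT h1.
  exact: (measurable_fun_fubini_tonelli_F (m2 := claw (size w)) _ mFc (fun p => F0 _)).
have h10 s : (0 <= h1 s)%E by exact: integral_ge0.
have supp s : h1 s != 0%E -> 0 <= s /\ `|s - it.2| <= e'.
  move=> /eqP hs; apply: contrapT => ns; apply: hs; apply: integral0_eq => u _.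
  by apply/eqP/negPn/negP => /(word_integrand_cons ug)[s0 se _]; apply: ns.
have opI : ((iter (size w).+1 T g (x, it.1))%:E = \int[clock_law S]_t (\sum_j
    jumpq S (retract_flow S it.1 t x) it.1 j * iter (size w) T g (retract_flow S it.1 t x, j))%:E)%E.
  exact: (opE S (x, it.1) umg).
rewrite opI cube_law_integral// EFinM -muleA.
have -> : (c%:E * \int[tlaw]_s \int[claw (size w)]_u F (cons_time (s, u)) =
    \int[tlaw]_s (c%:E * h1 s))%E by rewrite ge0_integralZl_EFin// ltW.
have mch : measurable_fun setT (fun s => c%:E * h1 s)%E by exact: measurable_funeM.
have ch0 s : (0 <= c%:E * h1 s)%E by rewrite mule_ge0// lee_fin ltW.
apply: le_trans (ha _ mch ch0 _) _ => [s hs|].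
  have [s0 se] : 0 <= s /\ `|s - it.2| <= e'.
    by apply: supp; apply: contraNN hs => /eqP ->; rewrite mule0.
  rewrite s0/=; move: se; rewrite ler_norml => /andP[_]; lra.
have mo := measurable_one_step S (x, it.1) umg.1.
apply: ge0_le_integral => //=; first exact/measurable_EFinP.
move=> s _; have [hs|hs] := eqVneq (h1 s) 0%E.
  rewrite hs mule0 lee_fin; apply: sumr_ge0 => j _; rewrite mulr_ge0//.
    exact/jumpq_ge0/retract_flow_in.
  by case/andP: (umg.2 (retract_flow S it.1 s x, j)).
have [s0 se] := supp s hs.
have rf : retract_flow S it.1 s x = flow S it.1 s x.
  by rewrite /retract_flow ger0_norm// retr_id.
rewrite rf; apply: le_trans (h g _ ug _ _); last 2 first.
- exact: region_invariant.
- by apply: hd; [exact: le_trans se e'd|exact: le_trans xx0 e'd].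
apply: lee_wpmul2l; first by rewrite lee_fin ltW.
apply: ge0_le_integral => //=.
- exact: (measurableT_comp mFc (pair1_measurable s)).
- by apply/measurable_EFinP; exact: measurable_word_integrand.
- move=> u _; rewrite lee_fin.
  have [->|hu] := eqVneq (word_integrand g e' x l (w := it :: w) (cons_time (s, u))) 0.
    exact: word_integrand_ge0.
  have [_ _ le1] := word_integrand_cons ug hu.
  by apply: le_trans le1 _; exact: word_integrand_le.
Qed.

Lemma flowed_jumped_bound it w i x0 : M x0 -> 0 < jumpq S x0 i it.1 ->
  flowed_bound it w x0 -> jumped_bound (it :: w) i x0.
Proof.
move=> Mx0 q0 [e [c [e0 c0 h]]].
have q2 : jumpq S x0 i it.1 / 2 < jumpq S x0 i it.1 by rewrite ltr_pdivrMr// ltr_pMr// ltr1n.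
have [d d0 hq] := jumpq_near Mx0 q2.
set q := jumpq S x0 i it.1 / 2 in hq.
have q20 : 0 < q by rewrite divr_gt0.
exists (Num.min e d), (q * c); split; rewrite ?lt_min ?e0 ?mulr_gt0//.
move=> g x ug Mx; rewrite le_min => /andP[xe xd].
have lb : q * iter (size w).+1 T g (x, it.1) <=
    \sum_k jumpq S x i k * iter (size (it :: w)) T g (x, k).
  have u1 := unit_fun_op_iter S (size w).+1 ug.
  have u0 k : 0 <= iter (size w).+1 T g (x, k) by case/andP: (u1.2 (x, k)).
  rewrite (bigD1 it.1)//= -[leLHS]addr0; apply: lerD.
    by apply: ler_wpM2r; [exact: (u0 it.1)|exact: hq].
  by apply: sumr_ge0 => k _; rewrite mulr_ge0 ?jumpq_ge0//; exact: (u0 k).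
rewrite -lee_fin in lb; apply: le_trans lb; rewrite !EFinM -muleA.
apply: lee_wpmul2l; first by rewrite lee_fin ltW.
apply: le_trans (h g x ug Mx xe); apply: lee_wpmul2l; first by rewrite lee_fin ltW.
apply: ge0_le_integral => //=.
- by move=> u _; rewrite lee_fin word_integrand_ge0.
- by apply/measurable_EFinP; exact: (measurable_word_integrand (w := it :: w) _ _ _ ug).
- by apply/measurable_EFinP; exact: (measurable_word_integrand (w := it :: w) _ _ _ ug).
- by move=> u _; rewrite lee_fin; apply: (word_integrand_le (w := it :: w)); rewrite // ge_min lexx.
Qed.

Lemma word_bound w i x0 : M x0 -> nonneg_times w ->
  (forall it, it \in w -> it.2 + 1 <= L) ->
  admissible (flow S) (fun x i j => 0 < jumpq S x i j) i x0 w -> jumped_bound w i x0.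
Proof.
elim: w i x0 => [|it w IH] i x0 Mx0 w0 wL /=.
  (* For the empty word the last state is [i], and only the jump from [i] to itself is kept. *)
  move=> _; have q2 : jumpq S x0 i i / 2 < jumpq S x0 i i.
    by rewrite ltr_pdivrMr// ltr_pMr ?ltr1n// jumpq_refl.
  have [d d0 hq] := jumpq_near Mx0 q2.
  exists d, (jumpq S x0 i i / 2); split=> //; first by rewrite divr_gt0// jumpq_refl.
  move=> g x ug Mx xd; rewrite integral_dirac//; last first.
    by apply/measurable_EFinP; exact: measurable_word_integrand.
  have g0 k : 0 <= g (x, k) by case/andP: (ug.2 (x, k)).
  rewrite diracT mul1e -EFinM lee_fin (bigD1 i)//= -[leLHS]addr0; apply: lerD.
    rewrite /word_integrand /= mulrA; apply: ler_wpM2r; first exact: (g0 i).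
    apply: le_trans (hq x Mx xd); rewrite indicE ler_piMr ?divr_ge0 ?jumpq_ge0//.
    by case: (_ \in _).
  by apply: sumr_ge0 => k _; rewrite mulr_ge0 ?jumpq_ge0//; exact: (g0 k).
move=> /andP[q0 adm]; apply: flowed_jumped_bound => //.
have t0 : 0 <= it.2 by apply: w0; rewrite mem_head.
apply: jumped_flowed_bound => //; first by apply: wL; rewrite mem_head.
apply: IH adm; first exact: region_invariant.
- by move=> a aw; apply: w0; rewrite inE aw orbT.
- by move=> a aw; apply: wL; rewrite inE aw orbT.
Qed.

(** As the kernel flows before it jumps, the chain is started directly in the first state of the
    word. *)
Lemma first_word_bound it w i x0 : M x0 -> nonneg_times (it :: w) ->
  (forall a, a \in it :: w -> a.2 + 1 <= L) ->
  admissible (flow S) (fun x i j => 0 < jumpq S x i j) i x0 (it :: w) -> flowed_bound it w x0.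
Proof.
move=> Mx0 w0 wL /= /andP[q0 adm].
have t0 : 0 <= it.2 by apply: w0; rewrite mem_head.
apply: jumped_flowed_bound => //; first by apply: wL; rewrite mem_head.
apply: word_bound adm; first exact: region_invariant.
- by move=> a aw; apply: w0; rewrite inE aw orbT.
- by move=> a aw; apply: wL; rewrite inE aw orbT.
Qed.

End word_minorization.

(** * From a surjective derivative to a lower bound on the law *)

Section averaging.
Context {R : realType} (L : R) (L0 : - L < L).
Notation claw := (cube_law L0).

(** A closed ball of the sup norm, written as a box so that its mass under the product law can be
    computed. *)
Definition cball {k : nat} (c : 'rV[R]_k) (a : R) : set 'rV[R]_k :=
  box (c - const_mx a) (c + const_mx a).

Lemma cballP k (c : 'rV[R]_k) (a : R) u : 0 <= a -> cball c a u <-> `|u - c| <= a.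
Proof.
move=> a0; rewrite /cball /box /=; split=> h.
  apply: norm_le_coord => // i; have := h i; rewrite !mxE => /andP[h1 h2].
  by rewrite ler_distl h1.
move=> i; have := le_trans (coord_le_norm (u - c) i) h.
by rewrite !mxE ler_distl.
Qed.

Lemma measurable_cball k (c : 'rV[R]_k) a : measurable (cball c a).
Proof. exact: measurable_box. Qed.

(* Shifting the durations by [y *m pinvmx D] moves the end point by [y], up to an
   error at most [`|y| / 2]. Averaging over [y] thus bounds the law of the end point
   from below without any change of variables formula. *)
Lemma averaged_minorization m n (c : 'rV[R]_m.+1) (v : 'rV[R]_m.+1 -> 'rV[R]_n.+1)
    (D : 'M[R]_(m.+1, n.+1)) (e h a r : R) (z : 'rV[R]_n.+1) (A : set 'rV[R]_n.+1) :
  row_full D -> measurable_fun setT v -> 0 <= r -> r <= L -> 0 <= a -> 0 <= e ->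
  a + r * (n.+1%:R * `|pinvmx D|) <= h -> e * (n.+1%:R * `|pinvmx D|) <= 2^-1 ->
  (forall t s, `|t - c| <= h -> `|s - c| <= h ->
     `|v t - v s - (t - s) *m D| <= e * `|t - s|) ->
  (forall u, `|u - c| <= a -> `|z - v u| <= r / 4) ->
  cball c h `<=` time_box L (n := m.+1) ->
  measurable A -> (forall y, A y -> `|y - z| <= r / 4) ->
  (claw m.+1 (cball c a) * claw n.+1 A <=
    ((2 * 2) ^+ n.+1)%:E * claw m.+1 (cball c h `&` v @^-1` A))%E.
Proof.
move=> Dfull mv r0 rL a0 e0 ah eb strict zv QL mA Az.
have claw1 : (claw n.+1 setT <= 1)%E by move: (claw n.+1) => mu; exact: (@sprobability_setT _ _ _ mu).
set B := pinvmx D in ah eb; set b := n.+1%:R * `|B| in ah eb.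
have b0 : 0 <= b by rewrite mulr_ge0.
have h0 : 0 <= h by apply: le_trans ah; rewrite addr_ge0// mulr_ge0.
have BD : B *m D = 1%:M by exact: mulVpmx.
have yB (y : 'rV[R]_n.+1) : `|y *m B| <= b * `|y| by exact: norm_mulmx_le.
pose U := cball c a; pose Y : set 'rV[R]_n.+1 := cball 0 r.
pose C := cball c h `&` v @^-1` A.
have mU : measurable U by exact: measurable_cball.
have mY : measurable Y by exact: measurable_cball.
have mC : measurable C.
  apply: measurableI; first exact: measurable_cball.
  by rewrite -[X in measurable X]setTI; exact: mv.
have YP y : Y y <-> `|y| <= r by rewrite /Y cballP// subr0.
have UP u : U u <-> `|u - c| <= a by exact: cballP.
pose sh (q : 'rV[R]_m.+1 * 'rV[R]_n.+1) := q.1 + q.2 *m B.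
have msh : measurable_fun setT sh.
  apply: measurable_fun_coords => k; under eq_fun do rewrite mxE mxE.
  apply: measurable_funD; first exact: (measurableT_comp (measurable_coord k) measurable_fst).
  apply: measurable_sum => l; apply: measurable_funM => //.
  exact: (measurableT_comp (measurable_coord l) measurable_snd).
pose W := (U `*` Y) `&` (v \o sh) @^-1` A.
have mW : measurable W.
  apply: measurableI; first exact: measurableX.
  by rewrite -[X in measurable X]setTI; exact: (measurableT_comp mv msh).
have shC u y : U u -> Y y -> `|sh (u, y) - c| <= h.
  move=> /UP uc /YP yr; rewrite /sh /= addrAC; apply: le_trans (ler_normD _ _) _.
  apply: le_trans ah; apply: lerD => //; apply: le_trans (yB _) _.
  by rewrite mulrC ler_wpM2r.
pose f (q : 'rV[R]_m.+1 * 'rV[R]_n.+1) : \bar R := (\1_W q)%:E.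
have mf : measurable_fun setT f by apply/measurable_EFinP; exact: measurable_indic.
have f0 q : (0 <= f q)%E by rewrite lee_fin.
have I12 := etrans (esym (giry_int_prod1 (claw m.+1) (claw n.+1) mf f0))
  (giry_int_prod2 (claw m.+1) (claw n.+1) mf f0).
(* For fixed [y], translation by [y *m B] sends the admissible [u] into [C], and the law of the
   durations is translation invariant inside the cube. *)
have up : (giry_int (claw n.+1) (fun y => giry_int (claw m.+1) (fun u => f (u, y))) <=
    claw m.+1 C)%E.
  rewrite /giry_int; apply: (@le_trans _ _ (\int[claw n.+1]_y (claw m.+1 C))%E); last first.
    rewrite integral_cst//; apply: le_trans (lee_wpmul2l (measure_ge0 (claw m.+1) C) claw1) _.
    by rewrite mule1.
  apply: ge0_le_integral => //.
  - by move=> y _; exact: integral_ge0.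
  - exact: (measurable_fun_fubini_tonelli_G (m1 := claw m.+1) _ mf f0).
  - move=> y _; pose Uy := [set u | W (u, y)].
    have mUy : measurable Uy.
      by rewrite -[Uy]setTI; apply: (pair2_measurable y).
    rewrite (_ : (fun u => f (u, y)) = EFin \o \1_Uy)//.
    rewrite integral_indic// setIT; have [yY|yY] := pselect (Y y); last first.
      rewrite (_ : Uy = set0) ?measure0//.
      by apply/seteqP; split => // u [[_ /= h1] _].
    apply: (@cube_law_shift _ _ L0 _ _ _ (y *m B)) => //.
      by move=> u [uc _]; exact: QL.
    move=> u [[/= uU _] /= vA]; split=> //; apply/cballP => //.
    exact: (shC u y uU yY).
(* For fixed [u], the map [y] to [v (u + y *m B)] differs from a translation by a contraction of
   ratio 1/2. It therefore covers [A] and is Lipschitz with constant 2, which gives the factor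
   [(2 * 2) ^+ n.+1]. *)
have low : (claw m.+1 U * claw n.+1 A <= ((2 * 2) ^+ n.+1)%:E *
    giry_int (claw m.+1) (fun u => giry_int (claw n.+1) (fun y => f (u, y))))%E.
  have mG : measurable_fun setT (fun u => giry_int (claw n.+1) (fun y => f (u, y))).
    exact: (measurable_fun_fubini_tonelli_F (m2 := claw n.+1) _ mf f0).
  have G0 u : (0 <= giry_int (claw n.+1) (fun y => f (u, y)))%E by exact: integral_ge0.
  rewrite /giry_int -ge0_integralZl_EFin//.
  have -> : (claw m.+1 U * claw n.+1 A = \int[claw m.+1]_(u in U) claw n.+1 A)%E.
    by rewrite integral_cst// muleC.
  rewrite [leLHS]integral_mkcond; apply: ge0_le_integral => //.
  - by move=> u _; rewrite patchE; case: ifP.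
  - by apply/(measurable_restrictT _ _).1.
  - exact: measurable_funeM.
  - move=> u _; rewrite patchE; case: ifPn => [/set_mem uU|_]; last by rewrite mule_ge0// ?G0// lee_fin exprn_ge0.
    pose Yu := [set y | W (u, y)].
    have mYu : measurable Yu.
      by rewrite -[Yu]setTI; apply: (pair1_measurable u).
    rewrite (_ : (fun y => f (u, y)) = EFin \o \1_Yu)// integral_indic// setIT.
    pose g y := v (u + y *m B).
    have gd y y' : `|y| <= r -> `|y'| <= r -> `|g y - g y' - (y - y')| <= 2^-1 * `|y - y'|.
      move=> /YP yr /YP y'r; have := strict _ _ (shC u y uU yr) (shC u y' uU y'r).
      rewrite /sh /= -/(g y) -/(g y') opprD addrACA subrr add0r -mulmxBl -mulmxA BD mulmx1.
      move=> h1; apply: le_trans h1 _; apply: le_trans (ler_wpM2l e0 (yB _)) _.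
      by rewrite mulrA ler_wpM2r.
    have g00 : g 0 = v u by rewrite /g mul0mx addr0.
    apply: (@cube_law_lipschitz _ _ L0 _ g _ _ 2) => //.
    - move=> y [[_ /= /YP yr] _] k; rewrite !mxE -ler_norml.
      by apply: le_trans (coord_le_norm _ _) _; exact: le_trans yr rL.
    - move=> y y' [[_ /= /YP yr] _] [[_ /= /YP y'r] _].
      rewrite -(subrK (y - y') (g y - g y')); apply: le_trans (ler_normD _ _) _.
      have := gd y y' yr y'r; have := normr_ge0 (y - y'); lra.
    - move=> y Ay; have [|q qr gq] := near_identity_surjective r0 gd (z := y).
        rewrite g00 -(subrKA z); apply: le_trans (ler_normD _ _) _.
        have := Az y Ay; have := zv u ((UP u).1 uU); lra.
      exists q => //; split; first by split=> //; exact/YP.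
      by rewrite /= /sh/= -/(g q) gq.
  by move=> u _; exact: G0.
apply: le_trans low _; apply: lee_wpmul2l; first by rewrite lee_fin exprn_ge0.
by rewrite -/C; rewrite I12.
Qed.

End averaging.

Lemma times_bounded {R : realType} (E : eqType) (w : seq (E * R)) :
  exists2 B : R, 0 <= B & forall a, a \in w -> a.2 <= B.
Proof.
elim: w => [|it w [B B0 hB]]; first by exists 0.
exists (Num.max B it.2); first by rewrite le_max B0.
move=> a; rewrite inE le_max => /orP[/eqP ->|/hB ->//]; by rewrite lexx orbT.
Qed.

Lemma word_times_ge0 {R : realType} {E : finType} (w : seq (E * R)) :
  nonneg_times w -> forall k, 0 <= word_times w ord0 k.
Proof.
elim: w => [|q s IH] s0 k; first by case: k.
rewrite [word_times _]/= mxE; case: splitP => j _.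
  by rewrite mxE (ord1 j) eqxx mulr1n; apply: s0; rewrite mem_head.
by apply: IH => o os; apply: s0; rewrite inE os orbT.
Qed.

(** * Uniform minorization by a law with a density *)

Section doeblin_minorization.
Context {R : realType} {n : nat} {E : pfinType} (S : switched_flow R n.+1 E).
Notation V := 'rV[R]_n.+1.
Notation Z := (V * E)%type.
Notation M := (region S).
Notation T := (op S).
Variable p : V.
Hypotheses (Mp : M p) (p_bracket : weak_bracket_condition (field S) p).

(** [first_word_bound] bounds the law of the chain from below through durations close to those of a
    full rank word, and [averaged_minorization] converts these durations into end points near
    [z]. *)
Theorem local_minorization : exists (L : R) (L0 : - L < L) (i l : E) (m : nat) (z : V)
    (r k r0 : R), [/\ 0 < r, `|z| + r <= L, 0 < k & 0 < r0] /\
  forall x (A : set Z), M x -> `|x - p| <= r0 -> measurable A ->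
  (k%:E * cube_law L0 n.+1 [set y : V | (`|y - z| <= r)%R /\ A (y, l)] <=
   (iter m T \1_A (x, i))%:E)%E.
Proof.
have /choice[J hJ] : forall i, exists J, flow_jacobian (flow S i) J.
  by move=> i; exact: flow_jacobian_exists (field_smooth S i 2) (field_le S i) (flowP S i).
have [w [w0 adm Dfull]] := full_rank_word (adm := fun x i j => 0 < jumpq S x i j)
  (field_smooth S) (field_le S) (flowP S) hJ (@region_invariant _ _ _ S)
  (fun x i Mx => jumpq_refl i Mx) (fun x i j Mx => jumpq_connect i j Mx) point Mp p_bracket.
(* The empty word is excluded: its tangent matrix has no row, while the dimension [n.+1] is
   positive. *)
case: w w0 adm Dfull => [|it w] w0 adm Dfull.
  by move: Dfull; rewrite /row_full => /eqP h; have := rank_leq_row (word_tangent (field S) (flow S) J [::] p); rewrite h.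
set D := word_tangent _ _ _ _ _ in Dfull.
have [Lw Lw0 hLw] := times_bounded (it :: w).
pose tau : 'rV[R]_(size w).+1 := word_times (it :: w).
pose vf (u : 'rV[R]_(size w).+1) x := vector_flow (flow S) (w := it :: w) u x.
pose y0 := vf tau p.
(* [L] leaves room for the durations of the word ([wL]), for the box of durations ([QL]) and for the
   ball around [z] that receives the end points. *)
pose L := Lw + `|tau| + `|y0| + 3.
have tau0 := normr_ge0 tau; have y00 := normr_ge0 y0.
have L0 : - L < L by rewrite /L; lra.
have wL a : a \in it :: w -> a.2 + 1 <= L by move=> /hLw h; rewrite /L; lra.
have [e1 [c1 [e10 c10 hb]]] := first_word_bound L0 Mp w0 wL adm.
set b := n.+1%:R * `|pinvmx D|; have b0 : 0 <= b by rewrite mulr_ge0.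
have half0 : (0 : R) < 2^-1 by [].
have [e [epos _ eb]] := small_multiple b0 half0.
have [d2 d20 strict] := vector_flow_strict (fun i => field_smooth S i 2) (field_le S) (flowP S) hJ (it :: w) p epos.
have [d3 d30 near1] := vector_flow_near S (w := it :: w) tau p ltr01.
pose h := Num.min (Num.min e1 d2) (Num.min d3 1) / 2.
have h0 : 0 < h by rewrite divr_gt0// !lt_min e10 d20 d30 ltr01.
have [he1 hd2 hd3 h1] : [/\ h * 2 <= e1, h * 2 <= d2, h * 2 <= d3 & h * 2 <= 1].
  by rewrite /h mulfVK// !ge_min !lexx !orbT.
clearbody h.
(* Some durations in [tau] may be 0. The centre is moved up by [h] in every coordinate, so that the
   whole ball of radius [h] around [c] consists of nonnegative durations. *)
pose c : 'rV[R]_(size w).+1 := tau + const_mx h.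
have ck k : c ord0 k = tau ord0 k + h by rewrite mxE; congr (_ + _); rewrite mxE.
have hmx : `|const_mx h : 'rV[R]_(size w).+1| <= h.
  by apply: norm_le_coord => [|k]; [exact: ltW|rewrite mxE ger0_norm// ltW].
have ctau u : `|u - c| <= h -> `|u - tau| <= h * 2.
  move=> uc; rewrite -(subrKA c) mulr_natr mulr2n; apply: le_trans (ler_normD _ _) _.
  by apply: lerD => //; rewrite /c addrC addKr.
pose z := vf c p.
have zy0 : `|z - y0| <= 1.
  apply: near1; last by rewrite subrr normr0 ltW.
  by rewrite /c addrC addKr; apply: le_trans hmx _; lra.
have h20 : 0 < h / 2 by rewrite divr_gt0.
(* Moving the end point by at most [r] changes the durations by at most [r * b <= h / 2]; together
   with [a <= h / 2] this stays within [h]. *)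
have [r [rpos r1 rb]] := small_multiple b0 h20.
have r40 : 0 < r / 4 by rewrite divr_gt0.
have [d4 d40 near2] := vector_flow_near S (w := it :: w) c p r40.
pose a := Num.min d4 (h / 2).
have a0 : 0 < a by rewrite lt_min d40.
have [ad4 ah] : a <= d4 /\ a <= h / 2 by rewrite /a !ge_min !lexx orbT.
clearbody a.
have tauk k : 0 <= tau ord0 k.
  exact: (word_times_ge0 w0).
have QL u : `|u - c| <= h -> time_box L (n := (size w).+1) u.
  move=> /ctau ut k; rewrite !mxE -ler_norml; apply: le_trans (coord_le_norm _ _) _.
  rewrite -(subrK tau u); apply: le_trans (ler_normD _ _) _; rewrite /L; lra.
have Upos : (0 < cube_law L0 (size w).+1 (cball c a))%E.
  apply: cube_law_box_gt0 => k; rewrite /c; move: (tauk k) (coord_le_norm tau k).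
  clearbody tau; rewrite !mxE ler_norml => t1 /andP[_ t2].
  by split; rewrite /L; lra.
have Ufin : cube_law L0 (size w).+1 (cball c a) \is a fin_num.
  by apply: fin_num_measure; exact: measurable_cball.
pose q := fine (cube_law L0 (size w).+1 (cball c a)).
have q0 : 0 < q by rewrite fine_gt0// Upos ltey_eq Ufin.
have p40 : (0 : R) < (2 * 2) ^+ n.+1 by rewrite exprn_gt0.
exists L, L0, it.1, (last_state it.1 w), (size w).+1, z, (r / 4),
  (c1 * (((2 * 2) ^+ n.+1)^-1 * q)), (Num.min e1 (Num.min d2 d4)).
split; first split=> //.
- have := ler_normD (z - y0) y0; rewrite subrK /L => hz.
  by apply: le_trans (_ : `|z - y0| + `|y0| + r / 4 <= _); [rewrite lerD2r|lra].
- by rewrite !mulr_gt0// invr_gt0.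
- by rewrite !lt_min e10 d20.
move=> x A Mx; rewrite !le_min => /and3P[xe1 xd2 xd4] mA.
set l := last_state it.1 w in hb *.
pose B : set V := [set y | `|y - z| <= r / 4 /\ A (y, l)].
have mB : measurable B.
  have -> : B = cball z (r / 4) `&` (pair^~ l) @^-1` A.
    by apply/seteqP; split => y [] /(cballP _ _ (ltW r40)).
  apply: measurableI; first exact: measurable_cball.
  by rewrite -[X in measurable X]setTI; apply: (pair2_measurable l).
have mv : measurable_fun setT (fun u : 'rV[R]_(size w).+1 => vf u x).
  exact: (measurable_vector_flow S (w := it :: w) x).
have ar : a + r * b <= h by apply: le_trans (lerD ah rb) _; rewrite -splitr.
have main := @averaged_minorization R L L0 (size w) n c (fun u => vf u x) D e h a r z B
  Dfull mv (ltW rpos) _ (ltW a0) (ltW epos) ar eb _ _ _ mB _.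
have {}main : (cube_law L0 (size w).+1 (cball c a) * cube_law L0 n.+1 B <=
    ((2 * 2) ^+ n.+1)%:E * cube_law L0 (size w).+1 (cball c h `&` (vf^~ x) @^-1` B))%E.
  apply: main.
  - by rewrite /L; lra.
  - move=> t s tc sc; have := strict t s x x (le_trans (ctau t tc) hd2) (le_trans (ctau s sc) hd2) xd2 xd2.
    by rewrite !subrr mul0mx addr0 normr0 addr0.
  - move=> u uc; rewrite distrC; apply: near2 => //; exact: le_trans ad4.
  - by move=> u /(cballP _ _ (ltW h0)); exact: QL.
  - by move=> y [].
set C := cball c h `&` _ in main.
have mC : measurable C.
  apply: measurableI; first exact: measurable_cball.
  by rewrite -[X in measurable X]setTI; exact: mv.
have uA := unit_fun_indic (R := R) mA.
apply: le_trans (hb \1_A x uA Mx xe1).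
rewrite EFinM -muleA; apply: lee_wpmul2l; first by rewrite lee_fin ltW.
apply: (@le_trans _ _ (cube_law L0 (size w).+1 C)).
  rewrite EFinM -muleA fineK// lee_pdivrMl//.
have -> : (cube_law L0 (size w).+1 C = \int[cube_law L0 (size w).+1]_u (\1_C u)%:E)%E.
  by rewrite integral_indic// setIT.
apply: ge0_le_integral => //.
- by apply/measurable_EFinP; exact: measurable_indic.
- by apply/measurable_EFinP; exact: (measurable_word_integrand S (w := it :: w) _ _ _ uA).
- move=> u _; rewrite lee_fin indicE; case: (boolP (u \in C)) => [/set_mem|_]; last exact: (word_integrand_ge0 S e1 x l (w := it :: w) u uA).
  move=> [/(cballP _ _ (ltW h0)) uc [_ uAl]].
  rewrite /word_integrand !indicE mem_set; last first.
    apply/times_nearP => k; have ut := ctau u uc.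
    have h3 := le_trans (coord_le_norm (u - c) k) uc; rewrite mxE [X in _ + X]mxE ck in h3.
    have h5 := le_trans (coord_le_norm (u - tau) k) (le_trans ut he1).
    rewrite mxE [X in _ + X]mxE in h5.
    split=> //; move: h3; rewrite ler_norml => /andP[h4 _]; have := tauk k; lra.
  by rewrite mem_set// mul1r.
Qed.

End doeblin_minorization.

Section doeblin_condition.
Context {R : realType} {n : nat} {E : pfinType} (S : switched_flow R n.+1 E).
Notation V := 'rV[R]_n.+1.
Notation Z := (V * E)%type.
Notation M := (region S).
Notation T := (op S).

Lemma op_iter_le k (f g : Z -> R) : unit_fun f -> unit_fun g -> (forall z, f z <= g z) ->
  forall z, iter k T f z <= iter k T g z.
Proof.
move=> uf ug fg; elim: k => [|k IH] z; first exact: fg.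
by apply: mean_le => //; exact: unit_fun_op_iter.
Qed.

Lemma mean_scale (mu : giry Z R) (a : R) (f : Z -> R) : 0 <= a -> unit_fun f ->
  mean mu (fun z => a * f z) = a * mean mu f.
Proof.
move=> a0 [mf f01]; rewrite /mean.
under eq_integral do rewrite EFinM.
rewrite ge0_integralZl_EFin//; last 2 first.
- by move=> x _; rewrite lee_fin; case/andP: (f01 x).
- exact/measurable_EFinP.
by rewrite (meanE mu (conj mf f01)).
Qed.

Lemma op_iter_scale k (a : R) (f : Z -> R) : 0 <= a -> unit_fun f ->
  iter k T (fun z => a * f z) = (fun z => a * iter k T f z).
Proof.
move=> a0 uf; elim: k => //= k ->; apply/funext => z.
by rewrite /op /markov_op mean_scale//; exact: unit_fun_op_iter.
Qed.

Lemma cube_law_setT (L : R) (L0 : - L < L) m : cube_law L0 m setT = 1%E.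
Proof.
apply/eqP; rewrite eq_le; apply/andP; split.
  by move: (cube_law L0 m) => mu; exact: (@sprobability_setT _ _ _ mu).
rewrite -(cube_law_full L0 m); apply: le_measure; rewrite ?inE//.
exact: measurable_time_box.
Qed.

Lemma cube_law_setC_box (L : R) (L0 : - L < L) m : cube_law L0 m (~` time_box L (n := m)) = 0%E.
Proof.
have mQ := @measurable_time_box _ L m.
have e : (cube_law L0 m setT =
    cube_law L0 m (time_box L (n := m)) + cube_law L0 m (~` time_box L (n := m)))%E.
  by rewrite -measureU ?setUCr//; [exact: measurableC|exact: setICr].
have xf : cube_law L0 m (~` time_box L (n := m)) =
    (fine (cube_law L0 m (~` time_box L (n := m))))%:E.
  by rewrite fineK// fin_num_measure//; exact: measurableC.
rewrite cube_law_setT cube_law_full xf -EFinD in e; rewrite xf; congr (_%:E).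
by case: e => e; apply: (addrI (1 : R)); rewrite -e addr0.
Qed.

Theorem doeblin_minorization (p : V) : M p -> accessible_set (flow S) M p ->
  weak_bracket_condition (field S) p ->
  exists (m : nat) (delta : R) (nu : giry Z R), [/\ (0 < m)%N, 0 < delta < 1, nu setT = 1%E,
    forall z B, measurable B -> (delta%:E * nu B <= (iter m T \1_B z)%:E)%E &
    forall A, measurable A -> (forall i, lebesgue_rV [set x | A (x, i)] = 0%E) -> nu A = 0%E].
Proof.
move=> Mp pacc pbr.
have [L [L0 [i [l [m [z [r [k [r0 [[rpos zL k0 r00] loc]]]]]]]]]] := local_minorization Mp pbr.
have Lpos : 0 < L by have := normr_ge0 z; lra.
(* [sc] scales the cube of half side [L] onto the ball of radius [r] around [z], in the state [l];
   the minorizing law [nu] is thus uniform on that ball. *)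
pose sc (y : V) : Z := (z + (r / L) *: y, l).
have msc : measurable_fun setT sc.
  apply: (measurableT_comp (pair2_measurable l)); apply: measurable_fun_coords => j.
  under eq_fun do rewrite mxE [X in _ + X]mxE.
  by apply: measurable_funD => //; apply: measurable_funM => //; exact: measurable_coord.
pose nu : giry Z R := giry_map msc (cube_law L0 n.+1).
pose g (y : V) := (L / r) *: (y - z).
have gsc y : g (z + (r / L) *: y) = y.
  rewrite /g addrAC subrr add0r scalerA mulrA mulfVK ?gt_eqF// divff ?gt_eqF// scale1r//.
pose Ba (A : set Z) : set V := [set y | `|y - z| <= r /\ A (y, l)].
have mBa A : measurable A -> measurable (Ba A).
  move=> mA; have -> : Ba A = cball z r `&` (pair^~ l) @^-1` A.
    by apply/seteqP; split => y [] /(cballP _ _ (ltW rpos)).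
  apply: measurableI; first exact: measurable_cball.
  by rewrite -[X in measurable X]setTI; apply: (pair2_measurable l).
have q0 : 0 < (2 * (L / r)) ^+ n.+1 by rewrite exprn_gt0// mulr_gt0// divr_gt0.
set q := (2 * (L / r)) ^+ n.+1 in q0.
have BaL A y : Ba A y -> time_box L (n := n.+1) y.
  move=> [yz _] j; rewrite !mxE -ler_norml; apply: le_trans (coord_le_norm _ _) _.
  rewrite -(subrK z y); apply: le_trans (ler_normD _ _) _; lra.
(* [g] undoes the scaling and is Lipschitz with constant [L / r], which produces the factor [q]. The
   part of the preimage outside the cube has mass zero and is cut off first. *)
have nu_le A : measurable A -> (nu A <= q%:E * cube_law L0 n.+1 (Ba A))%E.
  move=> mA; rewrite -[nu A]/(cube_law L0 n.+1 (sc @^-1` A)).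
  have mscA : measurable (sc @^-1` A) by rewrite -[X in measurable X]setTI; apply: (msc measurableT A mA).
  have mQ := @measurable_time_box _ L n.+1.
  have -> : cube_law L0 n.+1 (sc @^-1` A) =
      cube_law L0 n.+1 (sc @^-1` A `&` time_box L (n := n.+1)).
    rewrite -[in LHS](setUIDK (sc @^-1` A) (time_box L (n := n.+1))) measureU//; last 3 first.
    - exact: measurableI.
    - exact: measurableD.
    - by apply/seteqP; split => y; rewrite /setI /setD /=; tauto.
    rewrite [X in (_ + X)%E](_ : _ = 0%E) ?adde0//.
    apply/eqP; rewrite eq_le measure_ge0 andbT -(cube_law_setC_box L0 n.+1).
    have mQ' := measurableC mQ; have mD := measurableD mscA mQ.
    by apply: le_measure; rewrite ?inE// => y [].
  apply: (cube_law_lipschitz L0 (g := g)) => //.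
  - by rewrite divr_gt0.
  - exact: mBa.
  - exact: measurableI.
  - exact: BaL.
  - move=> x y _ _; rewrite /g -scalerBr opprB addrA subrK normrZ ger0_norm//.
    by rewrite divr_ge0// ltW.
  - move=> y [Ay yQ]; exists (z + (r / L) *: y); last exact: gsc.
    split=> //; rewrite addrAC subrr add0r normrZ ger0_norm ?divr_ge0 ?(ltW rpos) ?(ltW Lpos)//.
    rewrite mulrAC ler_pdivrMr// ler_wpM2l ?(ltW rpos)//.
    apply: norm_le_coord => [|j]; first exact: ltW.
    by have := yQ j; rewrite !mxE -ler_norml.
have mM : measurable M by exact: (measurable_closed_rV (@region_closed _ _ _ S)).
pose f : Z -> R := \1_((cball p r0 `&` M) `*` [set i]).
have mW : measurable ((cball p r0 `&` M) `*` [set i]).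
  by apply: measurableX => //; apply: measurableI => //; exact: measurable_cball.
have uf : unit_fun f by exact: unit_fun_indic.
have r020 : 0 < r0 / 2 by rewrite divr_gt0.
have [|N [c [c0 hN]]] := uniform_reachability uf r020 pacc (j0 := i).
  move=> y My yp; exists (r0 / 2), 1; split=> //= x Mx xy.
  rewrite /f indicE mem_set//; split=> //=; split=> //; apply/cballP; first exact: ltW.
  by rewrite -(subrKA y) (splitr r0); apply: le_trans (ler_normD _ _) _; exact: lerD.
(* [k / q] comes from comparing the local minorization with [nu], and [c] from reachability; the cap
   at 1/2 keeps [d] below 1. *)
pose d := Num.min (k / q * c) 2^-1.
have d0 : 0 < d by rewrite lt_min !mulr_gt0// ?invr_gt0//= divr_gt0.
have dk : d <= k / q * c by rewrite ge_min lexx.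
have d1 : d < 1 by rewrite gt_min invf_lt1// ltr1n orbT.
(* [N] steps reach the neighbourhood of [p] in the state [i], [m] steps follow the word. The
   successor makes the exponent positive, and [op_ge_region] carries a uniform lower bound through
   the extra step. *)
exists (N + m).+1, d, nu; split=> //.
- by rewrite d0 d1.
- exact: cube_law_setT.
- move=> x B mB.
  have nuB : nu B = (fine (nu B))%:E by rewrite fineK// fin_num_measure.
  set s := fine (nu B) in nuB; have s0 : 0 <= s by exact: fine_ge0.
  have uB := unit_fun_indic (R := R) mB.
  have ug := unit_fun_op_iter S m uB.
  have a0 : 0 <= k / q * s by rewrite mulr_ge0// divr_ge0// ltW.
  have lower y : M y -> `|y - p| <= r0 -> k / q * s <= iter m T \1_B (y, i).
    move=> My yp; rewrite -lee_fin; apply: le_trans (loc y B My yp mB).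
    rewrite mulrAC -mulrA EFinM; apply: lee_wpmul2l; first by rewrite lee_fin ltW.
    rewrite mulrC EFinM lee_pdivrMl// -nuB; exact: nu_le.
  have fg y : k / q * s * f y <= iter m T \1_B y.
    rewrite /f indicE; case: (boolP (y \in _)) => [/set_mem|_]; last first.
      by rewrite mulr0; case/andP: (ug.2 y).
    case: y => y j [[/= /(cballP _ _ (ltW r00)) yp My] ->]; rewrite mulr1.
    exact: lower.
  have ukf : unit_fun (fun y => k / q * s * f y).
    split; first by apply: measurable_funM => //; exact: uf.1.
    move=> y; apply/andP; split; first by rewrite mulr_ge0//; case/andP: (uf.2 y).
    by apply: le_trans (fg y) _; case/andP: (ug.2 y).
  rewrite nuB -EFinM lee_fin.
  apply: (op_ge_region (f := iter (N + m) T \1_B)); first exact: unit_fun_op_iter.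
    by rewrite mulr_ge0// ltW.
  move=> y j _; rewrite iterD; apply: le_trans (op_iter_le N ukf ug fg (y, j)).
  rewrite op_iter_scale//; apply: le_trans (_ : k / q * s * c <= _); last by rewrite ler_wpM2l.
  by rewrite mulrAC ler_wpM2r.
- move=> A mA A0; apply/eqP; rewrite eq_le measure_ge0 andbT.
  apply: le_trans (nu_le A mA) _; rewrite [X in (_ * X)%E](_ : _ = 0%E) ?mule0//.
  apply/eqP; rewrite eq_le measure_ge0 andbT.
  apply: le_trans (cube_law_le_lebesgue L0 (mBa A mA)) _.
  rewrite [X in (_ * X)%E](_ : _ = 0%E) ?mule0//.
  apply/eqP; rewrite eq_le lebesgue_rV_ge0 andbT -(A0 l).
  by apply: lebesgue_rV_le => y [].
Qed.

End doeblin_condition.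

(** * Absolute continuity *)

Section null_sets.
Context {R : realType} {n : nat} {E : pfinType} (S : switched_flow R n E).
Notation V := 'rV[R]_n.
Notation Z := (V * E)%type.
Notation M := (region S).
Notation T := (op S).

Definition step_value (A : set Z) (p : Z * measurableTypeR R) : R :=
  \sum_j jumpq S (retract_flow S p.1.2 p.2 p.1.1) p.1.2 j *
    \1_A (retract_flow S p.1.2 p.2 p.1.1, j).

Lemma step_value_ge0 A p : 0 <= step_value A p.
Proof.
apply: sumr_ge0 => j _; rewrite mulr_ge0//.
exact/jumpq_ge0/retract_flow_in.
Qed.

Lemma measurable_step_term A j : measurable A ->
  measurable_fun setT (fun p : Z * measurableTypeR R =>
    jumpq S (retract_flow S p.1.2 p.2 p.1.1) p.1.2 j *
    \1_A (retract_flow S p.1.2 p.2 p.1.1, j)).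
Proof.
move=> mA; have mF := measurable_flow_map (@measurable_retract_flow _ _ _ S).
apply: measurable_funM.
  have mq : measurable_fun setT (fun z : Z => retract_jump S z.1 z.2 j).
    by apply: measurable_fun_pfin => i; exact: measurable_retract_jump.
  under eq_fun do rewrite -retr_flow.
  exact: (measurableT_comp mq mF).
have m1 := measurableT_comp (@measurable_fst _ _ V E) mF.
have m2 := measurableT_comp (pair2_measurable j) m1.
exact: (measurableT_comp (measurable_indic mA) m2).
Qed.

Lemma measurable_step_value A : measurable A -> measurable_fun setT (step_value A).
Proof. by move=> mA; apply: measurable_sum => j; exact: measurable_step_term. Qed.

Lemma op_step_value A z : measurable A ->
  ((T \1_A z)%:E = \int[clock_law S]_t (step_value A (z, t))%:E)%E.
Proof. by move=> mA; exact: (opE S z (unit_fun_indic mA)). Qed.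

End null_sets.

Section absolute_continuity.
Context {R : realType} {n : nat} {E : pfinType} (S : switched_flow R n.+1 E).
Notation V := 'rV[R]_n.+1.
Notation Z := (V * E)%type.
Notation M := (region S).
Notation T := (op S).

Definition null_slices (A : set Z) := forall i, lebesgue_rV (M `&` [set x | A (x, i)]) = 0%E.

(** Within the region, the preimage of a slice under the flow lies in the image of that slice under
    the backward flow. The backward flow is Lipschitz on bounded sets, so this image is null. *)
Lemma null_slices_preimage (A : set Z) (t : R) j : null_slices A ->
  null_slices [set z | A (retract_flow S z.2 t z.1, j)].
Proof.
move=> A0 i; have [r Mr] : exists r, forall x, M x -> `|x| <= r.
  have [r [_ hr]] := compact_bounded (@region_compact _ _ _ S).
  by exists (r + 1) => x Mx; apply: (hr (r + 1)) => //; rewrite ltrDl.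
have [C C0 hC] := flow_space_lipschitz (field_smooth S i 2) (field_le S i) (flowP S i) `|t| r.
have C10 : 0 < C + 1 by rewrite ltr_wpDl.
apply/eqP; rewrite eq_le lebesgue_rV_ge0 andbT.
pose D := M `&` [set x | A (x, j)].
have lipD x y : D x -> D y ->
    `|flow S i (- `|t|) x - flow S i (- `|t|) y| <= (C + 1) * `|x - y|.
  move=> [Mx _] [My _]; apply: le_trans (hC _ _ _ (Mr _ Mx) (Mr _ My) _) _.
    by rewrite normrN normr_id.
  by rewrite ler_wpM2r// lerDl.
apply: (@le_trans _ _ (lebesgue_rV (flow S i (- `|t|) @` D))).
  apply: lebesgue_rV_le => x [Mx /=]; rewrite /retract_flow retr_id// => Ax.
  exists (flow S i `|t| x); first by split=> //; exact: region_invariant.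
  by rewrite (flow_group (field_smooth S i 2) (field_le S i) (flowP S i)) addNr flow0.
apply: le_trans (lebesgue_rV_lipschitz C10 lipD) _.
by rewrite /D (A0 j) mule0.
Qed.

Definition slice_continuous (mu : giry Z R) :=
  forall A, measurable A -> null_slices A -> mu A = 0%E.

(** By Fubini the duration is fixed first. For each duration [t], the starting states whose flow
    ends in a slice of [A] form a set with null slices, and the step value is at most the sum of the
    indicators of these sets. *)
Lemma slice_continuous_push (mu : giry Z R) :
  slice_continuous mu -> slice_continuous (push (measurable_kernel S) mu).
Proof.
move=> mu0 A mA A0; have uA := unit_fun_indic (R := R) mA.
have mv := measurable_step_value S mA.
have mV : measurable_fun setT (fun p : Z * measurableTypeR R => (step_value S A p)%:E).
  exact/measurable_EFinP.
have V0 p : (0 <= (step_value S A p)%:E)%E by rewrite lee_fin step_value_ge0.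
rewrite -mean_indic// mean_push// -meanE; last first.
  by apply: unit_fun_op => //; [exact: measurable_kernel|exact: kernel_setT].
under eq_integral => z _ do rewrite (op_step_value S z mA).
transitivity (giry_int mu (fun z => giry_int (clock_law S : giry _ R) (fun t => (step_value S A (z, t))%:E))) => //.
rewrite -(giry_int_prod1 mu (clock_law S) mV V0) (giry_int_prod2 mu (clock_law S) mV V0).
apply: integral0_eq => t _; rewrite /giry_int.
pose B j := [set z : Z | A (retract_flow S z.2 t z.1, j)].
have mB j : measurable (B j).
  have mF := measurable_flow_map (@measurable_retract_flow _ _ _ S).
  have m1 := measurableT_comp (@measurable_fst _ _ V E) mF.
  have m2 := measurableT_comp (pair2_measurable j) m1.
  have m3 := measurableT_comp m2 (pair2_measurable t).
  by rewrite -[X in measurable X]setTI; apply: (m3 measurableT A mA).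
apply/eqP; rewrite eq_le; apply/andP; split; last exact: integral_ge0.
apply: (@le_trans _ _ (\int[mu]_z (\sum_j (\1_(B j) z)%:E))%E).
  apply: ge0_le_integral => //.
  - exact: (measurableT_comp mV (pair2_measurable t)).
  - apply: emeasurable_sum => j; apply/measurable_EFinP; exact: measurable_indic.
  - move=> z _; rewrite sumEFin lee_fin; apply: ler_sum => j _ /=.
    rewrite !indicE (_ : (z \in B j) = ((retract_flow S z.2 t z.1, j) \in A)); last first.
      by apply/idP/idP => /set_mem h; apply/mem_set.
    rewrite ler_piMl// -(jumpq_sum S (retract_flow S z.2 t z.1) z.2) (bigD1 j)//= lerDl.
    by apply: sumr_ge0 => k _; exact/jumpq_ge0/retract_flow_in.
rewrite ge0_integral_sum//; last by move=> j; apply/measurable_EFinP; exact: measurable_indic.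
rewrite big1// => j _; rewrite integral_indic// setIT.
by apply: mu0 => //; exact: null_slices_preimage.
Qed.

Lemma slice_continuous_law k (mu : giry Z R) :
  slice_continuous mu -> slice_continuous (law (measurable_kernel S) k mu).
Proof. by move=> mu0; elim: k => //= k IH; exact: slice_continuous_push. Qed.

Lemma slice_continuous_dominates (mu : probability Z R) :
  (forall A, measurable A -> null_slices A -> mu A = 0%E) -> mu `<< lebesgue_ME M E.
Proof.
move=> mu0 A nA B mB BA; apply: mu0 => // i.
have h := nA B mB BA; rewrite /lebesgue_ME (bigD1 i)//= in h.
apply/eqP; rewrite eq_le lebesgue_rV_ge0 andbT -h; apply: leeDl.
by apply: sume_ge0 => j _; exact: lebesgue_rV_ge0.
Qed.

(** The hypothesis on [nu] concerns slices in the whole space, [null_slices] only their parts inside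
    the region. The minorization closes the gap: the chain enters the region after one step, so [nu]
    does not charge its complement. *)
Lemma slice_continuous_of_minorization (m : nat) (delta : R) (nu : giry Z R) :
  (0 < m)%N -> 0 < delta ->
  (forall z B, measurable B -> (delta%:E * nu B <= (iter m T \1_B z)%:E)%E) ->
  (forall A, measurable A -> (forall i, lebesgue_rV [set x | A (x, i)] = 0%E) -> nu A = 0%E) ->
  slice_continuous nu.
Proof.
move=> m0 d0 hmin hnull A mA A0.
have mM : measurable M by exact: (measurable_closed_rV (@region_closed _ _ _ S)).
pose O : set Z := ~` (M `*` setT).
have mO : measurable O by apply: measurableC; exact: measurableX.
have nuO : nu O = 0%E.
  have : (delta%:E * nu O <= 0)%E.
    apply: le_trans (hmin point O mO) _; rewrite lee_fin.
    case: m m0 {hmin} => // m _; rewrite iterSr.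
    have -> : T \1_O = (fun z => 0 * (\1_O : Z -> R) z).
      apply/funext => z; rewrite mul0r; apply: EFin_inj; rewrite (op_step_value S z mO).
      apply: integral0_eq => t _; rewrite /step_value big1// => j _.
      rewrite indicE memNset ?mulr0//; apply; split=> //; exact: retract_flow_in.
    by rewrite op_iter_scale ?mul0r//; exact: unit_fun_indic.
  move=> h; apply/eqP; rewrite eq_le measure_ge0 andbT.
  by move: h; rewrite -[leRHS](mule0 delta%:E) lee_pmul2l.
rewrite (_ : A = (A `&` (M `*` setT)) `|` (A `&` O)); last by rewrite -setIUr setUCr setIT.
apply/eqP; rewrite eq_le measure_ge0 andbT.
have mA1 : measurable (A `&` (M `*` setT)) by apply: measurableI => //; exact: measurableX.
have mA2 := measurableI _ _ mA mO.
have hU : (nu ((A `&` (M `*` setT)) `|` (A `&` O)) <=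
    nu (A `&` (M `*` setT)) + nu (A `&` O))%E by exact: measureU2.
apply: le_trans hU _.
rewrite (_ : nu (A `&` O) = 0%E) ?adde0; last first.
  apply/eqP; rewrite eq_le measure_ge0 andbT -nuO.
  by apply: le_measure; rewrite ?inE// => z [].
rewrite hnull//.
move=> i; rewrite -(A0 i); congr lebesgue_rV.
by apply/seteqP; split => x /=; tauto.
Qed.

End absolute_continuity.

(** * The law of the sampled chain *)

Section restricted_probability.
Context {R : realType} d (Omega : measurableType d) (P : probability Omega R).
Variables (C : set Omega) (mC : measurable C).

(** The restriction to [C] is not normalised, as [C] may have probability zero. *)
Definition restricted_probability := mrestr P mC.

HB.instance Definition _ := Measure.on restricted_probability.

Local Lemma restricted_probability_setT : (restricted_probability setT <= 1)%E.
Proof. exact: (probability_le1 P (measurableI _ _ measurableT mC)). Qed.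

HB.instance Definition _ :=
  Measure_isSubProbability.Build _ _ _ restricted_probability restricted_probability_setT.

Definition restricted_law : giry Omega R := restricted_probability.

Lemma restricted_law_integral (f : Omega -> \bar R) : measurable_fun setT f ->
  (forall w, 0 <= f w)%E -> (\int[restricted_law]_w f w = \int[P]_w ((\1_C w)%:E * f w))%E.
Proof.
move=> mf f0; apply: (integral_density (mu := P) (nu := restricted_law) (g := \1_C)) => //.
by move=> A mA; rewrite integral_indic// setIC.
Qed.

End restricted_probability.

Section chain_law.
Context {R : realType} {n : nat} {E : pfinType} (S : switched_flow R n E).
Notation V := 'rV[R]_n.
Notation Z := (V * E)%type.
Notation M := (region S).
Notation T := (op S).
Context (d : measure_display) (Omega : measurableType d) (P : probability Omega R).
Variables (U : nat -> {RV P >-> R}) (X : nat -> {RV P >-> Z}).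
Hypothesis chain : sampled_chain (flow S) M (rate S) (clock S) U X.

Let mU k : measurable_fun setT (U k : Omega -> measurableTypeR R).
Proof. by move=> mT A mA; exact: (@measurable_funP _ _ _ _ _ (U k) mT A mA). Qed.

Let mX k : measurable_fun setT (X k).
Proof. exact: measurable_funP. Qed.

Fixpoint times_event (B : nat -> set (measurableTypeR R)) (s : seq nat) : set Omega :=
  if s is k :: s' then U k @^-1` B k `&` times_event B s' else setT.

Lemma times_eventE B s : times_event B s = \bigcap_(k in [set` s]) (U k @^-1` B k).
Proof.
elim: s => [|k s IH] /=; first by rewrite set_nil bigcap_set0.
rewrite IH; apply/seteqP; split => w /=.
  by move=> [wk ws] l /=; rewrite inE => /orP[/eqP ->//|]; exact: ws.
move=> h; split; first by apply: h; rewrite /= mem_head.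
by move=> l ls; apply: h; rewrite /= inE ls orbT.
Qed.

Lemma measurable_times_event B s : (forall k, measurable (B k)) -> measurable (times_event B s).
Proof.
move=> mB; elim: s => //= k s IH; apply: measurableI => //.
by rewrite -[X in measurable X]setTI; exact: mU.
Qed.

Lemma times_event_prob B s : (forall k, measurable (B k)) -> uniq s ->
  (P (times_event B s) = \prod_(k <- s) P (U k @^-1` B k))%E.
Proof.
move=> mB us; rewrite times_eventE; apply: (chain_U_indep chain) => // k _.
by exists (B k); [exact: mB|exact: setTI].
Qed.

Lemma times_event_ext B B' s : (forall k, k \in s -> B k = B' k) ->
  times_event B s = times_event B' s.
Proof.
elim: s => //= k s IH h; rewrite h ?mem_head// IH// => l ls.
by apply: h; rewrite inE ls orbT.
Qed.

Let history_type k := g_sigma_algebraType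
  ((\bigcup_(l in [set l | (l <= k)%N]) g_sigma_algebra_preimage (X l)) `|`
   (\bigcup_l g_sigma_algebra_preimage (U l))).

Lemma history_event k (W : set (Z * measurableTypeR R)) B s : measurable W ->
  (forall l, measurable (B l)) ->
  history U X k ([set w | W (X k w, U k w)] `&` times_event B s).
Proof.
move=> mW mB.
have mXh : measurable_fun (T := history_type k) setT (X k).
  move=> _ A mA; apply: sub_gen_smallest; left; exists k => //=.
  by exists A; [exact: mA|].
have mUh l : measurable_fun (T := history_type k) setT (U l : Omega -> measurableTypeR R).
  move=> _ A mA; apply: sub_gen_smallest; right; exists l => //=.
  by exists A.
have h1 : measurable ([set w | W (X k w, U k w)] : set (history_type k)).
  have mp := measurable_fun_pair mXh (mUh k).
  by rewrite -[Y in measurable Y]setTI; apply: (mp measurableT W mW).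
apply: (measurableI _ _ h1).
elim: s => [|l s IH] /=; first exact: measurableT.
apply: measurableI => //; rewrite -[Y in measurable Y]setTI.
exact: (mUh l measurableT (B l) (mB l)).
Qed.

(** [U k] drives the step from [X k] to [X k.+1], hence the indices start at [k] itself. The
    definition of the chain gives this independence for the initial state; it has to be carried
    along the chain. *)
Definition independent_of_future k := forall A B s, measurable A ->
  (forall l, measurable (B l)) -> uniq s -> (forall l, l \in s -> (k <= l)%N) ->
  (P (X k @^-1` A `&` times_event B s) = P (X k @^-1` A) * P (times_event B s))%E.

Lemma initial_independent : independent_of_future 0.
Proof.
move=> A B s mA mB us _; apply: (chain_Z0_indep chain).
  by exists A; [exact: mA|exact: setTI].
have mUh l : measurable_fun (T := g_sigma_algebraType (\bigcup_l g_sigma_algebra_preimage (U l)))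
    setT (U l : Omega -> measurableTypeR R).
  by move=> _ C mC; apply: sub_gen_smallest; exists l => //; exists C.
elim: s {us} => [|l s IH] /=; first exact: (@measurableT _ (g_sigma_algebraType _)).
apply: (@measurableI _ (g_sigma_algebraType (\bigcup_l g_sigma_algebra_preimage (U l)))) => //.
rewrite -[Y in measurable Y]setTI.
exact: (mUh l measurableT (B l) (mB l)).
Qed.

Let lawX k : giry Z R := distribution P (X k).

Lemma chain_region k w : M (X k w).1.
Proof.
elim: k w => [|k IH] w; first by have [] := chain_Z0_in chain w.
rewrite (chain_X chain); apply: region_invariant; last exact: IH.
exact: chain_U_ge0 chain _ _.
Qed.

(** On an event about times later than [U k], the pair of [X k] and [U k] still has a product law,
    and [chain_Y] governs the next state. The event factors out, which both identifies the kernel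
    and propagates the independence. *)
Lemma chain_step_event k A B s : measurable A -> (forall l, measurable (B l)) -> uniq s ->
  (forall l, l \in s -> (k < l)%N) -> independent_of_future k ->
  (P (X k.+1 @^-1` A `&` times_event B s) =
   P (times_event B s) * (mean (lawX k) (T \1_A))%:E)%E.
Proof.
move=> mA mB us ks indep.
set C := times_event B s; have mC : measurable C by exact: measurable_times_event.
have uA := unit_fun_indic (R := R) mA.
have mV := measurable_step_value S mA.
have mVE : measurable_fun setT (fun q : Z * measurableTypeR R => (step_value S A q)%:E).
  exact/measurable_EFinP.
have V0 q : (0 <= (step_value S A q)%:E)%E by rewrite lee_fin step_value_ge0.
pose pr w : Z * measurableTypeR R := (X k w, U k w).
have mpr : measurable_fun setT pr by apply: measurable_fun_pair; [exact: mX|exact: mU].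
have next w : retract_flow S (X k w).2 (U k w) (X k w).1 = (X k.+1 w).1.
  rewrite (chain_X chain) /retract_flow ger0_norm ?(chain_U_ge0 chain)// retr_id//.
  exact: chain_region.
have mZ := @measurable_retract_flow _ _ _ S.
pose Wj j : set (Z * measurableTypeR R) := [set q | A (retract_flow S q.1.2 q.2 q.1.1, j)].
have mW j : measurable (Wj j).
  have m1 := measurableT_comp (@measurable_fst _ _ V E) (measurable_flow_map mZ).
  have m2 := measurableT_comp (pair2_measurable j) m1.
  by rewrite -[Y in measurable Y]setTI; apply: (m2 measurableT A mA).
pose G j := [set w | Wj j (pr w)] `&` C.
have mY j : measurable [set w | (X k.+1 w).2 = j].
  have := measurableT_comp (@measurable_snd _ _ V E) (mX k.+1).
  by move=> /(_ measurableT [set j] I); rewrite setTI.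
have mG j : measurable (G j).
  apply: measurableI => //; rewrite -[Y in measurable Y]setTI; apply: (mpr measurableT _ (mW j)).
(* The event is split along the value of the next state. On each part the new position is a function
   of [X k] and [U k], so the part is cut out by a history event and [chain_Y] applies. *)
have s1 : (P (X k.+1 @^-1` A `&` C) = \sum_j P (G j `&` [set w | (X k.+1 w).2 = j]))%E.
  have mS : measurable (X k.+1 @^-1` A `&` C).
    by apply: measurableI => //; rewrite -[Y in measurable Y]setTI; exact: mX.
  have Pint B' : measurable B' -> P B' = (\int[P]_w (\1_B' w)%:E)%E.
    by move=> mB'; rewrite integral_indic// setIT.
  rewrite (Pint _ mS) [RHS](eq_bigr (fun j =>
    \int[P]_w (\1_(G j `&` [set w | (X k.+1 w).2 = j]) w)%:E)%E); last first.
    by move=> j _; apply: Pint; exact: measurableI.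
  have mI j : measurable_fun setT (fun w => (\1_(G j `&` [set w | (X k.+1 w).2 = j]) w)%:E : \bar R).
    by apply/measurable_EFinP; apply: measurable_indic; exact: measurableI.
  rewrite -ge0_integral_sum//.
  apply: eq_integral => w _; rewrite (bigD1 (X k.+1 w).2)//= big1 => [|j jne].
    rewrite adde0; congr (_%:E); rewrite !indicE; congr (_%:R); congr nat_of_bool.
    apply/idP/idP => /set_mem h; apply/mem_set; move: h.
      rewrite /G /Wj /pr /= next => -[h1 h2]; split=> //; split=> //=.
      by case: (X k.+1 w) h1.
    rewrite /G /Wj /pr /= next => -[[h1 h2] _]; split=> //=.
    by case: (X k.+1 w) h1.
  rewrite indicE memNset// => -[_ /= e]; move: jne; by rewrite e eqxx.
have s2 j : (P (G j `&` [set w | (X k.+1 w).2 = j]) =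
    \int[P]_w ((\1_C w)%:E * (jumpq S (X k.+1 w).1 (X k w).2 j * \1_A ((X k.+1 w).1, j))%:E))%E.
  rewrite (chain_Y chain); last exact: history_event.
  rewrite integral_mkcond; apply: eq_integral => w _; rewrite patchE -EFinM.
  have -> : (w \in G j) = ((w \in C) && (((X k.+1 w).1, j) \in A)).
    rewrite -next; apply/idP/andP => [/set_mem[h1 h2]|[/set_mem h1 /set_mem h2]].
      by split; apply/mem_set.
    by apply/mem_set.
  rewrite !indicE; case: (w \in C); case: (_ \in A) => /=;
    by rewrite ?mul1r ?mul0r ?mulr1 ?mulr0.
have s3 : (P (X k.+1 @^-1` A `&` C) =
    giry_int (giry_map mpr (restricted_law P mC)) (fun q => (step_value S A q)%:E))%E.
  have mVp : measurable_fun setT (fun w => (step_value S A (pr w))%:E).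
    exact: (measurableT_comp mVE mpr).
  rewrite giry_int_map// /giry_int restricted_law_integral//.
  rewrite s1; under eq_bigr => j _ do rewrite s2.
  rewrite -ge0_integral_sum//.
  - apply: eq_integral => w _; rewrite -ge0_sume_distrr; last first.
      move=> j _; rewrite lee_fin mulr_ge0// -next; exact/jumpq_ge0/retract_flow_in.
    by rewrite sumEFin /step_value /= next.
  - move=> j; apply: emeasurable_funM; first by apply/measurable_EFinP; exact: measurable_indic.
    apply/measurable_EFinP.
    have mt := measurableT_comp (measurable_step_term S j mA) mpr.
    by apply: eq_measurable_fun mt => w _; rewrite /= next.
  - move=> j w _; rewrite -EFinM lee_fin !mulr_ge0// -next; exact/jumpq_ge0/retract_flow_in.
  by move=> w; exact: V0.
pose m1 : giry Z R := giry_map (mX k) (restricted_law P mC).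
(* A measure on the product is determined by its values on rectangles, where independence is
   available. *)
have prodE W : measurable W ->
    giry_map mpr (restricted_law P mC) W = giry_prod (m1, clock_law S : giry _ R) W.
  move=> mWW; apply/esym; apply: (product_measure_unique (m1 := m1) (m2 := clock_law S)
    (m' := giry_map mpr (restricted_law P mC))) => // A1 A2 mA1 mA2.
  (* [B'] places [A2] at the index [k], which does not occur in [s]; the independence hypothesis is
     then used with [k :: s]. *)
  pose B' l := if l == k then A2 else B l.
  have mB' l : measurable (B' l) by rewrite /B'; case: ifP.
  have kns : k \notin s by apply/negP => /ks; rewrite ltnn.
  have CE : C = times_event B' s.
    apply: times_event_ext => l ls; rewrite /B'; case: eqP => // lk.
    by move: kns; rewrite -lk ls.
  have e1 : times_event B' (k :: s) = U k @^-1` A2 `&` C by rewrite /= -CE /B' eqxx.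
  have us' : uniq (k :: s) by rewrite /= kns.
  have ks' l : l \in k :: s -> (k <= l)%N by rewrite inE => /orP[/eqP ->//|/ks/ltnW].
  have ks0 l : l \in s -> (k <= l)%N by move=> /ks/ltnW.
  have P1 : (P (U k @^-1` A2 `&` C) = P (U k @^-1` A2) * P C)%E.
    by rewrite -e1 times_event_prob// big_cons -times_event_prob// -CE /B' eqxx.
  have PU : P (U k @^-1` A2) = clock_law S A2 by exact: (chain_U_law chain).
  rewrite -[LHS]/(P ([set w | (A1 `*` A2) (pr w)] `&` C)).
  rewrite -[RHS]/(P (X k @^-1` A1 `&` C) * clock_law S A2)%E.
  rewrite (indep A1 B s mA1 mB us ks0) -PU.
  rewrite (_ : _ `&` C = X k @^-1` A1 `&` times_event B' (k :: s)); last first.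
    by rewrite e1 setIA.
  by rewrite (indep A1 B' (k :: s) mA1 mB' us' ks') e1 P1 (muleC (P (U k @^-1` A2)) (P C)) muleA.
rewrite s3 /giry_int (eq_measure_integral (giry_prod (m1, clock_law S : giry _ R))); last first.
  by move=> W mWW _; exact: prodE.
rewrite [LHS](giry_int_prod1 m1 (clock_law S) mVE V0).
have Cfin : P C = (fine (P C))%:E by rewrite fineK// fin_num_measure.
have C0 : 0 <= fine (P C) by exact: fine_ge0.
have uTA : unit_fun (T \1_A : Z -> R).
  by apply: unit_fun_op => //; [exact: measurable_kernel|exact: kernel_setT].
rewrite -meanE// Cfin -(ge0_integral_mscale _ measurableT (NngNum C0)); last 2 first.
- by apply/measurable_EFinP; case: uTA.
- by move=> z _; rewrite lee_fin; case/andP: (uTA.2 z).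
rewrite /giry_int; under eq_integral => z _ do rewrite -(op_step_value S z mA).
apply: eq_measure_integral => A1 mA1 _.
rewrite -[LHS]/(P (X k @^-1` A1 `&` C)) -[RHS]/((fine (P C))%:E * P (X k @^-1` A1))%E.
by rewrite (indep A1 B s mA1 mB us) -?Cfin 1?muleC// => l /ks/ltnW.
Qed.

(** With no later times, [chain_step_event] says that the mean in its conclusion is the probability
    that [X k.+1] lies in [A]; the general case is then the independence at the next index. *)
Lemma future_independent k : independent_of_future k.
Proof.
elim: k => [|k IH]; first exact: initial_independent.
move=> A B s mA mB us ks; rewrite chain_step_event// muleC.
have := chain_step_event mA mB (s := [::]) isT (fun _ h => ltac:(by [])) IH.
by rewrite /= setIT probability_setT mul1e => ->.
Qed.

Lemma chain_law_step k A : measurable A ->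
  distribution P (X k.+1) A = push (measurable_kernel S) (lawX k) A.
Proof.
move=> mA; rewrite -[RHS]mean_indic// mean_push; last exact: unit_fun_indic.
have := chain_step_event mA (fun _ => measurableT) (s := [::]) isT
  (fun _ h => ltac:(by [])) (@future_independent k) (B := fun=> setT).
by rewrite /= setIT probability_setT mul1e.
Qed.

Lemma chain_law k A : measurable A ->
  distribution P (X k) A = law (measurable_kernel S) k (distribution P (X 0%N)) A.
Proof.
elim: k A => // k IH A mA; rewrite chain_law_step//.
have uA := unit_fun_indic (R := R) mA.
apply: (giry_mean_ext (mu := push _ (lawX k)) (nu := push _ (law _ k _)) mA).
by rewrite !mean_push//; congr fine; apply: eq_measure_integral => B mB _; exact: IH.
Qed.

End chain_law.

(** * Invariance, absolute continuity and rate of convergence *)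

Section conclusion.
Context {R : realType} {n : nat} {E : pfinType} (S : switched_flow R n.+1 E) (p : 'rV[R]_n.+1).
Notation V := 'rV[R]_n.+1.
Notation Z := (V * E)%type.
Notation M := (region S).
Hypotheses (p_accessible : accessible_set (flow S) M p)
  (p_bracket : weak_bracket_condition (field S) p).

Lemma accessible_in : M p.
Proof.
apply: (@region_closed _ _ _ S) => B nB.
have [y [[m [i [u [_ u0 ->]]]] By]] := p_accessible (base_in S) nB.
exists (composite_flow (flow S) i u m (base S)); split=> //.
elim: m {By} => [|m IH] /=; first exact: base_in.
exact: region_invariant.
Qed.

Let mk := measurable_kernel S.

Lemma state_space_measurable : measurable (state_space M : set Z).
Proof.
by apply: measurableX => //; exact: (measurable_closed_rV (@region_closed _ _ _ S)).
Qed.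

Lemma push_state_space (mu : giry Z R) : mu setT = 1%E -> push mk mu (state_space M) = 1%E.
Proof.
move=> mu1; have mS := state_space_measurable; have uS := unit_fun_indic (R := R) mS.
rewrite -mean_indic// mean_push//.
have -> : markov_op (kernel S) \1_(state_space M) = cst 1.
  apply/funext => z; apply: EFin_inj; rewrite [LHS](op_step_value S z mS).
  rewrite (eq_integral (cst 1%E)) ?integral_cst//.
    by rewrite -[X in (_ * X)%E]/(clock_law S setT) probability_setT mule1.
  move=> t _; congr (_%:E).
  rewrite /step_value -[RHS](jumpq_sum S (retract_flow S z.2 t z.1) z.2).
  apply: eq_bigr => j _; rewrite indicE mem_set ?mulr1//.
  by split=> //; exact: retract_flow_in.
by rewrite mean_const.
Qed.

(** [transition] agrees with the kernel on the region, and the complement of the region is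
    negligible for [mu]. *)
Lemma push_transition (mu : giry Z R) A : mu setT = 1%E -> mu (state_space M) = 1%E ->
  measurable A ->
  push mk mu A = (\int[mu]_(z in state_space M) transition (flow S) (rate S) (clock S) z A)%E.
Proof.
move=> mu1 muM mA; have mS := state_space_measurable.
have uA := unit_fun_indic (R := R) mA.
have uK : unit_fun (op S \1_A) by apply: unit_fun_op => //; exact: kernel_setT.
have [mK K01] := uK.
have mKE : measurable_fun setT (fun z => (op S \1_A z)%:E) by exact/measurable_EFinP.
rewrite -mean_indic// mean_push// -meanE//.
rewrite -(setUv (state_space M)) ge0_integral_setU//; last 4 first.
- exact: measurableC.
- by rewrite setUv.
- by move=> z _; rewrite lee_fin; case/andP: (K01 z).
- by apply/disj_setPS => z [].
rewrite [X in (_ + X)%E](_ : _ = 0%E) ?adde0.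
  apply: eq_integral => z /set_mem zM; rewrite -kernel_transition//.
  exact: mean_indic.
have muC : mu (~` state_space M) = 0%E.
  have e : (mu setT = mu (state_space M) + mu (~` state_space M))%E.
    by rewrite -measureU ?setUv//; [exact: measurableC|exact: setICr].
  have xf : mu (~` state_space M) = (fine (mu (~` state_space M)))%:E.
    by rewrite fineK// fin_num_measure//; exact: measurableC.
  rewrite mu1 muM xf -EFinD in e; rewrite xf; congr (_%:E).
  by case: e => e; apply: (addrI (1 : R)); rewrite -e addr0.
have mC : measurable (~` state_space M : set Z) by exact: measurableC.
apply: (null_set_integral mC) => //; exact: (measurable_funTS mKE).
Qed.

Theorem switched_flow_ergodic : exists pi : probability Z R,
  [/\ invariant_probability (flow S) M (rate S) (clock S) pi,
      forall nu : probability Z R, invariant_probability (flow S) M (rate S) (clock S) nu ->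
        forall A, measurable A -> nu A = pi A,
      pi `<< lebesgue_ME M E &
      exists c rho : R, [/\ 1 < c, 0 < rho < 1 &
        forall (dO : measure_display) (Omega : measurableType dO) (P : probability Omega R)
               (U : nat -> {RV P >-> R}) (X : nat -> {RV P >-> Z}),
          sampled_chain (flow S) M (rate S) (clock S) U X ->
          forall k, (tv_norm (prob_diff (distribution P (X k)) pi) <= (c * rho ^+ k)%:E)%E]].
Proof.
have [m [delta [nu [m0 /andP[d0 d1] nu1 hmin hnull]]]] :=
  doeblin_minorization accessible_in p_accessible p_bracket.
have sc := slice_continuous_of_minorization m0 d0 hmin hnull.
have K1 := kernel_setT S.
have [pi [inv conv uni]] := doeblin_invariant_law mk K1 m0 d0 d1 nu1 hmin.
have pi1 : pi setT = 1%E by exact: probability_setT.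
have piM : pi (state_space M) = 1%E.
  rewrite -inv; last exact: state_space_measurable.
  exact: push_state_space.
exists pi; split.
- split=> // A mA; rewrite -[LHS]inv//; exact: push_transition.
- move=> mu [muM muinv] A mA; apply: uni => // B mB.
  rewrite (muinv B mB); apply: push_transition => //; exact: probability_setT.
- apply: slice_continuous_dominates => A mA A0.
  (* The laws started from [nu] vanish on [A] at every step, so the distance to [pi] bounds [pi A]
     itself. *)
  have small k : `|fine (pi A)| <= doeblin_const m delta * doeblin_rate m delta ^+ k.
    have := conv nu k A nu1 mA; rewrite (slice_continuous_law k sc)//.
    by rewrite /= sub0r normrN.
  have p0 : fine (pi A) = 0.
    apply: (@small_eq0 _ _ 1) => // e e0.
    have [k hk] := small_rate m0 d0 d1 e0.
    by rewrite mul1r; exact: le_trans (small k) hk.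
  by rewrite -[LHS]fineK ?p0// fin_num_measure.
- have c1 : 1 < doeblin_const m delta by exact: doeblin_const_gt1.
  (* The factor 2 comes from [tv_norm_le]: the total variation adds the deviations on both parts of
     a Hahn decomposition. *)
  exists (2 * doeblin_const m delta), (doeblin_rate m delta); split.
  + lra.
  + exact: doeblin_rate01.
  move=> dO Omega P U X chain k; rewrite -mulrA; apply: tv_norm_le => A mA.
  have P1 : (distribution P (X 0%N) : giry Z R) setT = 1%E by exact: probability_setT.
  pose B x := `|fine x - fine (pi A)| <= doeblin_const m delta * doeblin_rate m delta ^+ k.
  exact: (eq_ind _ B (conv _ k A P1 mA) _ (esym (chain_law chain k mA))).
Qed.

End conclusion.

Unset Implicit Arguments.

Theorem theorem4p5 (R : realType) (d : nat) (hd : (1 <= d)%N) (E : pfinType)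
  (F : E -> 'rV[R]_d -> 'rV[R]_d)
  (F_smooth : forall i, smooth (F i))
  (F_bounded : forall i, bounded_field (F i))
  (Phi : E -> R -> 'rV[R]_d -> 'rV[R]_d)
  (Phi_flow : forall i, is_flow (F i) (Phi i))
  (M : set 'rV[R]_d) (M_nonempty : M !=set0) (M_compact : compact M)
  (M_invariant : forall i (t : R) x, 0 <= t -> M x -> M (Phi i t x))
  (lam : 'rV[R]_d -> E -> E -> R)
  (lam_continuous : forall i j, {within M, continuous (fun x => lam x i j)})
  (lam_ge0 : forall x i j, M x -> i != j -> 0 <= lam x i j)
  (lam_diag : forall x i, M x -> lam x i i = 0)
  (lam_irreducible : forall x, M x ->
     forall i j, connect (fun k l => 0 < lam x k l) i j)
  (lambda : R)
  (lambda_gt : forall x i, M x -> \sum_(j | j != i) lam x i j < lambda)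
  (p : 'rV[R]_d) (p_accessible : accessible_set Phi M p)
  (p_bracket : weak_bracket_condition F p) :
  exists pi : probability ('rV[R]_d * E)%type R,
    [/\ invariant_probability Phi M lam lambda pi,
        forall nu : probability ('rV[R]_d * E)%type R,
          invariant_probability Phi M lam lambda nu ->
          forall A, measurable A -> nu A = pi A,
        pi `<< lebesgue_ME M E &
        exists c rho : R,
          [/\ 1 < c, 0 < rho < 1 &
              forall (dO : measure_display) (Omega : measurableType dO)
                     (P : probability Omega R)
                     (U : nat -> {RV P >-> R})
                     (Z : nat -> {RV P >-> ('rV[R]_d * E)%type}),
                sampled_chain Phi M lam lambda U Z ->
                forall n,
                  (tv_norm (prob_diff (distribution P (Z n)) pi)
                     <= (c * rho ^+ n)%:E)%E]].
Proof.
(* Volume estimates are available in dimension [n.+1]; [hd] excludes dimension 0. *)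
case: d hd F F_smooth F_bounded Phi Phi_flow M M_nonempty M_compact M_invariant lam
  lam_continuous lam_ge0 lam_diag lam_irreducible lambda_gt p p_accessible p_bracket => //.
move=> n _ F F_smooth F_bounded Phi Phi_flow M [x0 Mx0] M_compact M_invariant lam
  lam_continuous lam_ge0 _ lam_irreducible lambda_gt p p_accessible p_bracket.
have /choice[K hK] := F_bounded.
have F_le i x : `|F i x| <= \sum_j `|K j|.
  apply: le_trans (hK i x) _; apply: le_trans (ler_norm _) _.
  by rewrite (bigD1 i)//= lerDl sumr_ge0.
pose S := SwitchedFlow F_smooth F_le Phi_flow M_compact Mx0 M_invariant lam_continuous
  lam_ge0 lam_irreducible lambda_gt.
exact: (switched_flow_ergodic (S := S) p_accessible p_bracket).
Qed.
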